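(* Quantum advantage samplers (QASs) exist if and only if non-interactive IV-PoQ exist.
   Context: Conventions: $\lambda$ is the security parameter; PPT = classical probabilistic polynomial-time, QPT = quantum polynomial-time; all algorithms are uniform. For an algorithm $\mathcal{A}$ outputting strings, $\mathcal{A}(1^\lambda)$ also denotes its output distribution; $\mathrm{SD}$ is statistical distance. QAS: a QPT algorithm $\mathcal{A}$ that on input $1^\lambda$ outputs a classical string, such that there exists a polynomial $p$ such that for every PPT algorithm $\mathcal{B}$ (taking $1^\lambda$, outputting a classical string), for all sufficiently large $\lambda$, $\mathrm{SD}(\mathcal{A}(1^\lambda),\mathcal{B}(1^\lambda))>1/p(\lambda)$. Non-interactive IV-PoQ: a pair $(\mathcal{P},\mathcal{V}_2)$ where $\mathcal{P}$ is QPT and on input $1^\lambda$ outputs a classical string $\tau$, and $\mathcal{V}_2$ is unbounded and on input $(1^\lambda,\tau)$ outputs $\top/\bot$, such that there exist $c,s$ with $c(\lambda)-s(\lambda)\ge 1/\mathrm{poly}(\lambda)$ with: for all sufficiently large $\lambda$, $\Pr[\top\gets\mathcal{V}_2(1^\lambda,\tau):\tau\gets\mathcal{P}(1^\lambda)]\ge c(\lambda)$; and for every PPT $\mathcal{P}^*$, for all sufficiently large $\lambda$, $\Pr[\top\gets\mathcal{V}_2(1^\lambda,\tau):\tau\gets\mathcal{P}^*(1^\lambda)]\le s(\lambda)$. *)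

(* Defs.v *)
From HB Require Import structures.
From mathcomp Require Import all_boot all_order all_algebra all_field.
Set Implicit Arguments. Unset Strict Implicit. Unset Printing Implicit Defensive.
Import Order.TTheory GRing.Theory Num.Theory.
Local Open Scope ring_scope.

Inductive sym := Blank | Zero | One | Hash.

(* A probabilistic TM: finitely many states 'I_(nst.+2) (start = ord0,
   halt = ord_max); at every step a fresh fair coin is read.
   The move bit is true = right, false = left (stay at cell 0). *)
Record PTM := MkPTM {
  nst : nat;
  trans : 'I_nst.+2 -> sym -> bool -> 'I_nst.+2 * sym * bool }.

Record config (M : PTM) := Config {
  cstate : 'I_(nst M).+2; ctape : nat -> sym; chead : nat }.

Definition halt_state (M : PTM) : 'I_(nst M).+2 := ord_max.

Definition step (M : PTM) (cf : config M) (b : bool) : config M :=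
  if cstate cf == halt_state M then cf else
  let: (q', a, mv) := trans (cstate cf) (ctape cf (chead cf)) b in
  @Config M q' (fun i => if i == chead cf then a else ctape cf i)
           (if mv then (chead cf).+1 else (chead cf).-1).

Definition init_config (M : PTM) (w : seq sym) : config M :=
  @Config M ord0 (fun i => nth Blank w i) 0%N.

Definition run (M : PTM) (w : seq sym) (coins : seq bool) : config M :=
  foldl (@step M) (init_config M w) coins.

Fixpoint bits_prefix (l : seq sym) : seq bool :=
  match l with
  | Zero :: l' => false :: bits_prefix l'
  | One :: l' => true :: bits_prefix l'
  | _ => [::]
  end.

(* output = maximal block of bits starting at cell 0 (cells beyond
   size coins + size w are necessarily blank) *)
Definition output (M : PTM) (w : seq sym) (coins : seq bool) : seq bool :=
  bits_prefix (map (ctape (run M w coins)) (iota 0 (size coins + size w))).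

Definition halts_within (M : PTM) (T : nat) (w : seq sym) : Prop :=
  forall c : T.-tuple bool, cstate (run M w c) = halt_state M.

(* Pr[M(w) = s] when T coins suffice (i.e. under halts_within M T w) *)
Definition outprob (M : PTM) (T : nat) (w : seq sym) (s : seq bool) : algC :=
  (#|[set c : T.-tuple bool | output M w c == s]|)%:R / 2%:R ^+ T.

Definition accprob (M : PTM) (T : nat) (w : seq sym) : algC :=
  (#|[set c : T.-tuple bool | head false (output M w c)]|)%:R / 2%:R ^+ T.

Definition tb (k l : nat) : nat := (k * l ^ k + k)%N.

Definition ones (l : nat) : seq sym := nseq l One.

Definition is_PPT (M : PTM) (k : nat) : Prop :=
  forall l, halts_within M (tb k l) (ones l).

(* output distribution of the PPT algorithm (M,k) on 1^lambda;
   supported on strings of length <= tb k l + l *)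
Definition ppt_dist (M : PTM) (k l : nat) (s : seq bool) : algC :=
  outprob M (tb k l) (ones l) s.

Inductive gate := GH of nat | GT of nat | GCX of nat & nat.

Fixpoint read_unary (s : seq bool) : nat * seq bool :=
  match s with
  | true :: s' => let: (k, r) := read_unary s' in (k.+1, r)
  | false :: s' => (0%N, s')
  | [::] => (0%N, [::])
  end.

Fixpoint dec_gates (fuel : nat) (s : seq bool) : seq gate :=
  match fuel with
  | 0 => [::]
  | fuel'.+1 =>
    match s with
    | false :: false :: s' => let: (i, r) := read_unary s' in GH i :: dec_gates fuel' r
    | false :: true :: s' => let: (i, r) := read_unary s' in GT i :: dec_gates fuel' r
    | true :: false :: s' =>
        let: (c, r) := read_unary s' in
        let: (t, r') := read_unary r in GCX c t :: dec_gates fuel' r'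
    | _ => [::]
    end
  end.

(* circuit description: (number of qubits n, number of measured qubits m, gates) *)
Definition decode_circ (s : seq bool) : nat * nat * seq gate :=
  let: (n, r) := read_unary s in
  let: (m, r') := read_unary r in (n, m, dec_gates (size r') r').

Definition omega8 : algC := (1 + 'i) / sqrtC 2%:R.

(* a state on n qubits: amplitude of each bit string of length n *)
Definition apply_gate (n : nat) (g : gate) (f : seq bool -> algC) : seq bool -> algC :=
  match g with
  | GH i => if (i < n)%N then fun x =>
              (f (set_nth false x i false)
               + (if nth false x i then -1 else 1) * f (set_nth false x i true))
              / sqrtC 2%:R
            else f
  | GT i => if (i < n)%N then fun x => (if nth false x i then omega8 else 1) * f x
            else f
  | GCX c t => if [&& (c < n)%N, (t < n)%N & c != t] then
                 fun x => f (set_nth false x t (nth false x t (+) nth false x c))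
               else f
  end.

Definition final_amp (n : nat) (gs : seq gate) : seq bool -> algC :=
  foldl (fun f g => apply_gate n g f) (fun x => (x == nseq n false)%:R) gs.

(* measured output: the first m qubits, decoded pairwise
   ("1b" = bit b, anything else = end of string) *)
Fixpoint decode_out (s : seq bool) : seq bool :=
  match s with
  | true :: b :: s' => b :: decode_out s'
  | _ => [::]
  end.

Definition circprob (d : nat * nat * seq gate) (s : seq bool) : algC :=
  let: (n, m, gs) := d in
  \sum_(x : n.-tuple bool | decode_out (take m x) == s) `|final_amp n gs x| ^+ 2.

(* QPT algorithm given by a PPT circuit generator (M, k): on 1^lambda,
   run (M,k), decode its output as a circuit, run it and measure.
   Output supported on strings of length <= tb k l + l. *)
Definition qpt_dist (M : PTM) (k l : nat) (s : seq bool) : algC :=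
  (2%:R ^+ tb k l)^-1 *
  \sum_(c : (tb k l).-tuple bool) circprob (decode_circ (output M (ones l) c)) s.

(* statistical distance of distributions supported on strings of length <= L *)
Definition sd (L : nat) (P Q : seq bool -> algC) : algC :=
  2%:R^-1 * \sum_(j < L.+1) \sum_(t : j.-tuple bool) `|P t - Q t|.

(* E_{tau <- P}[f tau] for P supported on strings of length <= L *)
Definition expect (L : nat) (P f : seq bool -> algC) : algC :=
  \sum_(j < L.+1) \sum_(t : j.-tuple bool) P t * f t.

Definition pval (p : {poly rat}) (l : nat) : algC := ratr p.[l%:R].

Definition QAS_exist : Prop :=
  exists (A : PTM) (kA : nat), is_PPT A kA /\
  exists p : {poly rat},
  forall (B : PTM) (kB : nat), is_PPT B kB ->
  exists l0, forall l, (l0 <= l)%N ->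
    0 < pval p l /\
    (pval p l)^-1 < sd (tb kA l + tb kB l + l) (qpt_dist A kA l) (ppt_dist B kB l).

Definition vinput (l : nat) (tau : seq bool) : seq sym :=
  ones l ++ Hash :: map (fun b : bool => if b then One else Zero) tau.

(* unbounded (always halting) randomized verifier V; tV l tau is a bound on
   its running time on input (1^l, tau) for every coin sequence *)
Definition is_verifier (V : PTM) (tV : nat -> seq bool -> nat) : Prop :=
  forall l tau, halts_within V (tV l tau) (vinput l tau).

Definition vacc (V : PTM) (tV : nat -> seq bool -> nat) (l : nat) (tau : seq bool) : algC :=
  accprob V (tV l tau) (vinput l tau).

Definition IVPoQ_exist : Prop :=
  exists (P : PTM) (kP : nat), is_PPT P kP /\
  exists (V : PTM) (tV : nat -> seq bool -> nat), is_verifier V tV /\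
  exists c s : nat -> algC,
    (exists p : {poly rat}, exists l0, forall l, (l0 <= l)%N ->
        0 < pval p l /\ (pval p l)^-1 <= c l - s l) /\
    (exists l0, forall l, (l0 <= l)%N ->
        c l <= expect (tb kP l + l) (qpt_dist P kP l) (vacc V tV l)) /\
    (forall (B : PTM) (kB : nat), is_PPT B kB ->
       exists l0, forall l, (l0 <= l)%N ->
         expect (tb kB l + l) (ppt_dist B kB l) (vacc V tV l) <= s l).

(* Main.v *)
(* A sampler A is turned into a proof of quantumness by the correspondence between sampling
   and search problems. The prover outputs N independent samples tau of A, written by a
   single circuit consisting of N disjoint copies. Let M be the mixture of all classical
   algorithms in which a machine has weight 2 to the minus its code length. The verifier
   accepts tau when M(tau) <= D P(tau), where P is the exact output distribution of the
   prover. As M has total mass at most 1, an honest prover fails with probability at most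
   1/D. A PPT prover B satisfies B <= C M with a constant C, so where it is accepted its
   distribution is at most C D P. Under P the frequency of any event among the N samples has
   variance at most 1/N. Hence, if B were accepted with probability above 1 - 2/D, a random
   one of the N samples output by B would have a distribution within 4/D of that of A,
   which contradicts the hardness of sampling from A once N >= C D^3.
   Conversely, the acceptance probability of the verifier distinguishes the honest prover
   from every PPT algorithm, so the prover itself is a sampler.
   Machines are written as programs over a fixed number of stacks of bits, compiled to
   Turing machines; a calculus of programs on serialized trees then yields the closure
   properties of computable and of polynomial-time functions. *)
From HB Require Import structures.
From mathcomp Require Import all_boot all_order all_algebra all_field.
From mathcomp Require Import zify ring.
From Stdlib Require Import FunctionalExtensionality.
Require Import Defs.
Set Implicit Arguments. Unset Strict Implicit. Unset Printing Implicit Defensive.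
Import Order.TTheory GRing.Theory Num.Theory.

(** * Paths of a coin-tossing machine *)

(** The mixture stands in for Kolmogorov complexity. It dominates every PPT distribution up to a
    constant, and a verifier that always halts can evaluate it, because at parameter [l] only
    programs of [l] bits run, for [tb l l] steps. It has to be compared with the prover's
    distribution without rounding: amplitudes are sums of powers of [omega8] divided by powers of
    sqrt 2, so after enumerating all paths the test is one inequality in Z[sqrt 2]. Decoding of a
    measured string stops at its first end marker, so plain juxtaposition of copies would lose
    everything after the first copy that ends early. Each qubit is therefore rewritten in a code of
    fixed width with a mask, and the end markers of the copies are interpreted afterwards, by a
    classical function of tau. The constant C depends on the cheating prover but N may not; N
    carries a spare factor of order l, which exceeds C for large l. N is a power of two, so that
    fair coins choose a uniform sample exactly. *)

Definition sym_code (s : sym) : bool * bool :=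
  match s with
  | Blank => (false, false) | Zero => (false, true)
  | One => (true, false) | Hash => (true, true)
  end.
Definition sym_decode (p : bool * bool) : sym :=
  match p with
  | (false, false) => Blank | (false, true) => Zero
  | (true, false) => One | (true, true) => Hash
  end.
Lemma sym_codeK : cancel sym_code sym_decode. Proof. by case. Qed.
HB.instance Definition _ := Finite.copy sym (can_type sym_codeK).


Section Path.
Variables (X : Type) (stp : X -> bool -> X).

(** A coin is read at every step, but only steps with two different outcomes consume randomness: [r]
    lists the coins of these steps alone, while [n] counts all steps. *)
Inductive path : X -> seq bool -> nat -> X -> Prop :=
| path0 x : path x [::] 0 x
| pathD x y r n z : stp x true = y -> stp x false = y ->
    path y r n z -> path x r n.+1 z
| pathC x b r n z : stp x true <> stp x false ->
    path (stp x b) r n z -> path x (b :: r) n.+1 z.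

Lemma path_trans x r n y r' n' z :
  path x r n y -> path y r' n' z -> path x (r ++ r') (n + n') z.
Proof.
move=> p; elim: p r' n' z => {x r n y} [x //| x y r n z h1 h2 p IH|x b r n z h p IH] r' n' w q.
  by rewrite addSn; apply: (pathD h1 h2); apply: IH.
by rewrite addSn /=; apply: pathC => //; apply: IH.
Qed.

Lemma path_inv x r n z : path x r n z ->
  [\/ [/\ r = [::], n = 0 & z = x],
      exists y n', [/\ n = n'.+1, stp x true = y, stp x false = y & path y r n' z]
    | exists b r' n', [/\ r = b :: r', n = n'.+1, stp x true <> stp x false
                        & path (stp x b) r' n' z]].
Proof.
case=> {x r n z} [x|x y r n z h1 h2 p|x b r n z h p].
- by constructor 1.
- by constructor 2; exists y, n.
- by constructor 3; exists b, r, n.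
Qed.

Lemma path_halted x r n z : (forall b, stp x b = x) -> path x r n z -> r = [::] /\ z = x.
Proof.
move=> hx p; elim: p hx => {x r n z} [x //|x y r n z h1 h2 p IH|x b r n z h p IH] hx.
  have e : y = x by rewrite -h1 hx.
  by rewrite e in IH; apply: IH.
by case: h; rewrite !hx.
Qed.

Lemma path_size x r n z : path x r n z -> size r <= n.
Proof. by elim => //= *; lia. Qed.
End Path.

Local Open Scope ring_scope.

Lemma half_add (a : algC) : (a + a) / 2%:R = a.
Proof. by have h : 2%:R != 0 :> algC by [rewrite pnatr_eq0]; field. Qed.

(** Expectation over [n] fair coins, by recursion so that an induction along a run peels off one
    coin at a time. *)
Fixpoint avg (n : nat) (h : seq bool -> algC) : algC :=
  if n is n'.+1 then
    (avg n' (fun c => h (false :: c)) + avg n' (fun c => h (true :: c))) / 2%:R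
  else h [::].

Lemma eq_avg n h1 h2 : (forall c, size c = n -> h1 c = h2 c) -> avg n h1 = avg n h2.
Proof.
elim: n h1 h2 => [|n IH] h1 h2 e /=; first exact: e.
by congr ((_ + _) / _); apply: IH => c hc; apply: e; rewrite /= hc.
Qed.

Lemma avg_const n a : avg n (fun=> a) = a.
Proof.
by elim: n => //= n ->; rewrite half_add.
Qed.

Section Halting.
Variables (X : Type) (stp : X -> bool -> X).

Lemma avg_halted x T (g : X -> algC) : (forall b, stp x b = x) ->
  avg T (fun c => g (foldl stp x c)) = g x.
Proof.
move=> hx; rewrite -[RHS](avg_const T); apply: eq_avg => c _.
by congr (g _); elim: c => //= b c; rewrite hx.
Qed.

(** The [T] coins supplied are reduced to the [m] coins that matter: a [pathD] step averages two
    equal halves, a [pathC] step consumes the first bit of [r], and coins after halting change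
    nothing. The number of steps may depend on [r], the number of relevant coins may not. *)
Lemma avg_path T m x (F : seq bool -> X) (g : X -> algC) :
  (forall r, size r = m -> exists n, [/\ (n <= T)%N, path stp x r n (F r)
     & forall b, stp (F r) b = F r]) ->
  avg T (fun c => g (foldl stp x c)) = avg m (fun r => g (F r)).
Proof.
elim: T m x F => [|T IH] m x F H.
  have [n [hn p hh]] := H _ (size_nseq m false).
  have := path_size p; rewrite size_nseq => hm.
  have m0 : m = 0%N by lia.
  have n0 : n = 0%N by lia.
  by subst m n; case: (path_inv p) => {p} [[_ _ e]|[y [n' [//]]]|[b [r' [n' [//]]]]]; rewrite /= e.
(* The kind of the first step depends on [x] only, so any string of length [m] serves as a probe. *)
have [n [hn p hh]] := H _ (size_nseq m false).
case: (path_inv p) => {p} [[e _ e2]|[y [k [_ h1 h2 p]]]|[b [r [k [e _ h p]]]]].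
- have m0 : m = 0%N by rewrite -(size_nseq m false) e.
  rewrite e2 in hh; subst m; have [k [_ q hk]] := H [::] erefl.
  have [_ e3] := path_halted hh q.
  by rewrite avg_halted //= e3.
- rewrite /= h1 h2 (IH m y F) => [|r' hr'].
    exact: half_add.
  have [k' [hk' q hq]] := H _ hr'.
  case: (path_inv q) => {q} [[e _ e2]|[w [k2 [e g1 g2 q]]]|[b [r2 [k2 [_ _ hc _]]]]].
  + exists 0%N; split => //; rewrite e.
    have -> : y = F r' by rewrite -h1 -e2 hq.
    by rewrite e; exact: path0.
  + exists k2; split => //; first by lia.
    by rewrite -h1 g1.
  + by case: hc; rewrite h1 h2.
- case: m H e {hn hh p} => [//|m] H _ /=.
  have aux b' r' : size r' = m -> exists n0, [/\ (n0 <= T)%N,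
      path stp (stp x b') r' n0 (F (b' :: r')) & forall b0, stp (F (b' :: r')) b0 = F (b' :: r')].
    move=> hr'; have [k' [hk' q hq]] := H (b' :: r') (congr1 S hr').
    case: (path_inv q) => {q} [[//]|[w [k2 [_ g1 g2 _]]]|[b2 [r2 [k2 [[e1 e2] e3 _ q]]]]].
      by case: h; rewrite g1 g2.
    exists k2; split => //; first by rewrite e3 in hk'; lia.
    by rewrite {1}e1 {1}e2.
  by rewrite (IH m _ (fun r => F (false :: r)) (aux false)) (IH m _ (fun r => F (true :: r)) (aux true)).
Qed.
End Halting.

Local Close Scope ring_scope.

(** * Machines over an arbitrary finite set of states *)

Section FinMachine.
Variables (Q : finType) (q0 : Q) (delta : Q -> sym -> bool -> option Q * sym * bool).

(** Index 0 is the start state of a [PTM] and decodes to [q0] as a second name, so the states of [Q]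
    are shifted by one. [None] is the halting state. *)
Definition st_enc (o : option Q) : 'I_#|Q|.+2 :=
  if o is Some q then inord (enum_rank q).+1 else ord_max.

Definition st_dec (i : 'I_#|Q|.+2) : option Q :=
  if i == 0%N :> nat then Some q0 else
  if (insub (i : nat).-1 : option 'I_#|Q|) is Some j then Some (enum_val j) else None.

Lemma st_encK o : st_dec (st_enc o) = o.
Proof.
case: o => [q|] /=; rewrite /st_dec.
  have h := ltn_ord (enum_rank q).
  rewrite /= inordK; last by rewrite ltnS ltnW // ltnS.
  case: insubP => [j _ hj|]; last by rewrite /= h.
  by rewrite -(enum_rankK q); congr (Some (enum_val _)); apply: val_inj.
by rewrite /= insubF //= ltnn.
Qed.

Arguments st_enc : simpl never.

Definition fin_ptm : PTM := @MkPTM #|Q| (fun i s b =>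
  if st_dec i is Some q then
    let: (q', a, mv) := delta q s b in (st_enc q', a, mv)
  else (ord_max, s, false)).

(** The tape as a zipper: [L] is the part left of the head, nearest cell first, and [R] starts at
    the head. *)
Definition cf (q : option Q) (L R : seq sym) : config fin_ptm :=
  @Config fin_ptm (st_enc q) (fun i => nth Blank (rev L ++ R) i) (size L).

Lemma cf_state q L R q' L' R' : cf q L R = cf q' L' R' -> q = q'.
Proof. by case=> /(congr1 st_dec); rewrite !st_encK => ->. Qed.

Lemma cf_blank q L R : cf q L (rcons R Blank) = cf q L R.
Proof.
rewrite /cf; congr Config; apply: functional_extensionality => i.
rewrite -rcons_cat nth_rcons; case: ltnP => // h; rewrite (nth_default _ h).
by case: eqP.
Qed.

Lemma st_enc_halt o : (st_enc o == ord_max) = (o == None).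
Proof.
case: o => [q|]; last by rewrite !eqxx.
apply/eqP => e; have := st_encK (Some q).
by rewrite e -[ord_max]/(st_enc None) st_encK.
Qed.

Lemma cf_halted L R : cstate (cf None L R) = halt_state fin_ptm.
Proof. by []. Qed.

Lemma step_halted L R b : step (cf None L R) b = cf None L R.
Proof. by rewrite /step /= eqxx. Qed.

Definition moved (q' : option Q) (a : sym) (mv : bool) (L R : seq sym) :=
  if mv then cf q' (a :: L) (behead R)
  else if L is x :: L' then cf q' L' (x :: a :: behead R) else cf q' [::] (a :: behead R).

Lemma upd_tape L R a :
  (fun i => if i == size L then a else nth Blank (rev L ++ R) i)
  = (fun i => nth Blank (rev L ++ a :: behead R) i).
Proof.
apply: functional_extensionality => i; rewrite !nth_cat size_rev.
case: (ltngtP i (size L)) => h //.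
  by have -> : i - size L = (i - size L).-1.+1 by [lia]; rewrite /= nth_behead.
by rewrite h subnn.
Qed.

Lemma step_cf q L R b : step (cf (Some q) L R) b =
  let: (q', a, mv) := delta q (head Blank R) b in moved q' a mv L R.
Proof.
rewrite /step /halt_state /= st_enc_halt st_encK /=.
have -> : nth Blank (rev L ++ R) (size L) = head Blank R.
  by rewrite nth_cat size_rev ltnn subnn nth0.
case: (delta _ _ _) => [[q' a] mv]; rewrite /moved /= upd_tape.
case: mv; rewrite /cf.
  by congr Config; rewrite /= rev_cons cat_rcons.
case: L => [|x L] //=; congr Config.
by rewrite rev_cons cat_rcons.
Qed.

(** The initial configuration is in state 0, which is not [st_enc (Some q0)]; the two names of the
    start state are told apart only until the first step, hence the nonempty coin sequence in
    [run_init]. *)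
Lemma step_init w b : step (init_config fin_ptm w) b = step (cf (Some q0) [::] w) b.
Proof.
rewrite step_cf /step /init_config /=.
rewrite nth0; case: (delta _ _ _) => [[q' a] mv].
rewrite /moved (_ : (fun i => _) = (fun i => nth Blank (rev [::] ++ a :: behead w) i)).
  by case: mv.
exact: (@upd_tape [::] w a).
Qed.

Lemma run_init w c : c != [::] -> run fin_ptm w c = foldl (@step fin_ptm) (cf (Some q0) [::] w) c.
Proof. by case: c => //= b c _; rewrite /run /= step_init. Qed.
End FinMachine.

(** * Stack flowcharts on a Turing machine *)

(** Each instruction names its successors. Those of [IPop] are for an empty stack, a popped 0 and a
    popped 1. *)
Inductive instr :=
| IPush of nat & bool & nat
| ICoin of nat & nat
| IPop of nat & nat & nat & nat
| IHalt.

Definition bsym (b : bool) : sym := if b then One else Zero.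

Definition next_label (i : instr) (o : sym) : nat :=
  match i with
  | IPush _ _ x | ICoin _ x => x
  | IPop _ xE x0 x1 => match o with Zero => x0 | One => x1 | _ => xE end
  | IHalt => 0
  end.

(** Sweeps of the head that together execute one instruction: a push inserts a symbol and shifts the
    rest of the tape right, a pop deletes one and shifts it left. Cell 0 cannot be recognized, so
    the way home is found from the right end by counting separators. *)
Inductive phase (S : nat) :=
| PStart | PLook | PFwd
| PSeek of sym & 'I_S.+1
| PIns of sym & sym & 'I_S.+1
| PApp of sym & 'I_S.+1
| PBack of sym & 'I_S.+1
| PDel1 of sym
| PDel2 of sym
| PDel3 of sym & sym.
Arguments PStart {S}. Arguments PLook {S}. Arguments PFwd {S}.
Arguments PDel1 {S}. Arguments PDel2 {S}. Arguments PDel3 {S}.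

Definition phase_code S (p : phase S) :
  unit + (unit + (unit + (sym * 'I_S.+1 + (sym * sym * 'I_S.+1 + (sym * 'I_S.+1
  + (sym * 'I_S.+1 + (sym + (sym + sym * sym)))))))) :=
  match p with
  | PStart => inl tt
  | PLook => inr (inl tt)
  | PFwd => inr (inr (inl tt))
  | PSeek o c => inr (inr (inr (inl (o, c))))
  | PIns o a c => inr (inr (inr (inr (inl (o, a, c)))))
  | PApp o c => inr (inr (inr (inr (inr (inl (o, c))))))
  | PBack o c => inr (inr (inr (inr (inr (inr (inl (o, c)))))))
  | PDel1 o => inr (inr (inr (inr (inr (inr (inr (inl o)))))))
  | PDel2 o => inr (inr (inr (inr (inr (inr (inr (inr (inl o))))))))
  | PDel3 o x => inr (inr (inr (inr (inr (inr (inr (inr (inr (o, x)))))))))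
  end.

Definition phase_decode S (c :
  unit + (unit + (unit + (sym * 'I_S.+1 + (sym * sym * 'I_S.+1 + (sym * 'I_S.+1
  + (sym * 'I_S.+1 + (sym + (sym + sym * sym))))))))) : phase S :=
  match c with
  | inl _ => PStart
  | inr (inl _) => PLook
  | inr (inr (inl _)) => PFwd
  | inr (inr (inr (inl (o, c)))) => PSeek o c
  | inr (inr (inr (inr (inl (o, a, c))))) => PIns o a c
  | inr (inr (inr (inr (inr (inl (o, c)))))) => PApp o c
  | inr (inr (inr (inr (inr (inr (inl (o, c))))))) => PBack o c
  | inr (inr (inr (inr (inr (inr (inr (inl o))))))) => PDel1 o
  | inr (inr (inr (inr (inr (inr (inr (inr (inl o)))))))) => PDel2 o
  | inr (inr (inr (inr (inr (inr (inr (inr (inr (o, x))))))))) => PDel3 o x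
  end.

Lemma phase_codeK S : cancel (@phase_code S) (@phase_decode S).
Proof. by case. Qed.
HB.instance Definition _ S := Finite.copy (phase S) (can_type (@phase_codeK S)).

(** The top of a stack is next to its separator, so pushing and popping happen right behind the
    separator that [PSeek] has counted to. *)
Definition flat (s : seq (seq bool)) : seq sym :=
  flatten [seq Hash :: map bsym st | st <- s].

Definition upd (s : seq (seq bool)) j v := set_nth [::] s j v.

Section Flowchart.
Variables (prog : seq instr) (S' ext : nat).
Local Notation S := S'.+1.
Local Notation state := ('I_(size prog).+1 * phase S)%type.

Definition instr_at (i : nat) := nth IHalt prog i.

(* Seek, Ins, App and Back carry counters of separators or blanks still to be met. *)
Definition fdelta (q : state) (x : sym) (b : bool) : option state * sym * bool :=
  let: (i, ph) := q in
  let go p := Some (i, p) in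
  match ph with
  | PStart => match instr_at i with
     | IPush j v _ => (go (PSeek (bsym v) (inord j)), x, false)
     | ICoin j _ => (go (PSeek (bsym b) (inord j)), x, false)
     | IPop j _ _ _ => (go (PSeek Blank (inord j)), x, false)
     | IHalt => (go (PDel2 Blank), x, true)
     end
  | PSeek o c => if x is Hash then
        if c == 0 :> nat then
          (go (if instr_at i is IPop _ _ _ _ then PLook else PIns o o ord0), x, true)
        else (go (PSeek o (inord c.-1)), x, true)
      else (go ph, x, true)
  | PLook => match x with
     | Zero | One => (go (PDel2 x), x, true)
     | Hash => (go PFwd, x, true)
     | Blank => (go (PBack Blank ord_max), x, false)
     end
  | PFwd => if x is Blank then (go (PBack Blank ord_max), x, false) else (go ph, x, true)
  | PIns o a e => (go (if x is Blank then PApp o e else PIns o x e), a, true)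
  | PApp o e => if e == 0 :> nat then (go (PBack o ord_max), x, false)
                else (go (PApp o (inord e.-1)), Hash, true)
  | PBack o c => if x is Hash then
        if c == 1 :> nat then (Some (inord (next_label (instr_at i) o), PStart), x, false)
        else (go (PBack o (inord c.-1)), x, false)
      else (go ph, x, false)
  | PDel1 o => (go (PDel2 o), x, true)
  | PDel2 o => (go (PDel3 o x), x, false)
  | PDel3 o y => if y is Blank then
        (if instr_at i is IHalt then None else go (PBack o ord_max), y, true)
      else (go (PDel1 o), y, true)
  end.

Definition fptm : PTM := fin_ptm (ord0, PIns Blank Hash (inord ext)) fdelta.
Local Notation fcf := (@cf _ (ord0, PIns Blank Hash (inord ext)) fdelta).
Local Notation fpath := (path (@step fptm)).

Definition home (i : nat) (s : seq (seq bool)) : config fptm :=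
  fcf (Some (inord i, PStart)) [::] (flat s).

Lemma pathS q L R n z :
  (forall b, fdelta q (head Blank R) b = fdelta q (head Blank R) false) ->
  fpath (let: (q', a, mv) := fdelta q (head Blank R) false in
         moved (ord0, PIns Blank Hash (inord ext)) fdelta q' a mv L R) [::] n z ->
  fpath (fcf (Some q) L R) [::] n.+1 z.
Proof.
move=> e p; apply: pathD p; by rewrite step_cf // e.
Qed.

Lemma flat_cons st s : flat (st :: s) = Hash :: map bsym st ++ flat s.
Proof. by []. Qed.

Lemma path1 x n m y : fpath x [::] n y -> n = m -> fpath x [::] m y.
Proof. by move=> p <-. Qed.

Lemma seek_bits i o c st L R :
  fpath (fcf (Some (i, PSeek o c)) L (map bsym st ++ R)) [::] (size st)
        (fcf (Some (i, PSeek o c)) (rev (map bsym st) ++ L) R).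
Proof.
elim: st L => [|b st IH] L /=; first exact: path0.
apply: pathS; first by case: b.
case: b => /=; rewrite /moved /= rev_cons cat_rcons; exact: IH.
Qed.

Lemma seek_path i o j s L : j < size s -> j <= S ->
  fpath (fcf (Some (i, PSeek o (inord j))) L (flat s)) [::] (size (flat (take j s))).+1
   (fcf (Some (i, if instr_at i is IPop _ _ _ _ then PLook else PIns o o ord0))
     (Hash :: rev (flat (take j s)) ++ L) (map bsym (nth [::] s j) ++ flat (drop j.+1 s))).
Proof.
elim: s j L => // st s IH [|j] L hj hS.
  rewrite /= drop0; apply: pathS => //=; rewrite inordK //=; exact: path0.
rewrite [take _ _]/= [nth _ _ _]/= [drop _ _]/= !flat_cons.
apply: pathS => //=; rewrite inordK //= /moved /=.
apply: path1; first rewrite -[[::]]/([::] ++ [::]).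
apply: path_trans; first exact: seek_bits.
  have -> : Hash :: rev (Hash :: map bsym st ++ flat (take j s)) ++ L =
    Hash :: rev (flat (take j s)) ++ (rev (map bsym st) ++ Hash :: L).
    by rewrite rev_cons rev_cat cat_rcons -catA.
  apply: IH => //; exact: ltnW.
by rewrite /= size_cat size_map addnS.
Qed.

Lemma ins_path i o a e L (R : seq sym) : all (fun x : sym => x != Blank) R ->
  fpath (fcf (Some (i, PIns o a e)) L R) [::] (size R).+1
        (fcf (Some (i, PApp o e)) (rev (a :: R) ++ L) [::]).
Proof.
elim: R a L => [|x R IH] a L /=.
  by move=> _; apply: pathS => //=; rewrite /moved /=; exact: path0.
case/andP=> hx hR; apply: pathS => //=.
rewrite rev_cons cat_rcons; case: x hx => // _; exact: IH.
Qed.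

Lemma app_path i o e L : e <= S ->
  fpath (fcf (Some (i, PApp o (inord e))) L [::]) [::] e
        (fcf (Some (i, PApp o (inord 0))) (nseq e Hash ++ L) [::]).
Proof.
elim: e L => [|e IH] L he; first exact: path0.
apply: pathS => //=; rewrite inordK //= /moved /=.
have -> : Hash :: nseq e Hash ++ L = nseq e Hash ++ Hash :: L.
  by elim: (e) => //= k ->.
apply: IH; exact: ltnW.
Qed.

Lemma back_path i o c (L : seq sym) (y : sym) (R : seq sym) : count_mem Hash (y :: L) = c -> last y L = Hash -> c <= S ->
  fpath (fcf (Some (i, PBack o (inord c))) L (y :: R)) [::] (size L).+1
        (fcf (Some (inord (next_label (instr_at i) o), PStart)) [::] (rev L ++ y :: R)).
Proof.
elim: L y R c => [|z L IH] y R c /=.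
  move=> <- -> _; apply: pathS => //=; rewrite inordK //= /moved /=; exact: path0.
move=> hc hl hS.
have hz : 0 < (z == Hash) + count_mem Hash L.
  elim: L z hl {hc IH} => [|w L IH] z /=; first by move=> ->.
  by move=> /IH; case: (z == Hash).
have [e|ne] := eqVneq y Hash; last first.
  have -> : rev (z :: L) ++ y :: R = rev L ++ z :: y :: R by rewrite rev_cons cat_rcons.
  apply: pathS; first by case: (y) ne.
  rewrite (negbTE ne) add0n in hc.
  by case: y ne => // _ /=; rewrite /moved /=; apply: IH.
move: IH hz hc; rewrite e eqxx; set k := ((z == Hash) + count_mem Hash L) => IH hz hc.
have {}hc : k.+1 = c by [].
apply: pathS => //=.
rewrite inordK; last by rewrite ltnS.
rewrite -hc; case: ifP => [/eqP [h]|_]; first by rewrite h in hz.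
rewrite /moved /= rev_cons cat_rcons; apply: IH => //; apply: ltnW; by rewrite hc.
Qed.
Lemma flat_split s j v : j < size s -> flat (upd s j v) =
  flat (take j s) ++ Hash :: map bsym v ++ flat (drop j.+1 s).
Proof.
move=> h; rewrite /upd set_nthE h.
by rewrite /flat map_cat flatten_cat.
Qed.

Lemma size_flat_split s j v : j < size s -> size (flat (upd s j v)) =
  size (flat (take j s)) + size v + size (flat (drop j.+1 s)) + 1.
Proof. by move=> h; rewrite flat_split // size_cat /= size_cat size_map; lia. Qed.

Lemma upd_nth s j : j < size s -> upd s j (nth [::] s j) = s.
Proof.
by move=> h; apply: (@eq_from_nth _ [::]) => [|i]; rewrite ?size_set_nth ?(maxn_idPr _) //
  => hi; rewrite nth_set_nth /=; case: eqP => // ->.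
Qed.

Lemma size_upd s j v : j < size s -> size (upd s j v) = size s.
Proof. by move=> h; rewrite size_set_nth (maxn_idPr h). Qed.

Lemma flat_noblank s : all (fun x : sym => x != Blank) (flat s).
Proof.
elim: s => //= st s IH; rewrite all_cat IH andbT.
by elim: st => //= b st ->; rewrite andbT; case: b.
Qed.

Lemma bits_noblank st : all (fun x : sym => x != Blank) (map bsym st).
Proof. by elim: st => //= b st ->; case: b. Qed.

Lemma count_flat s : count_mem Hash (flat s) = size s.
Proof.
elim: s => //= st s IH; rewrite count_cat -/(flat s) IH.
suff -> : count_mem Hash (map bsym st) = 0 by [].
by elim: st => //= b st ->; case: b.
Qed.

Lemma size_flat s : size (flat s) = sumn (map size s) + size s.
Proof. by elim: s => //= st s IH; rewrite size_cat -/(flat s) IH size_map; lia. Qed.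

Lemma turn_path q i o s :
  (forall b, fdelta q Blank b = (Some (i, PBack o ord_max), Blank, false)) ->
  size s = S ->
  fpath (fcf (Some q) (rev (flat s)) [::]) [::] (size (flat s)).+1
    (home (next_label (instr_at i) o) s).
Proof.
move=> hq hs.
case E: s hs => [//|st s'] hs; rewrite -E.
have hc := count_flat s; rewrite E hs -E in hc.
have hl y : last y (rev (flat s)) = Hash by rewrite E flat_cons rev_cons last_rcons.
rewrite -(count_rev (pred1 Hash)) in hc.
case E2: (rev (flat s)) hl hc => [|y L] hl hc; first by have := hl Blank.
have ef : flat s = rev (y :: L) by rewrite -E2 revK.
apply: pathS => [b|]; rewrite ?hq //= /moved /=.
rewrite /home -[X in path _ _ _ _ X]cf_blank ef size_rev rev_cons -cats1 -cats1 -catA /=.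
rewrite -[ord_max]inord_val /=; apply: back_path => //.
exact: (hl y).
Qed.

Lemma del_path i o y (L R : seq sym) : all (fun x : sym => x != Blank) R ->
  fpath (fcf (Some (i, PDel2 o)) (y :: L) R) [::] (3 * size R).+2
   (fcf (if instr_at i is IHalt then None else Some (i, PBack o ord_max))
      (Blank :: rev R ++ L) [:: Blank]).
Proof.
elim: R y L => [|x R IH] y L.
  move=> _; do 2 (apply: pathS => //=; rewrite /moved /=); exact: path0.
case/andP=> hx hR.
have -> : (3 * size (x :: R)).+2 = (3 * size R).+2.+3 by rewrite /=; lia.
apply: pathS => //=; rewrite /moved /=.
have e : rev (x :: R) ++ L = rev R ++ x :: L by rewrite rev_cons cat_rcons.
apply: pathS => [|/=]; first by case: (x).
case: x hx e => // _ e /=; rewrite /moved /=; apply: pathS => //=;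
  rewrite /moved /= e; exact: IH.
Qed.

Lemma del_home (i : 'I_(size prog).+1) o y (s1 s2 : seq sym) s : flat s = s1 ++ s2 -> size s = S ->
  instr_at i <> IHalt -> all (fun x : sym => x != Blank) s2 ->
  fpath (fcf (Some (i, PDel2 o)) (y :: rev s1) s2) [::] ((3 * size s2) + size (flat s)).+4
   (home (next_label (instr_at i) o) s).
Proof.
move=> hs hS hi h2; have := del_path i o y (rev s1) h2.
have -> : (if instr_at i is IHalt then None else Some (i, PBack o ord_max)) =
   Some (i, PBack o ord_max) by case: (instr_at i) hi.
move=> p; apply: path1.
  rewrite -[[::]]/([::] ++ [::]); apply: path_trans p _.
  have -> x : home x s = fcf (Some (inord x, PStart)) [::] (rcons (rcons (flat s) Blank) Blank).
    by rewrite !cf_blank.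
  rewrite hs.
  have -> : rcons (rcons (s1 ++ s2) Blank) Blank = rev (Blank :: rev s2 ++ rev s1) ++ [:: Blank].
    by rewrite rev_cons rev_cat !revK cats1.
  rewrite -[ord_max]inord_val /=; apply: back_path => //=.
    by rewrite -rev_cat -hs count_rev count_flat hS.
  rewrite -rev_cat -hs; case: (s) hS => // st s' _.
  by rewrite flat_cons rev_cons last_rcons.
by rewrite /= -rev_cat size_rev -hs; lia.
Qed.

Lemma fwd_path i (L R : seq sym) : all (fun x : sym => x != Blank) R ->
  fpath (fcf (Some (i, PFwd)) L R) [::] (size R) (fcf (Some (i, PFwd)) (rev R ++ L) [::]).
Proof.
elim: R L => [|x R IH] L /=; first by move=> _; exact: path0.
case/andP=> hx hR; apply: pathS; first by case: (x).
rewrite rev_cons cat_rcons; case: x hx => // _ /=; exact: IH.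
Qed.

Definition total (s : seq (seq bool)) := sumn (map size s).

Inductive istep : nat -> seq (seq bool) -> seq bool -> nat -> seq (seq bool) -> Prop :=
| ist_push i j b x s : instr_at i = IPush j b x -> j < size s ->
    istep i s [::] x (upd s j (b :: nth [::] s j))
| ist_coin i j b x s : instr_at i = ICoin j x -> j < size s ->
    istep i s [:: b] x (upd s j (b :: nth [::] s j))
| ist_pop0 i j xE x0 x1 s : instr_at i = IPop j xE x0 x1 -> j < size s ->
    nth [::] s j = [::] -> istep i s [::] xE s
| ist_pop i j xE x0 x1 s b t : instr_at i = IPop j xE x0 x1 -> j < size s ->
    nth [::] s j = b :: t -> istep i s [::] (if b then x1 else x0) (upd s j t).

Lemma push_path i (ii : 'I_(size prog).+1) j b s : ii = i :> nat -> size s = S -> j < size s ->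
  (if instr_at i is IPop _ _ _ _ then False else True) ->
  exists2 n, n <= 3 * size (flat s) + 10 &
  fpath (fcf (Some (ii, PSeek (bsym b) (inord j))) [::] (flat s)) [::] n
    (home (next_label (instr_at i) (bsym b)) (upd s j (b :: nth [::] s j))).
Proof.
move=> hi hs hj hp.
have hjS : j <= S by rewrite -hs ltnW.
have p1 := seek_path ii (bsym b) [::] hj hjS.
have e : (if instr_at ii is IPop _ _ _ _ then PLook else PIns (bsym b) (bsym b) (@ord0 S))
   = PIns (bsym b) (bsym b) ord0 by rewrite hi; case: (instr_at i) hp.
have hnb : all (fun x : sym => x != Blank) (map bsym (nth [::] s j) ++ flat (drop j.+1 s)).
  by rewrite all_cat flat_noblank bits_noblank.
have := path_trans p1 _; rewrite e => /(_ [::] _ _ (ins_path _ _ _ _ _ hnb)) {}p1.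
have eu : rev (bsym b :: map bsym (nth [::] s j) ++ flat (drop j.+1 s)) ++
   Hash :: rev (flat (take j s)) ++ [::] = rev (flat (upd s j (b :: nth [::] s j))).
  by rewrite flat_split // cats0 rev_cat -[Hash :: _ ++ _]cat1s rev_cat -catA.
rewrite eu in p1.
have := path_trans p1 (turn_path (i := ii) (o := bsym b) _ _).
rewrite size_upd // => /(_ (fun=> erefl) hs); rewrite hi => {}p1.
eexists; last exact: p1.
have := size_flat_split (nth [::] s j) hj; rewrite upd_nth // => ->.
rewrite size_flat_split // size_cat size_map /=; lia.
Qed.

Lemma head_flat s : size s = S -> head Blank (flat s) :: behead (flat s) = flat s.
Proof. by case: s => // st s _; rewrite flat_cons. Qed.

Lemma istep_path i s r x s' : istep i s r x s' -> i < size prog -> size s = S ->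
  exists2 n, n <= 6 * size (flat s) + 20 & fpath (home i s) r n (home x s').
Proof.
case=> {i s r x s'} [i j b x s hi hj|i j b x s hi hj|i j xE x0 x1 s hi hj hn|i j xE x0 x1 s b t hi hj hn] hp hs.
- have ei : inord i = i :> nat := inordK (ltnW hp).
  have [|n hn p] := push_path b ei hs hj; first by rewrite hi.
  rewrite hi in p; exists n.+1; first by lia.
  apply: pathS => /=; rewrite ei hi //= /moved /= head_flat //.
- have ei : inord i = i :> nat := inordK (ltnW hp).
  have [|n hn p] := push_path b ei hs hj; first by rewrite hi.
  rewrite hi in p; exists n.+1; first by lia.
  have e b' : step (home i s) b' = fcf (Some (inord i, PSeek (bsym b') (inord j))) [::] (flat s).
    rewrite step_cf /= ei hi /moved /=; case: (s) hs => [//|st s1] _; by rewrite flat_cons.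
  (* The coin is stored in the phase, so the two successors differ in their state. *)
  apply: pathC; rewrite !e // => h.
  by have := cf_state h.
- have ei : inord i = i :> nat := inordK (ltnW hp).
  have hjS : j <= S by rewrite -hs ltnW.
  have p1 := seek_path (inord i) Blank [::] hj hjS.
  rewrite ei hi hn cats0 /= in p1.
  set R := flat (drop j.+1 s) in p1.
  have hR : all (fun x : sym => x != Blank) R by exact: flat_noblank.
  have eu : rev R ++ Hash :: rev (flat (take j s)) = rev (flat s).
    by rewrite -[in RHS](upd_nth hj) flat_split // hn /= rev_cat rev_cons cat_rcons.
  (* [PBack] counts separators from the right end; on an empty stack the head must first run there,
     unless the stack is the last one. *)
  have [n hn2 p2] : exists2 n, n <= 2 * size (flat s) + 5 &
    fpath (fcf (Some (inord i, PLook)) (Hash :: rev (flat (take j s))) R) [::] n (home xE s).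
    have hsz : size R <= size (flat s).
      by rewrite -(size_rev (flat s)) -eu size_cat size_rev leq_addr.
    case eR: {1 2 3 4}R hR eu hsz => [|y R'] hR eu hsz.
      have := @turn_path (inord i, PLook) (inord i) Blank s (fun=> erefl) hs.
      rewrite -eu ei hi => p2; eexists; last exact: p2; lia.
    have ey : y = Hash.
      by move: eR; rewrite /R; case: (drop j.+1 s) => [//|st s1]; rewrite flat_cons => -[].
    rewrite ey in hR eu *; case/andP: hR => _ hR.
    have p2 := fwd_path (inord i) (Hash :: Hash :: rev (flat (take j s))) hR.
    rewrite -cat_rcons -rev_cons eu in p2.
    have := @turn_path (inord i, PFwd) (inord i) Blank s (fun=> erefl) hs.
    rewrite ei hi => /(path_trans p2) {}p2.
    eexists; last first; first by apply: pathS; last exact: p2.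
    rewrite /= in hsz; lia.
  exists (1 + ((size (flat (take j s))).+1 + n)).
    have : size (flat (take j s)) <= size (flat s).
      by rewrite -(size_rev (flat s)) -eu size_cat /= !size_rev; lia.
    lia.
  apply: pathS => /=; rewrite ei hi //=.
  rewrite /moved /= head_flat //; exact: path_trans p1 p2.
- have ei : inord i = i :> nat := inordK (ltnW hp).
  have hjS : j <= S by rewrite -hs ltnW.
  have p1 := seek_path (inord i) Blank [::] hj hjS.
  rewrite ei hi hn cats0 in p1.
  have hu := size_upd t hj; rewrite hs in hu.
  have e1 : flat (upd s j t) = (flat (take j s) ++ [:: Hash]) ++ (map bsym t ++ flat (drop j.+1 s)).
    by rewrite flat_split // -catA.
  have e2 : flat s = (flat (take j s) ++ [:: Hash]) ++ bsym b :: (map bsym t ++ flat (drop j.+1 s)).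
    by rewrite -{1}(upd_nth hj) flat_split // hn -catA.
  have hnb : all (fun x : sym => x != Blank) (map bsym t ++ flat (drop j.+1 s)).
    by rewrite all_cat flat_noblank bits_noblank.
  have := @del_home (inord i) (bsym b) (bsym b) _ _ _ e1 hu _ hnb.
  rewrite ei hi rev_cat => /(_ ltac:(by [])) p2'.
  have ex : next_label (IPop j xE x0 x1) (bsym b) = if b then x1 else x0 by case: (b).
  rewrite ex in p2'.
  have p2 : fpath (fcf (Some (inord i, PLook)) (Hash :: rev (flat (take j s)))
      (map bsym (b :: t) ++ flat (drop j.+1 s))) [::] 
    (3 * size (map bsym t ++ flat (drop j.+1 s)) + size (flat (upd s j t))).+4.+1
    (home (if b then x1 else x0) (upd s j t)).
    apply: pathS; first by case: (b).
    by case: (b) p2'; rewrite /= /moved /=.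
  have p3 : fpath (home i s) [::] (1 + ((size (flat (take j s))).+1 +
      (3 * size (map bsym t ++ flat (drop j.+1 s)) + size (flat (upd s j t))).+4.+1))
      (home (if b then x1 else x0) (upd s j t)).
    apply: pathS => /=; rewrite ei hi //= /moved /= head_flat //.
    exact: path_trans p1 p2.
  eexists; last exact: p3.
  have -> : flat s = flat (upd s j (b :: t)) by rewrite -{1}(upd_nth hj) hn.
  rewrite !size_flat_split // size_cat size_map /=; lia.
Qed.

(** The start state is in the middle of an insertion: a separator is put in front of the input and
    [ext] empty stacks are appended. An input that contains [Hash] already provides several
    stacks. *)
Lemma init_path w s : flat s = Hash :: w ++ nseq ext Hash -> size s = S -> ext <= S ->
  fpath (fcf (Some (ord0, PIns Blank Hash (inord ext))) [::] w) [::]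
    (2 * size (flat s)).+1 (home (next_label (instr_at 0) Blank) s).
Proof.
move=> hs hS he; have hw : all (fun x : sym => x != Blank) w.
  by have := flat_noblank s; rewrite hs /= all_cat => /andP[].
have p1 := ins_path ord0 Blank Hash (inord ext) [::] hw.
have p2 := path_trans p1 (app_path _ _ _ he).
have e : nseq ext Hash ++ rev (Hash :: w) ++ [::] = rev (flat s).
  by rewrite cats0 hs !rev_cons rev_cat rev_nseq rcons_cat.
rewrite e in p2.
have ht b : fdelta (ord0, PApp Blank (inord 0)) Blank b
    = (Some (ord0, PBack Blank ord_max), Blank, false) by rewrite /= inordK.
have p3 := path_trans p2 (turn_path ht hS).
apply: path1 p3 _.
by rewrite hs /= size_cat size_nseq; lia.
Qed.

(** Halting deletes the separator in cell 0, so that the block of bits starting at cell 0, which is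
    the output, is stack 0. *)
Lemma halt_path i s : instr_at i = IHalt -> i <= size prog -> size s = S ->
  fpath (home i s) [::] (3 * size (flat s)) 
   (fcf None (Blank :: rev (behead (flat s))) [:: Blank]).
Proof.
move=> hi hp hs; have ei : inord i = i :> nat := inordK hp.
have hR : all (fun x : sym => x != Blank) (behead (flat s)).
  by have := flat_noblank s; rewrite -(head_flat hs) /= => /andP[].
have := del_path (inord i) Blank Hash [::] hR.
rewrite ei hi cats0 => p.
have {}p := path1 p; rewrite -[3 * _](_ : ((3 * size (behead (flat s))).+2).+1 = _); last first.
  by rewrite -[in RHS](head_flat hs) /=; lia.
apply: pathS => /=; rewrite ei hi //= /moved /=.
case: (s) hs p => [//|st s1] _; rewrite flat_cons /=; exact.
Qed.
End Flowchart.

(** * Structured stack programs *)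

Inductive cmd :=
| Skip
| Push of nat & bool
| Coin of nat
| Seq of cmd & cmd
| Case of nat & cmd & cmd & cmd
| Loop of nat & cmd & cmd
| While of nat & cmd.

(* Case pops a stack and branches on empty, 0, 1; Loop pops until the stack is empty,
   While pops until it is empty or a 0 is popped. The index n counts executed
   instructions, r lists the coins read. *)
Inductive exec : cmd -> seq (seq bool) -> seq bool -> nat -> seq (seq bool) -> Prop :=
| ex_skip s : exec Skip s [::] 0 s
| ex_push j b s : j < size s -> exec (Push j b) s [::] 1 (upd s j (b :: nth [::] s j))
| ex_coin j b s : j < size s -> exec (Coin j) s [:: b] 1 (upd s j (b :: nth [::] s j))
| ex_seq c1 c2 s r1 n1 s1 r2 n2 s2 : exec c1 s r1 n1 s1 -> exec c2 s1 r2 n2 s2 ->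
    exec (Seq c1 c2) s (r1 ++ r2) (n1 + n2) s2
| ex_case0 j cE c0 c1 s r n s' : j < size s -> nth [::] s j = [::] -> exec cE s r n s' ->
    exec (Case j cE c0 c1) s r n.+1 s'
| ex_case j cE c0 c1 s b t r n s' : j < size s -> nth [::] s j = b :: t ->
    exec (if b then c1 else c0) (upd s j t) r n s' -> exec (Case j cE c0 c1) s r n.+1 s'
| ex_loop0 j c0 c1 s : j < size s -> nth [::] s j = [::] -> exec (Loop j c0 c1) s [::] 1 s
| ex_loop j c0 c1 s b t r1 n1 s1 r2 n2 s2 : j < size s -> nth [::] s j = b :: t ->
    exec (if b then c1 else c0) (upd s j t) r1 n1 s1 ->
    exec (Loop j c0 c1) s1 r2 n2 s2 -> exec (Loop j c0 c1) s (r1 ++ r2) (n1 + n2).+1 s2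
| ex_while0 j c s : j < size s -> nth [::] s j = [::] -> exec (While j c) s [::] 1 s
| ex_while1 j c s t : j < size s -> nth [::] s j = false :: t ->
    exec (While j c) s [::] 1 (upd s j t)
| ex_while j c s t r1 n1 s1 r2 n2 s2 : j < size s -> nth [::] s j = true :: t ->
    exec c (upd s j t) r1 n1 s1 -> exec (While j c) s1 r2 n2 s2 ->
    exec (While j c) s (r1 ++ r2) (n1 + n2).+1 s2.

(* Code of a command placed at offset o with exit label x, and its entry label. *)
Fixpoint code (c : cmd) (o x : nat) : seq instr * nat :=
  match c with
  | Skip => ([::], x)
  | Push j b => ([:: IPush j b x], o)
  | Coin j => ([:: ICoin j x], o)
  | Seq c1 c2 =>
      let p2 := code c2 o x in
      let p1 := code c1 (o + size p2.1) p2.2 in (p2.1 ++ p1.1, p1.2)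
  | Case j cE c0 c1 =>
      let pE := code cE o.+1 x in
      let p0 := code c0 (o.+1 + size pE.1) x in
      let p1 := code c1 (o.+1 + size pE.1 + size p0.1) x in
      (IPop j pE.2 p0.2 p1.2 :: pE.1 ++ p0.1 ++ p1.1, o)
  | Loop j c0 c1 =>
      let p0 := code c0 o.+1 o in
      let p1 := code c1 (o.+1 + size p0.1) o in
      (IPop j x p0.2 p1.2 :: p0.1 ++ p1.1, o)
  | While j c =>
      let p := code c o.+1 o in (IPop j x x p.2 :: p.1, o)
  end.

Definition placed (prog : seq instr) o l := exists p q, prog = p ++ l ++ q /\ size p = o.

Lemma placed_cat prog o l1 l2 : placed prog o (l1 ++ l2) ->
  placed prog o l1 /\ placed prog (o + size l1) l2.
Proof.
case=> p [q [-> <-]]; split; first by exists p, (l2 ++ q); rewrite -catA.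
by exists (p ++ l1), q; rewrite -!catA size_cat.
Qed.

Lemma placed_cons prog o i l : placed prog o (i :: l) ->
  [/\ instr_at prog o = i, o < size prog & placed prog o.+1 l].
Proof.
case=> p [q [-> <-]]; split.
- by rewrite /instr_at nth_cat ltnn subnn.
- by rewrite size_cat /= -[X in X < _]addn0 ltn_add2l.
- by exists (rcons p i), q; rewrite cat_rcons size_rcons.
Qed.

Section Runs.
Variable prog : seq instr.

Inductive irun : nat -> seq (seq bool) -> seq bool -> nat -> nat -> seq (seq bool) -> Prop :=
| irun0 i s : irun i s [::] 0 i s
| irunS i s r i1 s1 r' n i2 s2 : i < size prog -> istep prog i s r i1 s1 ->
    irun i1 s1 r' n i2 s2 -> irun i s (r ++ r') n.+1 i2 s2.

Lemma irun_trans i s r n i1 s1 r' n' i2 s2 :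
  irun i s r n i1 s1 -> irun i1 s1 r' n' i2 s2 -> irun i s (r ++ r') (n + n') i2 s2.
Proof.
move=> p; elim: p r' n' i2 s2 => {i s r n i1 s1} [//|i s r i1 s1 r' n i2 s2 hi h p IH] r2 n' i3 s3 q.
rewrite -catA addSn; apply: (irunS hi h); exact: IH.
Qed.

Lemma irun1 i s r i1 s1 : i < size prog -> istep prog i s r i1 s1 -> irun i s r 1 i1 s1.
Proof. by move=> h p; rewrite -[r]cats0; apply: (irunS h p); exact: irun0. Qed.

Lemma irunD i s i1 s1 r n i2 s2 : i < size prog -> istep prog i s [::] i1 s1 ->
  irun i1 s1 r n i2 s2 -> irun i s r n.+1 i2 s2.
Proof. exact: irunS. Qed.

Lemma code_run c s r n s' : exec c s r n s' -> forall o x, placed prog o (code c o x).1 ->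
  irun (code c o x).2 s r n x s'.
Proof.
elim=> {c s r n s'}.
- by move=> s o x _; exact: irun0.
- move=> j b s hj o x /placed_cons [hi ho _] /=.
  by apply: irun1 => //; exact: ist_push hi hj.
- move=> j b s hj o x /placed_cons [hi ho _] /=.
  by apply: irun1 => //; exact: ist_coin hi hj.
- move=> c1 c2 s r1 n1 s1 r2 n2 s2 _ IH1 _ IH2 o x /= /placed_cat [h2 h1].
  exact: irun_trans (IH1 _ _ h1) (IH2 _ _ h2).
- move=> j cE c0 c1 s r n s' hj hn _ IH o x /= /placed_cons [hi ho /placed_cat[hE _]].
  apply: (irunD ho (ist_pop0 hi hj hn)); exact: IH.
- move=> j cE c0 c1 s b t r n s' hj hn _ IH o x /= /placed_cons [hi ho /placed_cat[_ /placed_cat [h0 h1]]].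
  apply: (irunD ho (ist_pop hi hj hn)); case: b IH {hn} => IH; exact: IH.
- move=> j c0 c1 s hj hn o x /= /placed_cons [hi ho _].
  exact: (irun1 ho (ist_pop0 hi hj hn)).
- move=> j c0 c1 s b t r1 n1 s1 r2 n2 s2 hj hn _ IH1 _ IH2 o x pl.
  move: (pl) => /= /placed_cons [hi ho /placed_cat [h0 h1]].
  apply: (irunD ho (ist_pop hi hj hn)); apply: irun_trans; last exact: (IH2 _ _ pl).
  case: b IH1 {hn} => IH1; exact: IH1.
- move=> j c s hj hn o x /= /placed_cons [hi ho _].
  exact: (irun1 ho (ist_pop0 hi hj hn)).
- move=> j c s t hj hn o x /= /placed_cons [hi ho _].
  exact: (irun1 ho (ist_pop hi hj hn)).
- move=> j c s t r1 n1 s1 r2 n2 s2 hj hn _ IH1 _ IH2 o x pl.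
  move: (pl) => /= /placed_cons [hi ho h].
  apply: (irunD ho (ist_pop hi hj hn)); apply: irun_trans; last exact: (IH2 _ _ pl).
  exact: IH1.
Qed.

Lemma total_upd s j v : j < size s -> total (upd s j v) + size (nth [::] s j) = total s + size v.
Proof.
elim: s j => // st s IH [|j] /= hj; rewrite /total /=; first by lia.
have := IH j hj; rewrite /total; lia.
Qed.

Lemma istep_size i s r i' s' : istep prog i s r i' s' ->
  size s' = size s /\ total s' <= (total s).+1.
Proof.
case=> {i s r i' s'} [i j b x s _ hj|i j b x s _ hj|i j xE x0 x1 s _ hj _|i j xE x0 x1 s b t _ hj hn];
  rewrite ?size_upd //; split => //.
- have := total_upd (b :: nth [::] s j) hj; rewrite /=; lia.
- have := total_upd (b :: nth [::] s j) hj; rewrite /=; lia.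
- have := total_upd t hj; rewrite hn /=; lia.
Qed.

Lemma irun_size i s r n i' s' : irun i s r n i' s' ->
  size s' = size s /\ total s' <= total s + n.
Proof.
elim=> {i s r n i' s'} [i s|i s r i1 s1 r' n i2 s2 _ /istep_size [h1 h2] _ [-> h]]; first by rewrite addn0.
split=> //; lia.
Qed.

Lemma irun_path S' ext i s r n i' s' : irun i s r n i' s' -> size s = S'.+1 ->
  exists2 t, t <= n * (6 * (total s + n + S'.+1) + 20) &
  path (@step (fptm prog S' ext)) (home prog S' ext i s) r t (home prog S' ext i' s').
Proof.
elim=> {i s r n i' s'} [i s hs|i s r i1 s1 r' n i2 s2 hi h p IH hs].
  by exists 0 => //; exact: path0.
have [e1 e2] := istep_size h; rewrite hs in e1.
have [t1 ht1 p1] := IH e1; have [t2 ht2 p2] := istep_path ext h hi hs.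
exists (t2 + t1); last exact: path_trans p2 p1.
rewrite size_flat hs -/(total s) in ht2.
move: ht1 ht2 e2; move: (total s) (total s1) => a b; nia.
Qed.
End Runs.

(** Instruction 0 is never executed as a push. The initial sweep runs under label 0 and leaves for
    the successor of that instruction, which is the entry of [c]. *)
Definition cmd_prog c := let p := code c 1 (size (code c 1 0).1).+1 in
  IPush 0 false p.2 :: rcons p.1 IHalt.

Lemma size_code c o x x' : size (code c o x).1 = size (code c o x').1.
Proof.
elim: c o x x' => //=.
- move=> c1 IH1 c2 IH2 o x x'; rewrite !size_cat (IH2 o x x').
  by rewrite (IH1 _ _ (code c2 o x').2).
- move=> j c IH c0 IH0 c1 IH1 o x x'; rewrite !size_cat (IH _ x x').
  by rewrite (IH0 _ x x') (IH1 _ x x').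
Qed.

Lemma exec_size c s r n s' : exec c s r n s' -> size s' = size s /\ total s' <= total s + n.
Proof.
move=> h; pose p := (code c 0 0).1.
have pl : placed p 0 p by exists [::], [::]; rewrite cats0.
exact: irun_size (code_run h pl).
Qed.

Definition cmd_ptm c S' ext := fptm (cmd_prog c) S' ext.

(** Initial sweep, [n] instructions on tapes of at most [a + n + S] cells, final shift. *)
Definition run_bound S a n := 2 * (a + S) + 1 + n * (6 * (a + n + S) + 20) + 3 * (a + n + S).

Local Open Scope ring_scope.

Lemma avg_eq0 n h : (forall c, 0 <= h c) -> avg n h = 0 -> forall c, size c = n -> h c = 0.
Proof.
have hge m (f : seq bool -> algC) : (forall c, 0 <= f c) -> 0 <= avg m f.
  by elim: m f => //= m IH f hf; rewrite divr_ge0 ?ler0n // addr_ge0 // IH.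
elim: n h => [|n IH] h hh /= e c; first by move/size0nil=> ->.
move/eqP: e; rewrite mulf_eq0 invr_eq0 pnatr_eq0 orbF paddr_eq0; try exact: hge.
by case/andP=> /eqP e0 /eqP e1; case: c => //= -[] c [hc]; [apply: (IH _ _ e1)|apply: (IH _ _ e0)].
Qed.

Lemma bits_prefix_blank (st : seq bool) R : bits_prefix (map bsym st ++ Blank :: R) = st.
Proof. by elim: st => //= b st IH; case: b; rewrite /= IH. Qed.

Lemma bits_prefix_hash (st : seq bool) R : bits_prefix (map bsym st ++ Hash :: R) = st.
Proof. by elim: st => //= b st IH; case: b; rewrite /= IH. Qed.

(** The bridge from programs to machines. Every execution reads exactly [m] coins, so the output is
    a function of [m] uniform coins whatever time bound [T] is granted. *)
Theorem cmd_realized c S' ext (w : seq sym) s m N (F : seq bool -> seq (seq bool)) T :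
  (ext <= S'.+1)%N -> flat s = Hash :: w ++ nseq ext Hash -> size s = S'.+1 ->
  (forall r, size r = m -> exists2 n, (n <= N)%N & exec c s r n (F r)) ->
  (run_bound S'.+1 (total s) N <= T)%N ->
  halts_within (cmd_ptm c S' ext) T w /\
  forall g : seq bool -> algC, avg T (fun c' => g (output (cmd_ptm c S' ext) w c'))
    = avg m (fun r => g (nth [::] (F r) 0)).
Proof.
move=> he hs hS hF hT; pose M := cmd_ptm c S' ext.
pose l := (code c 1 (size (code c 1 0).1).+1).1.
have hsl : size (cmd_prog c) = (size l).+2 by rewrite /= size_rcons.
have hpl : placed (cmd_prog c) 1 l.
  by exists [:: IPush 0 false (code c 1 (size (code c 1 0).1).+1).2], [:: IHalt]; rewrite cats1.
have hlx : size (code c 1 0).1 = size l by exact: size_code.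
pose fin r : config M := @cf _ _ (@fdelta (cmd_prog c) S') None
   (Blank :: rev (behead (flat (F r)))) [:: Blank].
have hrun r : size r = m -> exists n, [/\ (n <= T)%N,
    path (@step M) (@cf _ _ (@fdelta (cmd_prog c) S') (Some (ord0, PIns Blank Hash (inord ext))) [::] w) r n (fin r)
     & forall b, step (fin r) b = fin r].
  move=> hr; have [n hn ex] := hF r hr.
  have [e1 e2] := exec_size ex.
  have p1 := init_path (cmd_prog c) hs hS he.
  have [t ht p2] := irun_path ext (code_run ex hpl) hS.
  rewrite hlx in p2.
  have e0 : next_label (instr_at (cmd_prog c) 0) Blank = (code c 1 (size l).+1).2.
    by rewrite /instr_at /cmd_prog /= hlx.
  rewrite e0 in p1.
  have hh : instr_at (cmd_prog c) (size l).+1 = IHalt.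
    by rewrite /instr_at /= nth_rcons ltnn eqxx.
  have hle : ((size l).+1 <= size (cmd_prog c))%N by rewrite hsl.
  have p3 := halt_path ext hh hle (etrans e1 hS).
  have p := path_trans p1 (path_trans p2 p3); rewrite cats0 in p.
  eexists; split; [|exact: p|exact: step_halted].
  apply: leq_trans hT; rewrite /run_bound !size_flat e1 hS -!/(total _).
  move: ht hn e2; move: (total s) (total (F r)) => a b; clear; nia.
have hT0 : (0 < T)%N by apply: leq_trans hT; rewrite /run_bound; lia.
have hcn (c' : seq bool) : size c' = T -> c' != [::] by case: c' => // e; rewrite -e in hT0.
have H := fun g => avg_path g hrun.
split.
  move=> c'; rewrite run_init ?hcn ?size_tuple //.
  (* Halting on every coin sequence is read off an average: the indicator of not halting is
     nonnegative and averages to 0 over the final configurations. *)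
  have := @avg_eq0 T (fun c0 => (cstate (foldl (@step M) (@cf _ _ (@fdelta (cmd_prog c) S')
     (Some (ord0, PIns Blank Hash (inord ext))) [::] w) c0) != halt_state M)%:R).
  rewrite (H (fun cf => (cstate cf != halt_state M)%:R)).
  move=> /(_ (fun=> ler0n _ _)); rewrite (@eq_avg _ _ (fun=> 0)) ?avg_const; last first.
    by move=> r _; rewrite /fin cf_halted eqxx.
  move=> /(_ erefl c' (size_tuple _)) /eqP; rewrite pnatr_eq0 eqb0 negbK => /eqP.
  exact.
move=> g; pose h (cf : config M) := g (bits_prefix (map (ctape cf) (iota 0 (T + size w)))).
transitivity (avg T (fun c0 => h (foldl (@step M) (@cf _ _ (@fdelta (cmd_prog c) S')
     (Some (ord0, PIns Blank Hash (inord ext))) [::] w) c0))).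
  by apply: eq_avg => c' hc; rewrite /output -/M run_init ?hcn // hc.
rewrite H; apply: eq_avg => r hr; rewrite /h; congr g.
have [n hn ex] := hF r hr; have [e1 e2] := exec_size ex; rewrite hS in e1.
have -> : ctape (fin r) = (fun i => nth Blank (behead (flat (F r))) i).
  rewrite /= rev_cons revK; apply: functional_extensionality => i.
  rewrite -cats1 -catA nth_cat; case: ltnP => // h1.
  by rewrite (nth_default _ h1); case: (i - _)%N => [|[|k]] //=; rewrite nth_nil.
case: (F r) e1 e2 => [//|st s1] e1 e2; rewrite flat_cons /=.
have hst : (size st < T)%N.
  apply: leq_ltn_trans (_ : (total s + N < _))%N.
    by apply: leq_trans (leq_trans e2 _); [rewrite /total /= leq_addr|rewrite leq_add2l].
  apply: leq_trans hT; rewrite /run_bound; move: (total s) => a; clear; nia.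
have -> : (T + size w = size st + (T + size w - size st).-1.+1)%N by lia.
rewrite iotaD add0n map_cat.
have -> : map (nth Blank (map bsym st ++ flat s1)) (iota 0 (size st)) = map bsym st.
  apply: (@eq_from_nth _ Blank); rewrite !size_map size_iota // => i hi.
  by rewrite (nth_map 0%N) ?size_iota // nth_iota // add0n nth_cat size_map hi.
rewrite /= nth_cat size_map ltnn subnn.
case: (s1) => [|st2 s2] /=; [exact: bits_prefix_blank|exact: bits_prefix_hash].
Qed.

Local Close Scope ring_scope.

(** * Programs on serialized trees *)

Inductive tree := Nil | Cons of tree & tree.

(** A preorder code; it is prefix free, so values delimit themselves and can be piled up on one
    stack. *)
Fixpoint ser (t : tree) : seq bool :=
  if t is Cons a b then true :: ser a ++ ser b else [:: false].

(** [D] holds the data, [C] is a unary counter, [A] and [B] are scratch stacks. *)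
Definition st (D C A B : seq bool) := [:: D; C; A; B].
Notation st1 D := (st D [::] [::] [::]).

Definition ex0 c s N s' := exists2 n, n <= N & exec c s [::] n s'.

Lemma ex0_le c s N s' N' : ex0 c s N s' -> N <= N' -> ex0 c s N' s'.
Proof. by case=> n h e h'; exists n => //; exact: leq_trans h h'. Qed.

Lemma ex0_seq c1 c2 s N1 s1 N2 s2 : ex0 c1 s N1 s1 -> ex0 c2 s1 N2 s2 ->
  ex0 (Seq c1 c2) s (N1 + N2) s2.
Proof.
case=> n1 h1 e1 [n2 h2 e2]; exists (n1 + n2); first by rewrite leq_add.
exact: ex_seq e1 e2.
Qed.

Lemma ex0_skip s : ex0 Skip s 0 s.
Proof. by exists 0 => //; exact: ex_skip. Qed.

Lemma ex0_push j b s : j < size s -> ex0 (Push j b) s 1 (upd s j (b :: nth [::] s j)).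
Proof. by move=> h; exists 1 => //; exact: ex_push. Qed.

Lemma ex0_case j cE c0 c1 s b t N s' : j < size s -> nth [::] s j = b :: t ->
  ex0 (if b then c1 else c0) (upd s j t) N s' -> ex0 (Case j cE c0 c1) s N.+1 s'.
Proof. by move=> hj hn [n h e]; exists n.+1 => //; exact: ex_case hj hn e. Qed.

Lemma ex0_loop j c0 c1 s b t N1 s1 N2 s2 : j < size s -> nth [::] s j = b :: t ->
  ex0 (if b then c1 else c0) (upd s j t) N1 s1 -> ex0 (Loop j c0 c1) s1 N2 s2 ->
  ex0 (Loop j c0 c1) s (N1 + N2).+1 s2.
Proof.
move=> hj hn [n1 h1 e1] [n2 h2 e2]; exists (n1 + n2).+1; first by rewrite ltnS leq_add.
exact: ex_loop hj hn e1 e2.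
Qed.

Lemma ex0_loop0 j c0 c1 s : j < size s -> nth [::] s j = [::] -> ex0 (Loop j c0 c1) s 1 s.
Proof. by move=> hj hn; exists 1 => //; exact: ex_loop0. Qed.

Lemma ex0_while0 j c s t : j < size s -> nth [::] s j = false :: t ->
  ex0 (While j c) s 1 (upd s j t).
Proof. by move=> hj hn; exists 1 => //; exact: ex_while1 hj hn. Qed.

Lemma ex0_while j c s t N1 s1 N2 s2 : j < size s -> nth [::] s j = true :: t ->
  ex0 c (upd s j t) N1 s1 -> ex0 (While j c) s1 N2 s2 ->
  ex0 (While j c) s (N1 + N2).+1 s2.
Proof.
move=> hj hn [n1 h1 e1] [n2 h2 e2]; exists (n1 + n2).+1; first by rewrite ltnS leq_add.
exact: ex_while hj hn e1 e2.
Qed.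

(* Moves the serialized tree on top of stack 0 to stack k, using stack 1 as a unary
   counter of the subtrees still to be read. *)
Definition move_loop k := Loop 1 Skip (Case 0 Skip (Push k false)
  (Seq (Push k true) (Seq (Push 1 true) (Push 1 true)))).
Definition move k := Seq (Push 1 true) (move_loop k).
Definition restore k := Loop k (Push 0 false) (Push 0 true).

(** One loop reads the whole tree, so the statement extends a remaining run [h] by the reading of
    [t]. The two subtrees of a node are then consumed one after the other, each for one mark of the
    counter. *)
Lemma move_loop2 t D C A B N s' : ex0 (move_loop 2) (st D C (rev (ser t) ++ A) B) N s' ->
  ex0 (move_loop 2) (st (ser t ++ D) (true :: C) A B) (5 * size (ser t) + N) s'.
Proof.
elim: t D C A N s' => [|a IHa b IHb] D C A N s' h /=.
  apply: ex0_le (_ : _ <= _); first apply: (@ex0_loop _ _ _ _ true) => //=.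
  - apply: (@ex0_case _ _ _ _ _ false) => //=; exact: ex0_push.
  - exact: h.
  - lia.
apply: ex0_le; first apply: (@ex0_loop _ _ _ _ true) => //=.
- apply: (@ex0_case _ _ _ _ _ true) => //=.
  apply: ex0_seq; first exact: ex0_push.
  apply: ex0_seq; first exact: ex0_push.
  exact: ex0_push.
- rewrite /upd /= -catA; apply: IHa; apply: IHb.
  by move: h; rewrite /= rev_cons rev_cat cat_rcons -catA; exact.
- by rewrite size_cat; lia.
Qed.

Lemma move_loop3 t D C A B N s' : ex0 (move_loop 3) (st D C A (rev (ser t) ++ B)) N s' ->
  ex0 (move_loop 3) (st (ser t ++ D) (true :: C) A B) (5 * size (ser t) + N) s'.
Proof.
elim: t D C B N s' => [|a IHa b IHb] D C B N s' h /=.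
  apply: ex0_le (_ : _ <= _); first apply: (@ex0_loop _ _ _ _ true) => //=.
  - apply: (@ex0_case _ _ _ _ _ false) => //=; exact: ex0_push.
  - exact: h.
  - lia.
apply: ex0_le; first apply: (@ex0_loop _ _ _ _ true) => //=.
- apply: (@ex0_case _ _ _ _ _ true) => //=.
  apply: ex0_seq; first exact: ex0_push.
  apply: ex0_seq; first exact: ex0_push.
  exact: ex0_push.
- rewrite /upd /= -catA; apply: IHa; apply: IHb.
  by move: h; rewrite /= rev_cons rev_cat cat_rcons -catA; exact.
- by rewrite size_cat; lia.
Qed.

Lemma move2 t D A B : ex0 (move 2) (st (ser t ++ D) [::] A B) (5 * size (ser t) + 2)
  (st D [::] (rev (ser t) ++ A) B).
Proof.
apply: ex0_le; first apply: ex0_seq; first exact: ex0_push.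
  apply: move_loop2; exact: ex0_loop0.
lia.
Qed.

Lemma move3 t D A B : ex0 (move 3) (st (ser t ++ D) [::] A B) (5 * size (ser t) + 2)
  (st D [::] A (rev (ser t) ++ B)).
Proof.
apply: ex0_le; first apply: ex0_seq; first exact: ex0_push.
  apply: move_loop3; exact: ex0_loop0.
lia.
Qed.

Lemma restore2 D A B : ex0 (restore 2) (st D [::] A B) (2 * size A + 1) (st (rev A ++ D) [::] [::] B).
Proof.
elim: A D => [|b A IH] D; first exact: ex0_loop0.
apply: ex0_le; first apply: (@ex0_loop _ _ _ _ b A _ (st (b :: D) [::] A B)) => //=.
- by case: (b); exact: ex0_push.
- by rewrite rev_cons cat_rcons; exact: IH.
- by rewrite /=; lia.
Qed.

Lemma restore3 D A B : ex0 (restore 3) (st D [::] A B) (2 * size B + 1) (st (rev B ++ D) [::] A [::]).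
Proof.
elim: B D => [|b B IH] D; first exact: ex0_loop0.
apply: ex0_le; first apply: (@ex0_loop _ _ _ _ b B _ (st (b :: D) [::] A B)) => //=.
- by case: (b); exact: ex0_push.
- by rewrite rev_cons cat_rcons; exact: IH.
- by rewrite /=; lia.
Qed.

Definition swapv := Seq (move 2) (Seq (move 3) (Seq (restore 2) (restore 3))).

Lemma swapvE t u D : ex0 swapv (st1 (ser t ++ ser u ++ D))
  (7 * size (ser t) + 7 * size (ser u) + 6) (st1 (ser u ++ ser t ++ D)).
Proof.
apply: ex0_le; first apply: ex0_seq; first exact: move2.
  apply: ex0_seq; first exact: move3.
  rewrite !cats0; apply: ex0_seq; first exact: restore2.
  rewrite revK; have := restore3 (ser t ++ D) [::] (rev (ser u)); rewrite revK; exact.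
by rewrite !size_rev; lia.
Qed.

Definition dropv := Seq (move 2) (Loop 2 Skip Skip).

Lemma dropvE t D : ex0 dropv (st1 (ser t ++ D)) (6 * size (ser t) + 3) (st1 D).
Proof.
have h A : ex0 (Loop 2 Skip Skip) (st D [::] A [::]) (size A + 1) (st1 D).
  elim: A => [|b A IH]; first exact: ex0_loop0.
  apply: ex0_le; first apply: (@ex0_loop _ _ _ _ b A _ (st D [::] A [::])) => //=.
  - by case: (b); exact: ex0_skip.
  - exact: IH.
  - by rewrite /=; lia.
apply: ex0_le; first apply: ex0_seq; [exact: move2|exact: h|].
by rewrite size_cat size_rev /=; lia.
Qed.

(* The loop on stack 2 rebuilds the value on stack 0 and copies it to stack 3. *)
Definition dupv := Seq (move 2) (Seq
  (Loop 2 (Seq (Push 0 false) (Push 3 false)) (Seq (Push 0 true) (Push 3 true)))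
  (Seq (Loop 3 (Push 2 false) (Push 2 true)) (restore 2))).

Lemma dupvE t D : ex0 dupv (st1 (ser t ++ D)) (12 * size (ser t) + 5) (st1 (ser t ++ ser t ++ D)).
Proof.
have h1 A D' B : ex0 (Loop 2 (Seq (Push 0 false) (Push 3 false)) (Seq (Push 0 true) (Push 3 true)))
   (st D' [::] A B) (3 * size A + 1) (st (rev A ++ D') [::] [::] (rev A ++ B)).
  elim: A D' B => [|b A IH] D' B; first exact: ex0_loop0.
  apply: ex0_le; first apply: (@ex0_loop _ _ _ _ b A _ (st (b :: D') [::] A (b :: B))) => //=.
  - by case: (b); apply: ex0_seq; exact: ex0_push.
  - by rewrite rev_cons !cat_rcons; exact: IH.
  - by rewrite /=; lia.
have h2 B D' A : ex0 (Loop 3 (Push 2 false) (Push 2 true))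
   (st D' [::] A B) (2 * size B + 1) (st D' [::] (rev B ++ A) [::]).
  elim: B A => [|b B IH] A; first exact: ex0_loop0.
  apply: ex0_le; first apply: (@ex0_loop _ _ _ _ b B _ (st D' [::] (b :: A) B)) => //=.
  - by case: (b); exact: ex0_push.
  - by rewrite rev_cons !cat_rcons; exact: IH.
  - by rewrite /=; lia.
apply: ex0_le; first apply: ex0_seq; first exact: move2.
  rewrite cats0; apply: ex0_seq; first exact: h1.
  rewrite revK cats0; apply: ex0_seq; first exact: h2.
  rewrite cats0; have := restore2 (ser t ++ D) (rev (ser t)) [::]; rewrite revK; exact.
by rewrite !size_rev; lia.
Qed.

Fixpoint push_bits (u : seq bool) : cmd :=
  if u is b :: u' then Seq (push_bits u') (Push 0 b) else Skip.

Lemma push_bitsE u D C A B : ex0 (push_bits u) (st D C A B) (size u) (st (u ++ D) C A B).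
Proof.
elim: u => [|b u IH] /=; first exact: ex0_skip.
rewrite -addn1; apply: ex0_seq; first exact: IH; exact: ex0_push.
Qed.

Class Enc (A : Type) := enc : A -> tree.
Instance Enc_unit : Enc unit := fun _ => Nil.
Instance Enc_bool : Enc bool := fun b => if b then Cons Nil Nil else Nil.
Instance Enc_prod A B {_ : Enc A} {_ : Enc B} : Enc (A * B) :=
  fun p => Cons (enc p.1) (enc p.2).
Instance Enc_seq A {_ : Enc A} : Enc (seq A) := foldr (fun a => Cons (enc a)) Nil.
(** The same trees as lists of units: numbers are unary, and iteration is a fold over a list. *)
Instance Enc_nat : Enc nat := fun n => iter n (Cons Nil) Nil.

Definition sz A {_ : Enc A} (a : A) := size (ser (enc a)).

Lemma ser_pair A B {_ : Enc A} {_ : Enc B} (a : A) (b : B) :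
  ser (enc (a, b)) = true :: ser (enc a) ++ ser (enc b).
Proof. by []. Qed.

Lemma ser_cons A {_ : Enc A} (a : A) l : ser (enc (a :: l)) = true :: ser (enc a) ++ ser (enc l).
Proof. by []. Qed.

Lemma sz_pair A B {_ : Enc A} {_ : Enc B} (a : A) (b : B) : sz (a, b) = (sz a + sz b).+1.
Proof. by rewrite /sz ser_pair /= size_cat. Qed.

Lemma sz_cons A {_ : Enc A} (a : A) l : sz (a :: l) = (sz a + sz l).+1.
Proof. by rewrite /sz ser_cons /= size_cat. Qed.

Lemma sz_nil A {_ : Enc A} : sz (@nil A) = 1. Proof. by []. Qed.

(** The rest [D] of the data stack is a frame that the program leaves alone, which is what lets
    programs be composed. *)
Definition rz A B {_ : Enc A} {_ : Enc B} (c : cmd) (f : A -> B) (t : A -> nat) :=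
  forall a D, ex0 c (st1 (ser (enc a) ++ D)) (t a) (st1 (ser (enc (f a)) ++ D)).

Section Rz.
Context {A B C : Type} {eA : Enc A} {eB : Enc B} {eC : Enc C}.

Lemma rz_id (f : A -> B) : (forall a, enc (f a) = enc a) -> rz Skip f (fun=> 0).
Proof. by move=> h a D; rewrite h; exact: ex0_skip. Qed.

Lemma rz_comp c c' (f : A -> B) (g : B -> C) t t' : rz c f t -> rz c' g t' ->
  rz (Seq c c') (fun a => g (f a)) (fun a => t a + t' (f a)).
Proof. by move=> h h' a D; apply: ex0_seq. Qed.

Lemma rz_pair c c' (f : A -> B) (g : A -> C) t t' : rz c f t -> rz c' g t' ->
  rz (Seq dupv (Seq c' (Seq swapv (Seq c (Push 0 true))))) (fun a => (f a, g a))
    (fun a => t a + t' a + 19 * sz a + 7 * sz (g a) + 12).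
Proof.
move=> h h' a D; apply: ex0_le; first apply: ex0_seq; first exact: dupvE.
  apply: ex0_seq; first exact: h'.
  apply: ex0_seq; first exact: swapvE.
  apply: ex0_seq; first exact: h.
  have := @ex0_push 0 true (st1 (ser (enc (f a)) ++ ser (enc (g a)) ++ D)) isT.
  by rewrite /upd /= -catA; exact.
rewrite /sz; lia.
Qed.

Lemma rz_const (b : B) :
  rz (Seq dropv (push_bits (ser (enc b)))) (fun _ : A => b) (fun a => 6 * sz a + 3 + sz b).
Proof. move=> a D; apply: ex0_seq; [exact: dropvE|exact: push_bitsE]. Qed.

(** [false] is serialized as one bit and [true] as three, hence the two further pops before [c1]. *)
Lemma rz_if c c1 c2 (b : A -> bool) (f g : A -> B) t t1 t2 : rz c b t -> rz c1 f t1 -> rz c2 g t2 ->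
  rz (Seq dupv (Seq c (Case 0 Skip c2 (Seq (Case 0 Skip Skip Skip) (Seq (Case 0 Skip Skip Skip) c1)))))
    (fun a => if b a then f a else g a)
    (fun a => t a + t1 a + t2 a + 12 * sz a + 8).
Proof.
move=> h h1 h2 a D; apply: ex0_le; first apply: ex0_seq; first exact: dupvE.
  apply: ex0_seq; first exact: h.
  instantiate (1 := t1 a + t2 a + 3).
  case: (b a); apply: ex0_le.
  - apply: (@ex0_case _ _ _ _ _ true) => //=.
    apply: ex0_seq; first by apply: (@ex0_case _ _ _ _ _ false) => //=; exact: ex0_skip.
    apply: ex0_seq; first by apply: (@ex0_case _ _ _ _ _ false) => //=; exact: ex0_skip.
    exact: h1.
  - by lia.
  - apply: (@ex0_case _ _ _ _ _ false) => //=; exact: h2.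
  - by lia.
rewrite /sz; lia.
Qed.

End Rz.

Section Rz2.
Context {A B : Type} {eA : Enc A} {eB : Enc B}.

Lemma rz_fst : rz (Case 0 Skip Skip (Seq swapv dropv)) (fst : A * B -> A)
  (fun p => 13 * sz p + 10).
Proof.
case=> a b D; rewrite ser_pair sz_pair /= -catA; apply: ex0_le; first apply: (@ex0_case _ _ _ _ _ true) => //=.
  apply: ex0_seq; [exact: swapvE|exact: dropvE].
by rewrite /sz; lia.
Qed.

Lemma rz_snd : rz (Case 0 Skip Skip dropv) (snd : A * B -> B) (fun p => 13 * sz p + 10).
Proof.
case=> a b D; rewrite ser_pair sz_pair /= -catA; apply: ex0_le; first apply: (@ex0_case _ _ _ _ _ true) => //=.
  exact: dropvE.
by rewrite /sz; lia.
Qed.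

Lemma rz_nilp : rz (Case 0 Skip (push_bits (ser (enc true)))
    (Seq dropv (Seq dropv (push_bits (ser (enc false)))))) (@nilp A) (fun l => 6 * sz l + 10).
Proof.
case=> [|a l] D.
  apply: ex0_le; first apply: (@ex0_case _ _ _ _ _ false) => //=; first exact: (push_bitsE [:: true; false; false]).
  by rewrite /sz /=; lia.
rewrite ser_cons sz_cons /= -catA; apply: ex0_le; first apply: (@ex0_case _ _ _ _ _ true) => //=.
  apply: ex0_seq; first exact: dropvE.
  apply: ex0_seq; first exact: dropvE.
  exact: (push_bitsE [:: false]).
by rewrite /sz -[size [:: false]]/1; lia.
Qed.

Lemma rz_behead : rz (Case 0 Skip (Push 0 false) dropv) (@behead A) (fun l => 6 * sz l + 10).
Proof.
case=> [|a l] D.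
  apply: ex0_le; first apply: (@ex0_case _ _ _ _ _ false) => //=; first exact: ex0_push.
  by rewrite /sz /=; lia.
rewrite ser_cons sz_cons /= -catA; apply: ex0_le; first apply: (@ex0_case _ _ _ _ _ true) => //=.
  exact: dropvE.
by rewrite /sz; lia.
Qed.

Lemma rz_head (x0 : A) : rz (Case 0 Skip (push_bits (ser (enc x0))) (Seq swapv dropv))
  (head x0) (fun l => 13 * sz l + sz x0 + 10).
Proof.
case=> [|a l] D.
  apply: ex0_le; first apply: (@ex0_case _ _ _ _ _ false) => //=; first exact: push_bitsE.
  by rewrite /sz /=; lia.
rewrite ser_cons sz_cons /= -catA; apply: ex0_le; first apply: (@ex0_case _ _ _ _ _ true) => //=.
  apply: ex0_seq; [exact: swapvE|exact: dropvE].
by rewrite /sz; lia.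
Qed.

Lemma rz_succ : rz (push_bits [:: true; false]) S (fun=> 2).
Proof. move=> n D; exact: (push_bitsE [:: true; false]). Qed.

(** Starts with head, tail and accumulator on the stack. The tail is set aside, and a bit pushed in
    front of the head turns head and accumulator into the pair that [c] expects; the tail ends on
    top, ready for the next round. *)
Definition fold_body c := Seq swapv (Seq (move 2) (Seq (Push 0 true) (Seq (restore 2)
   (Seq swapv (Seq c swapv))))).

Fixpoint fold_time (h : A * B -> B) (t : A * B -> nat) (l : seq A) (s : B) : nat :=
  if l is a :: l' then
    7 * sz a + 28 * sz l' + 7 * sz (a, s) + 7 * sz (h (a, s)) + t (a, s) + 30
    + fold_time h t l' (h (a, s))
  else 1.

Lemma rz_fold c (h : A * B -> B) t : rz c h t ->
  rz (Case 0 Skip Skip (While 0 (fold_body c)))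
    (fun p : seq A * B => foldl (fun s a => h (a, s)) p.2 p.1)
    (fun p => (fold_time h t p.1 p.2).+1).
Proof.
move=> H [l s] D; rewrite ser_pair; apply: (@ex0_case _ _ _ _ _ true) => //=; rewrite /upd /= -catA.
elim: l s D => [|a l IH] s D; first exact: ex0_while0.
rewrite ser_cons /= -catA; apply: ex0_le; first apply: ex0_while; rewrite //= ?/upd /=.
- apply: ex0_seq; first exact: swapvE.
  apply: ex0_seq; first exact: move2.
  apply: ex0_seq; first exact: ex0_push.
  rewrite /upd /= cats0; apply: ex0_seq; first exact: restore2.
  rewrite revK; apply: (@ex0_seq _ _ _ _ (st1 (ser (@enc _ (@Enc_prod A B eA eB) (a, s)) ++ ser (enc l) ++ D))).
    move: (swapvE (@enc _ (@Enc_seq A eA) l) (@enc _ (@Enc_prod A B eA eB) (a, s)) D).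
    by rewrite ser_pair /= -!catA; exact.
  apply: ex0_seq; first exact: H.
  exact: swapvE.
- by rewrite size_rev sz_pair size_cat /sz; lia.
Qed.
End Rz2.

(** * Computable and polynomial-time functions *)

Lemma leq_expr k l l' : l <= l' -> l ^ k <= l' ^ k.
Proof. by move=> h; elim: k => // k IH; rewrite !expnS leq_mul. Qed.

Lemma tb_mono k l l' : l <= l' -> tb k l <= tb k l'.
Proof. by move=> h; rewrite /tb leq_add2r leq_mul2l leq_expr ?orbT. Qed.

Lemma tb0 k : tb k 0 = k.
Proof. by case: k => // k; rewrite /tb exp0n // muln0. Qed.

Lemma tb_pos k l : 0 < l -> tb k l <= 2 * k * l ^ k.
Proof. by move=> h; rewrite /tb; have := expn_gt0 l k; rewrite h /=; nia. Qed.

Lemma tb_ge K c k l : 0 < l -> c <= K -> k <= K -> c * l ^ k <= tb K l.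
Proof.
move=> h hc hk; apply: leq_trans (leq_addr _ _).
by rewrite leq_mul // leq_pexp2l.
Qed.

Lemma tb_add k k' l : tb k l + tb k' l <= tb (k + k') l.
Proof.
case: l => [|l]; first by rewrite !tb0.
rewrite {1 2}/tb addnACA leq_add2r /= mulnDl.
by rewrite leq_add // leq_mul2l leq_pexp2l ?orbT // ?leq_addr ?leq_addl.
Qed.

Lemma tb_mul k k' l : tb k l * tb k' l <= tb (4 * k * k' + k + k') l.
Proof.
case: l => [|l]; first by rewrite !tb0; nia.
apply: leq_trans (leq_mul (tb_pos k (ltn0Sn l)) (tb_pos k' (ltn0Sn l))) _.
have -> : 2 * k * l.+1 ^ k * (2 * k' * l.+1 ^ k') = 4 * k * k' * l.+1 ^ (k + k').
  by rewrite expnD; ring.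
by apply: tb_ge => //; rewrite -addnA ?leq_addr ?leq_addl.
Qed.

Lemma tb_comp k k' l : tb k (tb k' l) <= tb (2 * k * (2 * k') ^ k + k' * k + tb k k') l.
Proof.
case: l => [|l]; first by rewrite !tb0 leq_addl.
case: k' => [|k']; first by rewrite {2}/tb mul0n addn0 {1}tb0 /tb; nia.
have hp : 0 < tb k'.+1 l.+1 by rewrite /tb addnS.
apply: leq_trans (tb_pos k hp) _.
apply: (@leq_trans (2 * k * (2 * k'.+1 * l.+1 ^ k'.+1) ^ k)).
  by rewrite leq_mul2l leq_expr ?orbT // tb_pos.
rewrite expnMn -expnM mulnA.
by apply: tb_ge => //; rewrite -addnA ?leq_addr // addnCA leq_addr.
Qed.

(** Polynomial bounds in the form [tb] used by [is_PPT]; the preceding lemmas show that this family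
    absorbs sums, products and compositions. *)
Definition PB X (z t : X -> nat) := exists k, forall x, t x <= tb k (z x).

Section PB.
Variables (X : Type) (z : X -> nat).

Lemma PB_le t t' : (forall x, t x <= t' x) -> PB z t' -> PB z t.
Proof. by move=> h [k hk]; exists k => x; exact: leq_trans (h x) (hk x). Qed.

Lemma PB_add t t' : PB z t -> PB z t' -> PB z (fun x => t x + t' x).
Proof.
move=> [k h] [k' h']; exists (k + k') => x; apply: leq_trans (tb_add _ _ _).
by rewrite leq_add.
Qed.

Lemma PB_mul t t' : PB z t -> PB z t' -> PB z (fun x => t x * t' x).
Proof.
move=> [k h] [k' h']; eexists => x; apply: leq_trans (tb_mul _ _ _).
by rewrite leq_mul.
Qed.

Lemma PB_const c : PB z (fun=> c).
Proof. by exists c => x; rewrite /tb leq_addl. Qed.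

Lemma PB_id : PB z z.
Proof. by exists 1 => x; rewrite /tb expn1 mul1n leq_addr. Qed.

Lemma PB_tb k t : PB z t -> PB z (fun x => tb k (t x)).
Proof.
move=> [k' h']; eexists => x; apply: leq_trans (tb_comp _ _ _).
exact: tb_mono.
Qed.

Lemma PB_succ t : PB z t -> PB z (fun x => (t x).+1).
Proof. by move=> h; apply: PB_le (PB_add h (PB_const 1)) => x; rewrite addn1. Qed.

Lemma PB_exp t k : PB z t -> PB z (fun x => t x ^ k).
Proof.
move=> h; elim: k => [|k IH]; first exact: PB_const.
by apply: PB_le (PB_mul h IH) => x; rewrite expnS.
Qed.
End PB.

Ltac pb := repeat first [assumption | apply: PB_id | apply: PB_const | apply: PB_add
  | apply: PB_mul | apply: PB_succ | apply: PB_tb | apply: PB_exp].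

Lemma PB_comp X Y (z : X -> nat) (w : Y -> nat) (t : Y -> nat) (f : X -> Y) :
  PB w t -> PB z (fun x => w (f x)) -> PB z (fun x => t (f x)).
Proof. by case=> k h h'; apply: PB_le (PB_tb k h') => x. Qed.

(* Computability by a stack program; in polynomial time when pl holds. *)
Definition Cp (pl : bool) A B {_ : Enc A} {_ : Enc B} (f : A -> B) :=
  exists c t, rz c f t /\ (pl -> PB (@sz A _) t).

Lemma sz_gt0 A {_ : Enc A} (a : A) : 0 < sz a.
Proof. by rewrite /sz; case: (enc a). Qed.

Section Cp.
Context {A B C : Type} {eA : Enc A} {eB : Enc B} {eC : Enc C} {pl : bool}.

Lemma Cp_ext (f g : A -> B) : f =1 g -> Cp pl f -> Cp pl g.
Proof. by move=> e [c [t [h p]]]; exists c, t; split=> // a D; rewrite -e. Qed.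

Lemma Cp_cast (f : A -> B) : (forall a, enc (f a) = enc a) -> Cp pl f.
Proof. by move=> h; exists Skip, (fun=> 0); split; [exact: rz_id|move=> _; exact: PB_const]. Qed.

Lemma Cp_id : Cp pl (fun a : A => a).
Proof. by exists Skip, (fun=> 0); split; [exact: rz_id|move=> _; exact: PB_const]. Qed.

Lemma Cp_const (b : B) : Cp pl (fun _ : A => b).
Proof. by eexists; eexists; split; [exact: rz_const|move=> _; pb]. Qed.

(** An instruction adds at most one bit to the stacks, so the output is no longer than input size
    plus running time. *)
Lemma Cp_size (f : A -> B) : Cp true f -> PB (@sz A _) (fun a => sz (f a)).
Proof.
case=> c [t [h /(_ isT) p]].
apply: (@PB_le _ _ _ (fun a => sz a + t a)); last by pb.
move=> a.
have [n hn e] := h a [::]; have [_] := exec_size e.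
rewrite /total /= !cats0 !addn0 /sz => h2; lia.
Qed.
End Cp.

Section Cp2.
Context {A B C : Type} {eA : Enc A} {eB : Enc B} {eC : Enc C} {pl : bool}.

Lemma Cp_comp (f : A -> B) (g : B -> C) : Cp pl g -> Cp pl f -> Cp pl (fun a => g (f a)).
Proof.
move=> [c [t [h p]]] hf; have [c' [t' [h' p']]] := hf; eexists; eexists; split.
  exact: rz_comp h' h.
move=> e; apply: PB_add (p' e) _; apply: (PB_comp (p e)).
by apply: Cp_size; rewrite -e.
Qed.

Lemma Cp_pair (f : A -> B) (g : A -> C) : Cp pl f -> Cp pl g -> Cp pl (fun a => (f a, g a)).
Proof.
move=> [c [t [h p]]] hg; have [c' [t' [h' p']]] := hg; eexists; eexists; split.
  exact: rz_pair h h'.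
move=> e; have {}p := p e; have {}p' := p' e.
have hs : PB (@sz A _) (fun a => sz (g a)) by apply: Cp_size; rewrite -e.
pb.
Qed.

Lemma Cp_if (b : A -> bool) (f g : A -> B) : Cp pl b -> Cp pl f -> Cp pl g ->
  Cp pl (fun a => if b a then f a else g a).
Proof.
move=> [c0 [t0 [h0 p0]]] [c [t [h p]]] [c' [t' [h' p']]]; eexists; eexists; split.
  exact: rz_if h0 h h'.
move=> e; have {}p := p e; have {}p' := p' e; have {}p0 := p0 e; pb.
Qed.
End Cp2.

Section Cp3.
Context {X A B : Type} {eX : Enc X} {eA : Enc A} {eB : Enc B} {pl : bool}.

Lemma Cp_fst (f : X -> A * B) : Cp pl f -> Cp pl (fun x => (f x).1).
Proof.
by apply: (Cp_comp (g := fst)); eexists; eexists; split; [exact: rz_fst|move=> _; pb].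
Qed.

Lemma Cp_snd (f : X -> A * B) : Cp pl f -> Cp pl (fun x => (f x).2).
Proof.
by apply: (Cp_comp (g := snd)); eexists; eexists; split; [exact: rz_snd|move=> _; pb].
Qed.

Lemma Cp_nilp (f : X -> seq A) : Cp pl f -> Cp pl (fun x => nilp (f x)).
Proof.
by apply: (Cp_comp (g := @nilp A)); eexists; eexists; split; [exact: rz_nilp|move=> _; pb].
Qed.

Lemma Cp_behead (f : X -> seq A) : Cp pl f -> Cp pl (fun x => behead (f x)).
Proof.
by apply: (Cp_comp (g := @behead A)); eexists; eexists; split; [exact: rz_behead|move=> _; pb].
Qed.

Lemma Cp_head a (f : X -> seq A) : Cp pl f -> Cp pl (fun x => head a (f x)).
Proof.
by apply: (Cp_comp (g := head a)); eexists; eexists; split; [exact: rz_head|move=> _; pb].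
Qed.

Lemma Cp_cons (f : X -> A) (g : X -> seq A) : Cp pl f -> Cp pl g -> Cp pl (fun x => f x :: g x).
Proof.
move=> hf hg; apply: (Cp_comp (f := fun x => (f x, g x)) (g := fun p : A * seq A => p.1 :: p.2)); last exact: Cp_pair hf hg.
by apply: Cp_cast; case.
Qed.

Lemma Cp_succ (f : X -> nat) : Cp pl f -> Cp pl (fun x => (f x).+1).
Proof.
apply: (Cp_comp (g := S)).
by eexists; eexists; split; [exact: rz_succ|move=> _; pb].
Qed.
End Cp3.

Lemma sz_nth A {_ : Enc A} (l : seq A) a0 i : i < size l -> sz (nth a0 l i) <= sz l.
Proof.
elim: l i => // a l IH [|i] /= h; rewrite sz_cons; first by lia.
have := IH i h; lia.
Qed.

Lemma size_sz A {_ : Enc A} (l : seq A) : size l < sz l.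
Proof. by elim: l => // a l IH; rewrite sz_cons /=; have := sz_gt0 a; lia. Qed.

Lemma fold_time_le A B {eA : Enc A} {eB : Enc B} (h : A * B -> B) t l s M L T :
  sz l <= L ->
  (forall i, sz (foldl (fun s a => h (a, s)) s (take i l)) <= M) ->
  (forall a s, sz a <= L -> sz s <= M -> t (a, s) <= T) ->
  fold_time h t l s <= size l * (42 * L + 14 * M + T + 37) + 1.
Proof.
move=> hL hM hT; elim: l s hL hM => [|a l IH] s //; rewrite sz_cons => hL hM.
rewrite [fold_time _ _ _ _]/= [size _]/=.
have h0 := hM 0; have h1 := hM 1; rewrite /= take0 /= in h0 h1.
have {}IH : fold_time h t l (h (a, s)) <= size l * (42 * L + 14 * M + T + 37) + 1.
  by apply: IH => [|i]; [lia|exact: (hM i.+1)].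
have h2 : t (a, s) <= T by apply: hT; lia.
rewrite sz_pair mulSn; lia.
Qed.

Section CpFold.
Context {X A B : Type} {eX : Enc X} {eA : Enc A} {eB : Enc B} {pl : bool}.

(** Iterating a polynomial-time step stays polynomial only if the accumulator stays small, which the
    bound [M] provides when [pl] holds. The loop body sees just an element and the accumulator, so
    the parameter [x] travels inside the accumulator. *)
Lemma Cp_foldl (l : X -> seq A) (s0 : X -> B) (h : X * (A * B) -> B) :
  Cp pl l -> Cp pl s0 -> Cp pl h ->
  (pl -> exists2 M, PB (@sz X _) M &
    forall x i, sz (foldl (fun s a => h (x, (a, s))) (s0 x) (take i (l x))) <= M x) ->
  Cp pl (fun x => foldl (fun s a => h (x, (a, s))) (s0 x) (l x)).
Proof.
move=> hl hs0 hh hM.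
pose h' (p : A * (X * B)) := (p.2.1, h (p.2.1, (p.1, p.2.2))).
have e l0 x s : foldl (fun s a => h' (a, s)) (x, s) l0 = (x, foldl (fun s a => h (x, (a, s))) s l0).
  by elim: l0 s => //= a l0 IH s; rewrite IH.
have hh' : Cp pl h'.
  apply: Cp_pair; first by apply/Cp_fst/Cp_snd/Cp_id.
  apply: (Cp_comp (g := h) hh); apply: Cp_pair; first by apply/Cp_fst/Cp_snd/Cp_id.
  by apply: Cp_pair; [apply/Cp_fst/Cp_id|apply/Cp_snd/Cp_snd/Cp_id].
have hin : Cp pl (fun x => (l x, (x, s0 x))) by apply: Cp_pair => //; apply: Cp_pair => //; exact: Cp_id.
apply: (@Cp_ext _ _ _ _ _ (fun x => (foldl (fun s a => h' (a, s)) (x, s0 x) (l x)).2)).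
  by move=> x; rewrite e.
apply: Cp_snd.
have [c [t [rh ph]]] := hh'; have [c2 [t2 [r2 p2]]] := hin.
eexists; eexists; split; first exact: (rz_comp r2 (rz_fold rh)).
move=> epl; have [M pM {}hM] := hM epl; have [k hk] := ph epl.
have hsl : PB (@sz X _) (fun x => sz (l x)) by apply: Cp_size; rewrite -epl.
have {}p2 := p2 epl.
apply: PB_add => //; apply: PB_succ.
apply: (@PB_le _ _ _ (fun x => sz (l x) * (42 * sz (l x) + 14 * (sz x + M x + 1)
   + tb k (sz (l x) + (sz x + M x + 1) + 1) + 37) + 1)); last by pb.
move=> x /=; apply: leq_trans (fold_time_le (L := sz (l x)) (M := sz x + M x + 1)
  (T := tb k (sz (l x) + (sz x + M x + 1) + 1)) _ _ _) _ => //.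
- by move=> i; rewrite e sz_pair addn1 ltnS leq_add2l.
- by move=> a [y s] h1 h2; apply: leq_trans (hk _) _; apply: tb_mono; rewrite sz_pair addn1 ltnS leq_add.
- by rewrite leq_add2r leq_mul2r ltnW ?orbT // size_sz.
Qed.

Lemma sz_foldl_le (h : A -> B -> B) l s b :
  (forall a s, sz a <= sz l -> sz (h a s) <= sz s + b) ->
  sz (foldl (fun s a => h a s) s l) <= sz s + size l * b.
Proof.
move=> H; have : forall a s, sz a <= sz l -> sz (h a s) <= sz s + b by [].
elim: l s {H} => [|a l IH] s H /=; first by rewrite addn0.
apply: leq_trans (IH _ _) _ => [a' s' ha'|].
  by apply: H; rewrite sz_cons; lia.
have := H a s; rewrite sz_cons mulSn => /(_ _) h2; have := h2 ltac:(lia); lia.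
Qed.

Lemma sz_take (l : seq A) i : sz (take i l) <= sz l.
Proof.
elim: l i => // a l IH [|i]; first by rewrite take0 sz_gt0.
by rewrite /= !sz_cons ltnS leq_add2l.
Qed.

Lemma sz_drop (l : seq A) i : sz (drop i l) <= sz l.
Proof.
elim: l i => // a l IH [|i]; first by rewrite drop0.
rewrite /= !sz_cons; have := IH i; lia.
Qed.

(** Additive growth per round keeps the accumulator polynomial, since the number of rounds is below
    the size of the list. *)
Lemma Cp_foldl_add (l : X -> seq A) (s0 : X -> B) (h : X * (A * B) -> B) (b : X -> nat) :
  Cp pl l -> Cp pl s0 -> Cp pl h -> PB (@sz X _) b ->
  (forall x a s, sz a <= sz (l x) -> sz (h (x, (a, s))) <= sz s + b x) ->
  Cp pl (fun x => foldl (fun s a => h (x, (a, s))) (s0 x) (l x)).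
Proof.
move=> hl hs hh hb H; apply: Cp_foldl => // epl.
have h1 : PB (@sz X _) (fun x => sz (l x)) by apply: Cp_size; rewrite -epl.
have h2 : PB (@sz X _) (fun x => sz (s0 x)) by apply: Cp_size; rewrite -epl.
exists (fun x => sz (s0 x) + sz (l x) * b x); first by pb.
move=> x i; pose h' a s := h (x, (a, s)).
have ht := sz_take (l x) i.
have := @sz_foldl_le h' (take i (l x)) (s0 x) (b x).
move=> /(_ (fun a s ha => H x a s (leq_trans ha ht))) H1.
apply: leq_trans H1 _; rewrite leq_add2l leq_mul2r; apply/orP; right.
exact: leq_trans (ltnW (size_sz _)) ht.
Qed.
End CpFold.

Section Avg.
Local Open Scope ring_scope.

Lemma sum_tuple_cons n (h : seq bool -> algC) :
  \sum_(c : n.+1.-tuple bool) h c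
  = \sum_(c : n.-tuple bool) h (false :: c) + \sum_(c : n.-tuple bool) h (true :: c).
Proof.
rewrite (reindex (fun p : bool * n.-tuple bool => [tuple of p.1 :: p.2])) /=; last first.
  exists (fun c : n.+1.-tuple bool => (thead c, [tuple of behead c])) => [[b c] _|c _] /=.
    by congr pair; apply: val_inj.
  by rewrite -tuple_eta.
rewrite -(pair_bigA _ (fun b (c : n.-tuple bool) => h (b :: c))) /=.
by rewrite big_bool addrC.
Qed.

Lemma avgE n h : avg n h = (\sum_(c : n.-tuple bool) h c) / 2%:R ^+ n.
Proof.
elim: n h => [|n IH] h /=.
  by rewrite expr0 divr1 (big_pred1 [tuple]) // => c; apply/esym/eqP; exact: tuple0.
by rewrite !IH sum_tuple_cons -mulrDl exprS invfM mulrA mulrAC.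
Qed.

Lemma outprob_avg M T w s : outprob M T w s = avg T (fun c => (output M w c == s)%:R).
Proof. by rewrite avgE /outprob -sum1_card natr_sum big_mkcond /=; congr (_ / _); apply: eq_bigr => c _; rewrite inE; case: eqP. Qed.

Lemma accprob_avg M T w : accprob M T w = avg T (fun c => (head false (output M w c))%:R).
Proof. by rewrite avgE /accprob -sum1_card natr_sum big_mkcond /=; congr (_ / _); apply: eq_bigr => c _; rewrite inE; case: head. Qed.

Lemma qpt_dist_avg M k l s : qpt_dist M k l s =
  avg (tb k l) (fun c => circprob (decode_circ (output M (ones l) c)) s).
Proof. by rewrite avgE /qpt_dist mulrC. Qed.
End Avg.

(** * Input, coins and output of programs *)

Lemma enc_nseq n : enc (nseq n tt) = enc n.
Proof. by elim: n => //= n IH; congr Cons. Qed.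

Lemma sz_nat (n : nat) : sz n = 2 * n + 1.
Proof. by elim: n => // n; rewrite /sz /= => ->; lia. Qed.

Lemma sz_bits (r : seq bool) : sz r <= 4 * size r + 1.
Proof. elim: r => // b r IH; rewrite sz_cons /=; case: b; rewrite [sz _]/=; move: IH; rewrite /sz /=; lia. Qed.

Definition push_zero := push_bits [:: true; false].
Definition push_one := push_bits [:: true; true; false; false].

Definition read_nat := Seq (Loop 0 (Push 2 true) (Push 2 true))
  (Seq (Push 0 false) (Loop 2 push_zero push_zero)).

Lemma ser_succ (n : nat) : ser (enc n.+1) = [:: true, false & ser (enc n)].
Proof. by []. Qed.

Lemma read_natE l C : ex0 read_nat (st (nseq l true) C [::] [::]) (6 * l + 3)
  (st (ser (enc l)) C [::] [::]).
Proof.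
have h1 A : ex0 (Loop 0 (Push 2 true) (Push 2 true)) (st (nseq l true) C A [::]) (2 * l + 1)
   (st [::] C (nseq l true ++ A) [::]).
  elim: l A => [|l IH] A; first exact: ex0_loop0.
  apply: ex0_le; first apply: (@ex0_loop _ _ _ _ true _ _ (st (nseq l true) C (true :: A) [::])) => //=.
  - exact: ex0_push.
  - have -> : true :: nseq l true ++ A = nseq l true ++ true :: A by elim: (l) => //= ? ->.
    exact: IH.
  - lia.
have h2 k : ex0 (Loop 2 push_zero push_zero) (st (ser (enc k)) C (nseq l true) [::]) (3 * l + 1)
   (st (ser (enc (l + k))) C [::] [::]).
  elim: l k {h1} => [|l IH] k; first exact: ex0_loop0.
  apply: ex0_le; first apply: (@ex0_loop _ _ _ _ true _ _ (st (ser (enc k.+1)) C (nseq l true) [::])) => //.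
  - exact: (push_bitsE [:: true; false]).
  - rewrite addSnnS; exact: IH.
  - rewrite /=; lia.
have {}h2 := h2 0; rewrite addn0 in h2; have {}h1 := h1 [::]; rewrite cats0 in h1.
apply: ex0_le; first apply: ex0_seq; first exact: h1.
  apply: ex0_seq; first exact: ex0_push.
  exact: h2.
lia.
Qed.

Definition read_bits j := Seq (Push 0 false) (Loop j push_zero push_one).

Lemma read_bits_loop2 r r' D C B : ex0 (Loop 2 push_zero push_one)
  (st (ser (enc r') ++ D) C (rev r) B) (5 * size r + 1) (st (ser (enc (r ++ r')) ++ D) C [::] B).
Proof.
elim/last_ind: r r' => [|r b IH] r'; first exact: ex0_loop0.
rewrite rev_rcons; apply: ex0_le;
 first apply: (@ex0_loop _ _ _ _ b _ _ (st (ser (enc (b :: r')) ++ D) C (rev r) B)) => //.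
- instantiate (1 := 4); case: b; first exact: (push_bitsE [:: true; true; false; false]).
  by apply: ex0_le; first exact: (push_bitsE [:: true; false]).
- rewrite cat_rcons; exact: IH.
- rewrite size_rcons; lia.
Qed.

Lemma read_bits_loop3 r r' D C A : ex0 (Loop 3 push_zero push_one)
  (st (ser (enc r') ++ D) C A (rev r)) (5 * size r + 1) (st (ser (enc (r ++ r')) ++ D) C A [::]).
Proof.
elim/last_ind: r r' => [|r b IH] r'; first exact: ex0_loop0.
rewrite rev_rcons; apply: ex0_le;
 first apply: (@ex0_loop _ _ _ _ b _ _ (st (ser (enc (b :: r')) ++ D) C A (rev r))) => //.
- instantiate (1 := 4); case: b; first exact: (push_bitsE [:: true; true; false; false]).
  by apply: ex0_le; first exact: (push_bitsE [:: true; false]).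
- rewrite cat_rcons; exact: IH.
- rewrite size_rcons; lia.
Qed.

Lemma read_bits2 r D C B : ex0 (read_bits 2) (st D C (rev r) B) (5 * size r + 2)
  (st (ser (enc r) ++ D) C [::] B).
Proof.
have := @read_bits_loop2 r [::] D C B; rewrite cats0 => h.
apply: ex0_le; first (apply: ex0_seq; first exact: ex0_push); first exact: h.
lia.
Qed.

Lemma read_bits3 r D C A : ex0 (read_bits 3) (st D C A (rev r)) (5 * size r + 2)
  (st (ser (enc r) ++ D) C A [::]).
Proof.
have := @read_bits_loop3 r [::] D C A; rewrite cats0 => h.
apply: ex0_le; first (apply: ex0_seq; first exact: ex0_push); first exact: h.
lia.
Qed.

Definition write_bits := Seq (While 0 (Case 0 Skip (Push 2 false)
  (Seq (Case 0 Skip Skip Skip) (Seq (Case 0 Skip Skip Skip) (Push 2 true))))) (restore 2).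

Lemma write_bitsE r : ex0 write_bits (st1 (ser (enc r))) (8 * size r + 2) (st1 r).
Proof.
have h A : ex0 (While 0 (Case 0 Skip (Push 2 false)
   (Seq (Case 0 Skip Skip Skip) (Seq (Case 0 Skip Skip Skip) (Push 2 true)))))
   (st (ser (enc r)) [::] A [::]) (5 * size r + 1) (st [::] [::] (rev r ++ A) [::]).
  elim: r A => [|b r IH] A; first exact: ex0_while0.
  rewrite rev_cons cat_rcons ser_cons.
  apply: ex0_le; first apply: (@ex0_while _ _ _ _ 4 (st (ser (enc r)) [::] (b :: A) [::])) => //.
  - case: b => /=.
      apply: (@ex0_case _ _ _ _ _ true) => //=.
      apply: (@ex0_seq _ _ _ 1 _ 2); first by apply: (@ex0_case _ _ _ _ _ false) => //=; exact: ex0_skip.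
      apply: (@ex0_seq _ _ _ 1 _ 1); first by apply: (@ex0_case _ _ _ _ _ false) => //=; exact: ex0_skip.
      exact: ex0_push.
    apply: (@ex0_le _ _ 2) => //; apply: (@ex0_case _ _ _ _ _ false) => //=; exact: ex0_push.
  - by rewrite /=; lia.
have {}h := h [::]; rewrite cats0 in h.
apply: ex0_le; first apply: ex0_seq; first exact: h.
  have := restore2 [::] (rev r) [::]; rewrite revK cats0; exact.
rewrite size_rev; lia.
Qed.

(** Tosses as many coins as the unary number on top of the data stack; they land reversed on stack
    3, from where [read_bits] turns them into a list. *)
Definition fill := While 0 (Seq (Case 0 Skip Skip Skip) (Coin 3)).

Lemma fillE r D B : exists2 n, n <= 3 * size r + 1 &
  exec fill (st (ser (enc (size r)) ++ D) [::] [::] B) r n (st D [::] [::] (rev r ++ B)).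
Proof.
elim: r B => [|b r IH] B.
  by exists 1 => //; exact: ex_while1.
have [n hn e] := IH (b :: B); exists (2 + n).+1; first by rewrite /=; lia.
rewrite rev_cons cat_rcons -[b :: r]/([:: b] ++ r) ser_succ; apply: ex_while e => //=.
apply: (@ex_seq _ _ _ [::] 1 (st (ser (enc (size r)) ++ D) [::] [::] B) [:: b] 1); last exact: ex_coin.
by apply: (@ex_case _ _ _ _ _ false) => //; exact: ex_skip.
Qed.

(** Builds the generator of the prover's circuits and the sampler extracted from a cheating prover.
    The number [m l] is computed first, then the coins are tossed, then the deterministic [F] runs,
    so every run reads exactly [m l] coins. *)
Theorem ppt_realized (m : nat -> nat) (F : nat * seq bool -> seq bool) :
  Cp true m -> Cp true F ->
  exists (M : PTM) (k : nat), is_PPT M k /\ forall l (g : seq bool -> algC),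
    avg (tb k l) (fun c => g (output M (ones l) c)) = avg (m l) (fun r => g (F (l, r))).
Proof.
move=> hm hF.
have hm' : Cp true (fun l => (m l, l)) by apply: Cp_pair => //; exact: Cp_id.
have hF' : Cp true (fun p : seq bool * nat => F (p.2, p.1)).
  by apply: (Cp_comp (f := fun p : seq bool * nat => (p.2, p.1)) hF);
     apply: Cp_pair; [apply/Cp_snd/Cp_id|apply/Cp_fst/Cp_id].
have [c1 [t1 [r1 /(_ isT) p1]]] := hm'; have [c2 [t2 [r2 /(_ isT) p2]]] := hF'.
pose c := Seq read_nat (Seq c1 (Seq (Case 0 Skip Skip fill) (Seq (read_bits 3)
   (Seq (Push 0 true) (Seq c2 write_bits))))).
have hsz : PB id (fun l : nat => sz l) by apply: (@PB_le _ _ _ (fun l => 2 * l + 1)) => [x|]; [rewrite sz_nat|pb].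
have [k1 hk1] := p1; have [k2 hk2] := p2; have hs := Cp_size hF'; have [k3 hk3] := hs.
have hms : PB id m.
  apply: PB_le (PB_comp (Cp_size hm) hsz) => l; rewrite sz_nat; lia.
pose u l := (2 * l + 1) + (4 * m l + 1) + 1.
have hu (r : seq bool) l : size r = m l -> sz (r, l) <= u l.
  by move=> hr; rewrite sz_pair sz_nat /u -hr; have := sz_bits r; lia.
pose N l := (6 * l + 3) + (tb k1 (2 * l + 1) + ((3 * m l + 1).+1 + ((5 * m l + 2) + (1 + (tb k2 (u l) +
   (8 * tb k3 (u l) + 2)))))).
have pu : PB id u by rewrite /u; pb.
have pN : PB id N by rewrite /N; pb.
pose s l := [:: nseq l true; [::]; [::]; [::]].
have hT : PB id (fun l => run_bound 4 (total (s l)) (N l)).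
  have e l : total (s l) = l by rewrite /total /= size_nseq !addn0.
  apply: (@PB_le _ _ _ (fun l => run_bound 4 l (N l))) => [l|]; first by rewrite e.
  rewrite /run_bound; pb.
have [k hk] := hT; exists (cmd_ptm c 3 3), k.
have H l : halts_within (cmd_ptm c 3 3) (tb k l) (ones l) /\ forall g : seq bool -> algC,
   avg (tb k l) (fun c' => g (output (cmd_ptm c 3 3) (ones l) c'))
    = avg (m l) (fun r => g (nth [::] (st1 (F (l, r))) 0)).
  apply: cmd_realized (hk l) => //.
    rewrite /flat /=; congr (_ :: _ ++ _).
    by elim: (l) => //= n ->.
  move=> r hr.
  have [n1 q1 e1] := read_natE l [::].
  have [n2 q2 e2] := r1 l [::]; rewrite ser_pair !cats0 in e2.
  have [n3 q3 e3] := fillE r (ser (enc l)) [::]; rewrite cats0 hr in e3.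
  have [n4 q4 e4] := read_bits3 r (ser (enc l)) [::] [::].
  have [n5 q5 e5] := r2 (r, l) [::]; rewrite ser_pair !cats0 /= in e5.
  have [n6 q6 e6] := write_bitsE (F (l, r)).
  have e3' : exec (Case 0 Skip Skip fill) (st1 (true :: ser (enc (m l)) ++ ser (enc l))) r n3.+1
     (st (ser (enc l)) [::] [::] (rev r)).
    exact: (@ex_case 0 Skip Skip fill (st1 (true :: ser (enc (m l)) ++ ser (enc l))) true (ser (enc (m l)) ++ ser (enc l)) r n3 _ isT erefl e3).
  have ep : exec (Push 0 true) (st1 (ser (enc r) ++ ser (enc l))) [::] 1
     (st1 (true :: ser (enc r) ++ ser (enc l))) by exact: ex_push.
  have := ex_seq e1 (ex_seq e2 (ex_seq e3' (ex_seq e4 (ex_seq ep (ex_seq e5 e6))))).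
  rewrite /= cats0 => e; eexists; last exact: e.
  have h2 : n2 <= tb k1 (2 * l + 1) by rewrite -sz_nat; exact: leq_trans (hk1 l).
  have h5 : n5 <= tb k2 (u l).
    by apply: leq_trans q5 (leq_trans (hk2 _) _); apply: tb_mono; exact: hu.
  have h6 : size (F (l, r)) <= tb k3 (u l).
    apply: leq_trans (ltnW (size_sz _)) _; apply: leq_trans (hk3 (r, l)) _.
    by apply: tb_mono; exact: hu.
  rewrite /N; lia.
split=> [l|l g]; [exact: (H l).1|exact: (H l).2].
Qed.

Theorem verifier_realized (G : nat * seq bool -> bool) : Cp false G ->
  exists V tV, is_verifier V tV /\ forall l tau, vacc V tV l tau = ((G (l, tau))%:R)%R.
Proof.
move=> hG.
have hG' : Cp false (fun p : seq bool * nat => [:: G (p.2, p.1)]).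
  apply: Cp_cons; last exact: Cp_const.
  by apply: (Cp_comp (f := fun p : seq bool * nat => (p.2, p.1)) hG);
     apply: Cp_pair; [apply/Cp_snd/Cp_id|apply/Cp_fst/Cp_id].
have [c2 [t2 [r2 _]]] := hG'.
pose c := Seq read_nat (Seq (Loop 1 (Push 2 false) (Push 2 true)) (Seq (read_bits 2)
   (Seq (Push 0 true) (Seq c2 write_bits)))).
pose s l tau := [:: nseq l true; tau; [::]; [::]] : seq (seq bool).
pose N l (tau : seq bool) := (6 * l + 3) + ((2 * size tau + 1) + ((5 * size tau + 2) + (1 + (t2 (tau, l) + (8 * 1 + 2))))).
pose tV l tau := run_bound 4 (total (s l tau)) (N l tau).
have H l tau : halts_within (cmd_ptm c 3 2) (tV l tau) (vinput l tau) /\ forall g : seq bool -> algC,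
   avg (tV l tau) (fun c' => g (output (cmd_ptm c 3 2) (vinput l tau) c'))
    = avg 0 (fun r => g (nth [::] (st1 [:: G (l, tau)]) 0)).
  (* The [Hash] inside the verifier's input separates two stacks, the unary parameter and [tau], so
     only two empty stacks are appended. No coins are read. *)
  apply: (@cmd_realized _ _ _ _ (s l tau) 0 (N l tau) (fun=> st1 [:: G (l, tau)])) => //.
    rewrite /flat /= /vinput -catA /=; congr (_ :: _ ++ _).
    by elim: (l) => //= n ->.
  move=> r /size0nil ->.
  have [n1 q1 e1] := read_natE l tau.
  have [n2 q2 e2] : ex0 (Loop 1 (Push 2 false) (Push 2 true)) (st (ser (enc l)) tau [::] [::])
     (2 * size tau + 1) (st (ser (enc l)) [::] (rev tau) [::]).
    have h A : ex0 (Loop 1 (Push 2 false) (Push 2 true)) (st (ser (enc l)) tau A [::])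
     (2 * size tau + 1) (st (ser (enc l)) [::] (rev tau ++ A) [::]).
      elim: (tau) A => [|b tau' IH] A; first exact: ex0_loop0.
      rewrite rev_cons cat_rcons; apply: ex0_le;
        first apply: (@ex0_loop _ _ _ _ b _ _ (st (ser (enc l)) tau' (b :: A) [::])) => //.
      - by case: (b); exact: ex0_push.
      - by rewrite /=; lia.
    by have := h [::]; rewrite cats0.
  have [n4 q4 e4] := read_bits2 tau (ser (enc l)) [::] [::].
  have [n5 q5 e5] := r2 (tau, l) [::]; rewrite ser_pair !cats0 [X in enc X]/= in e5.
  have [n6 q6 e6] := write_bitsE [:: G (l, tau)].
  have ep : exec (Push 0 true) (st1 (ser (enc tau) ++ ser (enc l))) [::] 1
     (st1 (true :: ser (enc tau) ++ ser (enc l))) by exact: ex_push.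
  have := ex_seq e1 (ex_seq e2 (ex_seq e4 (ex_seq ep (ex_seq e5 e6)))).
  move=> e; eexists; last exact: e.
  rewrite /N; move: q6; rewrite [size _]/=; lia.
exists (cmd_ptm c 3 2), tV; split=> [l tau|l tau]; first exact: (H l tau).1.
by rewrite /vacc accprob_avg ((H l tau).2 (fun o => (head false o)%:R)%R).
Qed.

(** * A library of computable functions *)

Ltac cp1 := first [ assumption | exact Cp_id | apply Cp_const | apply Cp_fst | apply Cp_snd
  | apply Cp_pair | apply Cp_cons | apply Cp_succ | apply Cp_nilp | apply Cp_behead
  | apply Cp_head | apply Cp_if ].

Section Lib1.
Context {X A : Type} {eX : Enc X} {eA : Enc A} {pl : bool}.
Implicit Types (f g : X -> nat) (b c : X -> bool) (l : X -> seq A).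

Lemma Cp_units f : Cp pl f -> Cp pl (fun x => nseq (f x) tt).
Proof. by apply: (Cp_comp (g := fun n => nseq n tt)); apply: Cp_cast => n; exact: enc_nseq. Qed.

Lemma Cp_iter B {eB : Enc B} f (s0 : X -> B) (h : X * B -> B) :
  Cp pl f -> Cp pl s0 -> Cp pl h ->
  (pl -> exists2 M, PB (@sz X _) M &
    forall x i, i <= f x -> sz (iter i (fun s => h (x, s)) (s0 x)) <= M x) ->
  Cp pl (fun x => iter (f x) (fun s => h (x, s)) (s0 x)).
Proof.
pose kk (p : X * (unit * B)) := h (p.1, p.2.2).
move=> hf hs hh hM.
have e n x s : foldl (fun s a => kk (x, (a, s))) s (nseq n tt) =
   iter n (fun s => h (x, s)) s by elim: n s => //= n IH s; rewrite IH -iterSr.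
apply: (@Cp_ext _ _ _ _ _ (fun x => foldl (fun s a => kk (x, (a, s))) (s0 x) (nseq (f x) tt))).
  by move=> x; rewrite e.
apply: (Cp_foldl (h := kk)) => //; first exact: Cp_units.
  by apply: (Cp_comp (f := fun p : X * (unit * B) => (p.1, p.2.2)) hh); do !cp1.
move=> epl; have [M pM H] := hM epl; exists M => // x i.
have [hi|hi] := leqP i (f x); first by rewrite take_nseq // e; exact: H.
by rewrite take_oversize ?size_nseq ?(ltnW hi) // e; exact: H.
Qed.

Lemma Cp_iter_add B {eB : Enc B} f (s0 : X -> B) (h : X * B -> B) (b : X -> nat) :
  Cp pl f -> Cp pl s0 -> Cp pl h -> PB (@sz X _) b ->
  (forall x s, sz (h (x, s)) <= sz s + b x) ->
  Cp pl (fun x => iter (f x) (fun s => h (x, s)) (s0 x)).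
Proof.
move=> hf hs hh hb H; apply: Cp_iter => // epl.
have h1 : PB (@sz X _) (fun x => sz (f x)) by apply: Cp_size; rewrite -epl.
have h2 : PB (@sz X _) (fun x => sz (s0 x)) by apply: Cp_size; rewrite -epl.
exists (fun x => sz (s0 x) + sz (f x) * b x); first by pb.
move=> x i hi; apply: (@leq_trans (sz (s0 x) + i * b x)).
  elim: i {hi} => [|i IH] /=; first by rewrite addn0.
  by have := H x (iter i (fun s => h (x, s)) (s0 x)); rewrite mulSn; lia.
rewrite leq_add2l leq_mul2r sz_nat; apply/orP; right; lia.
Qed.

Lemma Cp_not b : Cp pl b -> Cp pl (fun x => ~~ b x).
Proof.
move=> h; apply: (@Cp_ext _ _ _ _ _ (fun x => if b x then false else true)); last by do !cp1.
by move=> x; case: (b x).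
Qed.

Lemma Cp_and b c : Cp pl b -> Cp pl c -> Cp pl (fun x => b x && c x).
Proof.
move=> h h'; apply: (@Cp_ext _ _ _ _ _ (fun x => if b x then c x else false)); last by do !cp1.
by move=> x; case: (b x).
Qed.

Lemma Cp_or b c : Cp pl b -> Cp pl c -> Cp pl (fun x => b x || c x).
Proof.
move=> h h'; apply: (@Cp_ext _ _ _ _ _ (fun x => if b x then true else c x)); last by do !cp1.
by move=> x; case: (b x).
Qed.

Lemma Cp_eqb b c : Cp pl b -> Cp pl c -> Cp pl (fun x => b x == c x).
Proof.
move=> h h'; apply: (@Cp_ext _ _ _ _ _ (fun x => if b x then c x else if c x then false else true)); last by do !cp1.
by move=> x; case: (b x); case: (c x).
Qed.

Lemma Cp_pred f : Cp pl f -> Cp pl (fun x => (f x).-1).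
Proof.
move=> h; have h2 : Cp pl (fun l : seq unit => size l).
  apply: Cp_cast => l; rewrite -enc_nseq; congr enc.
  by elim: l => //= -[] l ->.
apply: (@Cp_ext _ _ _ _ _ (fun x => size (behead (nseq (f x) tt)))).
  by move=> x; rewrite size_behead size_nseq.
apply: (Cp_comp (f := fun x => behead (nseq (f x) tt)) h2); apply: Cp_behead; exact: Cp_units.
Qed.

Lemma Cp_eq0 f : Cp pl f -> Cp pl (fun x => f x == 0).
Proof.
move=> h; apply: (@Cp_ext _ _ _ _ _ (fun x => nilp (nseq (f x) tt))).
  by move=> x; rewrite /nilp size_nseq.
apply: Cp_nilp; exact: Cp_units.
Qed.

Lemma Cp_add f g : Cp pl f -> Cp pl g -> Cp pl (fun x => f x + g x).
Proof.
pose kk (p : X * nat) := p.2.+1.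
move=> h h'; apply: (@Cp_ext _ _ _ _ _ (fun x => iter (g x) (fun s => kk (x, s)) (f x))).
  by move=> x /=; elim: (g x) => [|n /= ->]; rewrite ?addn0 ?addnS.
apply: (Cp_iter_add (h := kk) (b := fun=> 2)) => //; first by do !cp1.
  exact: PB_const.
by move=> x s; rewrite /kk !sz_nat /=; lia.
Qed.

Lemma Cp_sub f g : Cp pl f -> Cp pl g -> Cp pl (fun x => f x - g x).
Proof.
pose kk (p : X * nat) := p.2.-1.
move=> h h'; apply: (@Cp_ext _ _ _ _ _ (fun x => iter (g x) (fun s => kk (x, s)) (f x))).
  by move=> x /=; elim: (g x) => [|n /= ->]; rewrite ?subn0 ?subnS.
apply: (Cp_iter_add (h := kk) (b := fun=> 0)) => //; last first.
- by move=> x s; rewrite /kk !sz_nat /=; lia.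
- exact: PB_const.
have h2 : Cp pl (fun l : seq unit => size l).
  apply: Cp_cast => l; rewrite -enc_nseq; congr enc.
  by elim: l => //= -[] l ->.
have h3 : Cp pl (fun n => nseq n tt) by apply: Cp_cast => n; exact: enc_nseq.
apply: (@Cp_ext _ _ _ _ _ (fun p : X * nat => size (behead (nseq p.2 tt)))).
  by move=> p; rewrite size_behead size_nseq.
apply: (Cp_comp h2 (f := fun p : X * nat => behead (nseq p.2 tt))); apply: Cp_behead.
by apply: (Cp_comp h3 (f := snd)); do !cp1.
Qed.

Lemma Cp_leq f g : Cp pl f -> Cp pl g -> Cp pl (fun x => f x <= g x).
Proof. by move=> h h'; apply: Cp_eq0; apply: Cp_sub. Qed.

Lemma Cp_eqn f g : Cp pl f -> Cp pl g -> Cp pl (fun x => f x == g x).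
Proof.
move=> h h'; apply: (@Cp_ext _ _ _ _ _ (fun x => (f x <= g x) && (g x <= f x))).
  by move=> x; rewrite eqn_leq.
by apply: Cp_and; apply: Cp_leq.
Qed.

Lemma Cp_minn f g : Cp pl f -> Cp pl g -> Cp pl (fun x => minn (f x) (g x)).
Proof.
move=> h h'; apply: (@Cp_ext _ _ _ _ _ (fun x => if (f x).+1 <= g x then f x else g x)) => //.
by apply: Cp_if => //; apply: Cp_leq => //; apply: Cp_succ.
Qed.
End Lib1.

Section Lib2.
Context {X A B : Type} {eX : Enc X} {eA : Enc A} {eB : Enc B} {pl : bool}.
Implicit Types (f g : X -> nat) (b c : X -> bool) (l : X -> seq A).

Lemma Cp_mul f g : Cp pl f -> Cp pl g -> Cp pl (fun x => f x * g x).
Proof.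
pose kk (p : (nat * nat) * nat) := p.2 + p.1.1.
move=> h h'.
have hc : Cp pl (fun x => (f x, g x)) by apply: Cp_pair.
apply: (Cp_comp (f := fun x => (f x, g x)) (g := fun q : nat * nat => q.1 * q.2) _ hc).
apply: (@Cp_ext _ _ _ _ _ (fun q : nat * nat => iter q.2 (fun s => kk (q, s)) 0)).
  by case=> m n /=; elim: n => [|n /= ->]; rewrite ?muln0 ?mulnS // addnC.
apply: (Cp_iter_add (h := kk) (b := fun q : nat * nat => sz q)); do ?cp1.
- by apply: Cp_add; do !cp1.
- exact: PB_id.
- by case=> m n s; rewrite /kk sz_pair !sz_nat /=; lia.
Qed.

Lemma Cp_exp f k : Cp pl f -> Cp pl (fun x => f x ^ k).
Proof.
move=> h; elim: k => [|k IH]; first exact: Cp_const.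
apply: (@Cp_ext _ _ _ _ _ (fun x => f x * f x ^ k)); first by move=> x; rewrite expnS.
exact: Cp_mul.
Qed.

Lemma Cp_tb f k : Cp pl f -> Cp pl (fun x => tb k (f x)).
Proof.
move=> h; apply: Cp_add; last exact: Cp_const.
by apply: Cp_mul; [exact: Cp_const|exact: Cp_exp].
Qed.

Lemma Cp_rev l : Cp pl l -> Cp pl (fun x => rev (l x)).
Proof.
pose kk (p : X * (A * seq A)) := p.2.1 :: p.2.2.
move=> h; apply: (@Cp_ext _ _ _ _ _ (fun x => foldl (fun s a => kk (x, (a, s))) [::] (l x))).
  move=> x /=; rewrite -[RHS]cats0; elim: (l x) [::] => //= a l' IH s.
  by rewrite IH rev_cons cat_rcons.
apply: (Cp_foldl (h := kk)) => //; do ?cp1.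
move=> epl; have hs : PB (@sz X _) (fun x => sz (l x)) by apply: Cp_size; rewrite -epl.
exists (fun x => 2 * sz (l x)); first by pb.
move=> x i; have ht : sz (take i (l x)) <= sz (l x) by exact: sz_take _ _.
have : sz (foldl (fun s a => kk (x, (a, s))) [::] (take i (l x))) + 1 = sz (take i (l x)) + sz (@nil A).
  by elim: (take i (l x)) [::] => [|a l' IH] s /=; rewrite ?IH /kk /= ?sz_cons ?sz_nil; lia.
have hp : 0 < sz (l x) by exact: sz_gt0 _.
by rewrite sz_nil; lia.
Qed.

Lemma Cp_drop l f : Cp pl l -> Cp pl f -> Cp pl (fun x => drop (f x) (l x)).
Proof.
pose kk (p : X * seq A) := behead p.2.
move=> h h'; apply: (@Cp_ext _ _ _ _ _ (fun x => iter (f x) (fun s => kk (x, s)) (l x))).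
  move=> x /=; elim: (f x) (l x) => [|n IH] s; first by rewrite drop0.
  by rewrite /= IH /kk /= -drop1 drop_drop add1n.
apply: (Cp_iter_add (h := kk) (b := fun=> 0)) => //; do ?cp1.
  exact: PB_const.
by move=> x [|a s] //=; rewrite /kk /= sz_cons; lia.
Qed.

Lemma Cp_nth a0 l f : Cp pl l -> Cp pl f -> Cp pl (fun x => nth a0 (l x) (f x)).
Proof.
move=> h h'; apply: (@Cp_ext _ _ _ _ _ (fun x => head a0 (drop (f x) (l x)))).
  by move=> x; rewrite -nth0 nth_drop addn0.
by apply: Cp_head; exact: Cp_drop.
Qed.

Lemma Cp_size_seq l : Cp pl l -> Cp pl (fun x => size (l x)).
Proof.
pose kk (p : X * (A * nat)) := p.2.2.+1.
move=> h; apply: (@Cp_ext _ _ _ _ _ (fun x => foldl (fun s a => kk (x, (a, s))) 0 (l x))).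
  move=> x /=; rewrite -[RHS]addn0; elim: (l x) 0 => //= a l' IH s.
  by rewrite IH addSnnS.
apply: (Cp_foldl_add (h := kk) (b := fun=> 2)) => //; do ?cp1.
  exact: PB_const.
by move=> x a s _; rewrite /kk !sz_nat /=; lia.
Qed.

Lemma Cp_nseq f (a : X -> A) : Cp pl f -> Cp pl a -> Cp pl (fun x => nseq (f x) (a x)).
Proof.
pose kk (p : (nat * A) * seq A) := p.1.2 :: p.2.
move=> h h'; have hc : Cp pl (fun x => (f x, a x)) by apply: Cp_pair.
apply: (Cp_comp (f := fun x => (f x, a x)) (g := fun q : nat * A => nseq q.1 q.2) _ hc).
apply: (@Cp_ext _ _ _ _ _ (fun q : nat * A => iter q.1 (fun s => kk (q, s)) [::])).
  by case=> n b /=; elim: n => //= n ->.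
apply: (Cp_iter_add (h := kk) (b := fun q : nat * A => sz q)); do ?cp1.
  exact: PB_id.
by case=> n b s; rewrite /kk sz_pair sz_cons /=; lia.
Qed.

End Lib2.

Section Lib3.
Context {X A B : Type} {eX : Enc X} {eA : Enc A} {eB : Enc B} {pl : bool}.
Implicit Types (f g : X -> nat) (b c : X -> bool) (l : X -> seq A).

Lemma Cp_take l f : Cp pl l -> Cp pl f -> Cp pl (fun x => take (f x) (l x)).
Proof.
move=> h h'; have hc : Cp pl (fun x => (f x, l x)) by apply: Cp_pair.
apply: (Cp_comp (f := fun x => (f x, l x)) (g := fun q : nat * seq A => take q.1 q.2) _ hc).
pose hh (p : (nat * seq A) * (A * (nat * seq A))) :=
  if p.2.2.1 == 0 then p.2.2 else (p.2.2.1.-1, p.2.1 :: p.2.2.2).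
apply: (@Cp_ext _ _ _ _ _ (fun q : nat * seq A => rev (foldl (fun s a => hh (q, (a, s))) (q.1, [::]) q.2).2)).
  move=> [n s] /=.
  have -> (s' : seq A) : (foldl (fun s a => hh ((n, s'), (a, s))) (n, [::]) s).2 = rev (take n s).
    rewrite -[RHS]cats0; elim: s n [::] => [|a s IH] [|n] t //=.
      by rewrite /hh /= IH take0.
    by rewrite {2}/hh /= rev_cons cat_rcons -IH.
  by rewrite revK.
apply: Cp_rev; apply: Cp_snd.
apply: (Cp_foldl_add (h := hh) (b := fun q : nat * seq A => sz q)).
- by do !cp1.
- by do !cp1.
- rewrite /hh; apply: Cp_if; [apply: Cp_eq0; by do !cp1|by do !cp1|].
  by apply: Cp_pair; [apply: Cp_pred|]; do !cp1.
- exact: PB_id.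
case=> n s a [i t]; rewrite /hh /=; case: ifP => _; first by lia.
by rewrite !sz_pair sz_cons !sz_nat; lia.
Qed.
Lemma sz_cat (s t : seq A) : sz (s ++ t) + 1 = sz s + sz t.
Proof. by elim: s => [|a s IH] /=; rewrite ?sz_cons; [rewrite /sz /=; lia|lia]. Qed.

Lemma Cp_cat l (l' : X -> seq A) : Cp pl l -> Cp pl l' -> Cp pl (fun x => l x ++ l' x).
Proof.
pose kk (p : X * (A * seq A)) := p.2.1 :: p.2.2.
move=> h h'; apply: (@Cp_ext _ _ _ _ _ (fun x => foldl (fun s a => kk (x, (a, s))) (l' x) (rev (l x)))).
  move=> x /=; elim/last_ind: (l x) (l' x) => [|s a IH] t //.
  by rewrite rev_rcons /= IH cat_rcons.
have hr : Cp pl (fun x => rev (l x)) by exact: Cp_rev.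
apply: (Cp_foldl (h := kk)) => //; do ?cp1.
move=> epl; have hs : PB (@sz X _) (fun x => sz (rev (l x))) by apply: Cp_size; rewrite -epl.
have hs' : PB (@sz X _) (fun x => sz (l' x)) by apply: Cp_size; rewrite -epl.
exists (fun x => sz (rev (l x)) + sz (l' x)); first by pb.
move=> x i; apply: (@leq_trans (sz (take i (rev (l x))) + sz (l' x))).
  elim: (take i _) (l' x) => [|a s IH] t /=; first exact: leq_addl.
  apply: leq_trans (IH _) _; rewrite /kk /= !sz_cons; lia.
by rewrite leq_add2r sz_take.
Qed.

Lemma Cp_map l (h : X * A -> B) : Cp pl l -> Cp pl h -> Cp pl (fun x => [seq h (x, a) | a <- l x]).
Proof.
pose kk (p : X * (A * seq B)) := h (p.1, p.2.1) :: p.2.2.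
move=> hl hh.
have e x s t : foldl (fun s a => kk (x, (a, s))) t s
   = rev [seq h (x, a) | a <- s] ++ t.
  by elim: s t => //= a s IH t; rewrite IH rev_cons cat_rcons.
apply: (@Cp_ext _ _ _ _ _ (fun x => rev (foldl (fun s a => kk (x, (a, s))) [::] (l x)))).
  by move=> x; rewrite e cats0 revK.
apply: Cp_rev; apply: (Cp_foldl (h := kk)) => //; do ?cp1.
  by apply: (Cp_comp (f := fun p : X * (A * seq B) => (p.1, p.2.1)) hh); do !cp1.
move=> epl; have hs : PB (@sz X _) (fun x => sz (l x)) by apply: Cp_size; rewrite -epl.
have [k hk] : PB (@sz (X * A) _) (fun p => sz (h p)) by apply: Cp_size; rewrite -epl.
exists (fun x => 1 + sz (l x) * (tb k (sz x + sz (l x) + 1)).+1); first by pb.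
move=> x i; rewrite e cats0.
apply: (@leq_trans (1 + size (take i (l x)) * (tb k (sz x + sz (l x) + 1)).+1)).
  have : forall a, a \in map (@sz A _) (take i (l x)) -> a <= sz (l x).
    move=> _ /(nthP 0) [j hj <-]; rewrite size_map in hj.
    case E: (l x) hj => [|a0 l0] //; rewrite -E => hj.
    rewrite (nth_map a0) //; apply: leq_trans (sz_nth a0 hj) _; exact: sz_take.
  elim/last_ind: (take i (l x)) => [|s a IH] ha //.
  rewrite map_rcons rev_rcons sz_cons size_rcons mulSn.
  have : sz (h (x, a)) <= tb k (sz x + sz (l x) + 1).
    apply: leq_trans (hk _) _; apply: tb_mono; rewrite sz_pair addn1 ltnS leq_add2l.
    by apply: ha; rewrite map_rcons mem_rcons inE eqxx.
  have ha' (y : nat) : y \in [seq sz i | i <- s] -> y <= sz (l x).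
    by move=> hy; apply: ha; rewrite map_rcons mem_rcons inE hy orbT.
  have {}IH := IH ha'; lia.
rewrite leq_add2l leq_mul2r; apply/orP; right.
by apply: leq_trans (ltnW (size_sz _)) (sz_take _ _).
Qed.
End Lib3.

Section Lib4.
Context {X A B : Type} {eX : Enc X} {eA : Enc A} {eB : Enc B} {pl : bool}.
Implicit Types (f g : X -> nat) (b c : X -> bool) (l : X -> seq A).

Lemma Cp_flatten (l : X -> seq (seq A)) : Cp pl l -> Cp pl (fun x => flatten (l x)).
Proof.
pose kk (p : seq (seq A) * (seq A * seq A)) := p.2.2 ++ p.2.1.
move=> h; apply: (Cp_comp (f := l) (g := @flatten A)) => //.
apply: (@Cp_ext _ _ _ _ _ (fun x => foldl (fun s a => kk (x, (a, s))) [::] x)).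
  move=> x /=; rewrite -[RHS]cat0s; elim: x [::] => [|a x IH] s /=; first by rewrite cats0.
  by rewrite IH catA.
apply: (Cp_foldl_add (h := kk) (b := fun x => sz x)); do ?cp1.
- by apply: Cp_cat; do !cp1.
- exact: PB_id.
by move=> x a s ha; rewrite /kk /=; have hc : sz (s ++ a) + 1 = sz s + sz a by [exact: sz_cat]; lia.
Qed.

Lemma Cp_filter l (p : X * A -> bool) : Cp pl l -> Cp pl p ->
  Cp pl (fun x => [seq a <- l x | p (x, a)]).
Proof.
move=> hl hp; apply: (@Cp_ext _ _ _ _ _ (fun x => flatten [seq (fun q : X * A => if p q then [:: q.2] else [::]) (x, a) | a <- l x])).
  by move=> x /=; elim: (l x) => //= a s ->; case: (p _).
by apply: Cp_flatten; apply: (Cp_map (h := fun q : X * A => if p q then [:: q.2] else [::])) => //; do !cp1.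
Qed.

Lemma Cp_iota f : Cp pl f -> Cp pl (fun x => iota 0 (f x)).
Proof.
pose kk (p : nat * (nat * seq nat)) := (p.2.1.+1, p.2.1 :: p.2.2).
move=> h; apply: (Cp_comp (f := f) (g := iota 0)) => //.
have e i : iter i (fun p : nat * seq nat => (p.1.+1, p.1 :: p.2)) (0, [::]) = (i, rev (iota 0 i)).
  elim: i => // i IH; rewrite iterS IH -[in RHS]addn1 iotaD rev_cat addn1; by [].
apply: (@Cp_ext _ _ _ _ _ (fun n : nat => rev (iter n (fun s => kk (n, s)) (0, [::])).2)).
  by move=> n /=; rewrite e revK.
apply: Cp_rev; apply: Cp_snd; apply: (Cp_iter (h := kk)); do ?cp1.
move=> _; exists (fun n : nat => sz n + sz n * sz n + sz n + 3); first by pb.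
move=> n i hi /=; rewrite e sz_pair sz_nat.
have : sz (rev (iota 0 i)) <= 1 + i * (2 * i + 2).
  elim: i {hi} => // i IH; rewrite -{1}addn1 iotaD rev_cat add0n sz_cons sz_nat.
  by move: IH; nia.
rewrite sz_nat; nia.
Qed.

Lemma Cp_eqseq (s t : X -> seq bool) : Cp pl s -> Cp pl t -> Cp pl (fun x => s x == t x).
Proof.
move=> hs ht.
pose h (p : X * (bool * (bool * seq bool))) :=
  (p.2.2.1 && ~~ nilp p.2.2.2 && (head false p.2.2.2 == p.2.1), behead p.2.2.2).
have hh : Cp pl h.
  apply: Cp_pair; last by do !cp1.
  apply: Cp_and; [apply: Cp_and; [by do !cp1|]|apply: Cp_eqb]; try by do !cp1.
pose fin x := foldl (fun s a => h (x, (a, s))) (true, t x) (s x).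
apply: (@Cp_ext _ _ _ _ _ (fun x => (fin x).1 && nilp (fin x).2)).
  move=> x; rewrite /fin -[RHS]andTb.
  elim: (s x) true (t x) => [|b s' IH] ok [|b' t'] //=.
  - by rewrite IH /= andbF.
  - by rewrite IH /= andbT -andbA eqseq_cons [b' == b]eq_sym.
have hf : Cp pl fin.
  apply: (Cp_foldl_add (b := fun=> 3)); do ?cp1.
    exact: PB_const.
  move=> x a [ok r] _; rewrite /h /= !sz_pair.
  have hb (b : bool) : sz b <= 3 by case: b.
  have h2 : 0 < sz ok by exact: sz_gt0.
  apply: (@leq_trans (3 + sz r + 1 )); last by lia.
  rewrite addn1 ltnS leq_add //; case: r => [|a' r] //=; rewrite sz_cons; lia.
by apply: Cp_and; do !cp1.
Qed.

Lemma Cp_sumn (f : X -> seq nat) : Cp pl f -> Cp pl (fun x => sumn (f x)).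
Proof.
pose kk (p : seq nat * (nat * nat)) := p.2.2 + p.2.1.
move=> h; apply: (Cp_comp (f := f) (g := sumn)) => //.
apply: (@Cp_ext _ _ _ _ _ (fun x => foldl (fun s a => kk (x, (a, s))) 0 x)).
  by move=> x /=; rewrite -[RHS]add0n; elim: x 0 => [|a x IH] s /=; rewrite ?addn0 // IH addnA.
apply: (Cp_foldl_add (h := kk) (b := fun x => sz x)); do ?cp1.
- by apply: Cp_add; do !cp1.
- exact: PB_id.
by move=> x a s ha; move: ha; rewrite /kk !sz_nat /=; lia.
Qed.
End Lib4.

(** Numbers are unary, so a power with variable exponent has exponential size and is only
    computable; this suffices for the unbounded verifier. *)
Lemma Cp_expn X {eX : Enc X} (f g : X -> nat) : Cp false f -> Cp false g -> Cp false (fun x => f x ^ g x).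
Proof.
pose kk (p : X * nat) := f p.1 * p.2.
move=> h h'; apply: (@Cp_ext _ _ _ _ _ (fun x => iter (g x) (fun s => kk (x, s)) 1)).
  by move=> x /=; elim: (g x) => //= n ->; rewrite expnS.
apply: (Cp_iter (h := kk)) => //; do ?cp1.
apply: Cp_mul; do ?cp1.
by apply: (Cp_comp h); do !cp1.
Qed.

Ltac cp_step := lazymatch goal with
  | |- Cp _ (fun x => x) => exact Cp_id
  | |- Cp _ (fun _ => ?c) => exact (Cp_const c)
  | |- Cp _ (fun x => fst (@?f x)) => apply (Cp_fst (f := f))
  | |- Cp _ (fun x => snd (@?f x)) => apply (Cp_snd (f := f))
  | |- Cp _ (fun x => (@?f x, @?g x)) => apply (Cp_pair (f := f) (g := g))
  | |- Cp _ (fun x => cons (@?f x) (@?g x)) => apply (Cp_cons (f := f) (g := g))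
  | |- Cp _ (fun x => nilp (@?f x)) => apply (Cp_nilp (f := f))
  | |- Cp _ (fun x => behead (@?f x)) => apply (Cp_behead (f := f))
  | |- Cp _ (fun x => head _ (@?f x)) => apply (Cp_head _ (f := f))
  | |- Cp _ (fun x => negb (@?f x)) => apply (Cp_not (b := f))
  | |- Cp _ (fun x => andb (@?f x) (@?g x)) => apply (Cp_and (b := f) (c := g))
  | |- Cp _ (fun x => orb (@?f x) (@?g x)) => apply (Cp_or (b := f) (c := g))
  | |- Cp _ (fun x => eq_op (@?f x) 0) => apply (Cp_eq0 (f := f))
  | |- Cp _ (fun x => eq_op (@?f x) (@?g x)) =>
      first [apply (Cp_eqn (f := f) (g := g)) | apply (Cp_eqb (b := f) (c := g))
        | apply (Cp_eqseq (s := f) (t := g))]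
  | |- Cp _ (fun x => leq (@?f x) (@?g x)) => apply (Cp_leq (f := f) (g := g))
  | |- Cp _ (fun x => S (@?f x)) => apply (Cp_succ (f := f))
  | |- Cp _ (fun x => Nat.pred (@?f x)) => apply (Cp_pred (f := f))
  | |- Cp _ (fun x => addn (@?f x) (@?g x)) => apply (Cp_add (f := f) (g := g))
  | |- Cp _ (fun x => subn (@?f x) (@?g x)) => apply (Cp_sub (f := f) (g := g))
  | |- Cp _ (fun x => muln (@?f x) (@?g x)) => apply (Cp_mul (f := f) (g := g))
  | |- Cp _ (fun x => minn (@?f x) (@?g x)) => apply (Cp_minn (f := f) (g := g))
  | |- Cp _ (fun x => tb ?k (@?f x)) => apply (Cp_tb (f := f) k)
  | |- Cp _ (fun x => expn (@?f x) ?k) => apply (Cp_exp (f := f) k)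
  | |- Cp _ (fun x => expn (@?f x) (@?g x)) => apply (Cp_expn (f := f) (g := g))
  | |- Cp _ (fun x => rev (@?f x)) => apply (Cp_rev (l := f))
  | |- Cp _ (fun x => drop (@?g x) (@?f x)) => apply (Cp_drop (l := f) (f := g))
  | |- Cp _ (fun x => take (@?g x) (@?f x)) => apply (Cp_take (l := f) (f := g))
  | |- Cp _ (fun x => nth _ (@?f x) (@?g x)) => apply (Cp_nth _ (l := f) (f := g))
  | |- Cp _ (fun x => size (@?f x)) => apply (Cp_size_seq (l := f))
  | |- Cp _ (fun x => nseq (@?f x) (@?g x)) => apply (Cp_nseq (f := f) (a := g))
  | |- Cp _ (fun x => cat (@?f x) (@?g x)) => apply (Cp_cat (l := f) (l' := g))
  | |- Cp _ (fun x => flatten (@?f x)) => apply (Cp_flatten (l := f))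
  | |- Cp _ (fun x => iota 0 (@?f x)) => apply (Cp_iota (f := f))
  | |- Cp _ (fun x => sumn (@?f x)) => apply (Cp_sumn (f := f))
  | |- Cp _ (fun x => map (@?h x) (@?l x)) =>
      apply (Cp_map (l := l) (h := fun p => h p.1 p.2)); cbv beta
  | |- Cp _ (fun x => filter (@?h x) (@?l x)) =>
      apply (Cp_filter (l := l) (p := fun p => h p.1 p.2)); cbv beta
  | H : Cp _ (fun p => ?g (fst p) (snd p)) |- Cp _ (fun x => ?g (@?a x) (@?b x)) =>
      apply (Cp_comp (f := fun x => (a x, b x)) H)
  | H : Cp _ (fun p => ?g (fst (fst p)) (snd (fst p)) (snd p))
      |- Cp _ (fun x => ?g (@?a x) (@?b x) (@?c x)) =>
      apply (Cp_comp (f := fun x => (a x, b x, c x)) H)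
  | H : Cp _ ?g |- Cp _ (fun x => ?g (@?f x)) => apply (Cp_comp (f := f) H)
  end.
Ltac cp_eta := lazymatch goal with
  | |- Cp _ (fun _ => _) => fail
  | |- @Cp ?p ?A ?B ?eA ?eB ?f => change (@Cp p A B eA eB (fun x => f x))
  end.
Ltac cp := repeat first [assumption | cp_step | apply Cp_if | cp_eta].

(** * A universal machine *)

Definition symn (s : sym) : nat := match s with Blank => 0 | Zero => 1 | One => 2 | Hash => 3 end.
Definition nsym (n : nat) : sym := match n with 0 => Blank | 1 => Zero | 2 => One | _ => Hash end.

(* A machine is coded by its halting state followed by three entries (next state, symbol,
   move) for each state, symbol and coin; tapes are zippers. *)
Definition entry (M : PTM) (j : nat) : seq nat :=
  let: (q, a, mv) := trans (inord (j %/ 8) : 'I_(nst M).+2) (nsym (j %% 8 %/ 2)) (odd j) in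
  [:: q : nat; symn a; mv : nat].

Definition table (M : PTM) : seq nat :=
  (nst M).+1 :: flatten (mkseq (entry M) (8 * (nst M).+2)).

Definition ustate := (nat * (seq nat * seq nat))%type.

Definition ustep (T : seq nat) (b : bool) (z : ustate) : ustate :=
  if z.1 == nth 0 T 0 then z else
  let i := (3 * (8 * z.1 + 2 * head 0 z.2.2 + (if b then 1 else 0))).+1 in
  (nth 0 T i,
   if nth 0 T i.+2 == 0 then
     if nilp z.2.1 then ([::], nth 0 T i.+1 :: behead z.2.2)
     else (behead z.2.1, head 0 z.2.1 :: nth 0 T i.+1 :: behead z.2.2)
   else (nth 0 T i.+1 :: z.2.1, behead z.2.2)).

Definition ubits_step (a : nat) (p : bool * seq bool) : bool * seq bool :=
  if p.1 then p else if a == 1 then (false, false :: p.2)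
  else if a == 2 then (false, true :: p.2) else (true, p.2).

Definition ubits (t : seq nat) : seq bool :=
  rev (foldl (fun s a => ubits_step a s) (false, [::]) t).2.

Definition universal (T : seq nat) (l : nat) (c : seq bool) : seq bool :=
  let z := foldl (fun z b => ustep T b z) (0, ([::], nseq l 2)) c in
  ubits (rev z.2.1 ++ z.2.2).

Lemma ubitsE t : ubits (map symn t) = bits_prefix t.
Proof.
have H u o : foldl (fun s a => ubits_step a s) (true, o) u = (true, o) by elim: u.
rewrite /ubits; suff -> o : (foldl (fun s a => ubits_step a s) (false, o) (map symn t)).2 = rev (bits_prefix t) ++ o.
  by rewrite cats0 revK.
elim: t o => //= -[] t IH o; rewrite /ubits_step /= ?H //= IH rev_cons cat_rcons //.
Qed.

Lemma bits_prefix_iota t n : size t <= n ->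
  bits_prefix (map (nth Blank t) (iota 0 n)) = bits_prefix t.
Proof.
elim: t n => [|a t IH] [|n] //= h; rewrite (iotaDl 1) -map_comp.
by case: a => //=; rewrite -(IH n h).
Qed.

Lemma nth_blocks T (x0 : T) k (ss : seq (seq T)) i j : all (fun s => size s == k) ss -> j < k -> i < size ss ->
  nth x0 (flatten ss) (k * i + j) = nth x0 (nth [::] ss i) j.
Proof.
elim: ss i => // s ss IH [|i] /= /andP[/eqP hs h] hj hi.
  by rewrite muln0 nth_cat hs hj.
rewrite nth_cat hs mulnS -addnA ltnNge leq_addr /= addKn; exact: IH.
Qed.

Lemma nth_table M J q s (b : bool) d : q < (nst M).+2 -> d < 3 ->
  nth 0 (table M ++ J) ((3 * (8 * q + 2 * symn s + b)).+1 + d) =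
  nth 0 (entry M (8 * q + 2 * symn s + b)) d.
Proof.
move=> hq hd; set j := 8 * q + 2 * symn s + b.
have hj : j < 8 * (nst M).+2 by rewrite /j; case: s b {j} => -[] /=; lia.
have hall : all (fun s => size s == 3) (mkseq (entry M) (8 * (nst M).+2)).
  by apply/allP => _ /mapP [i _ ->]; rewrite /entry; case: trans => [[? ?] ?].
have hsz : size (flatten (mkseq (entry M) (8 * (nst M).+2))) = 3 * (8 * (nst M).+2).
  rewrite size_flatten /shape; elim: (mkseq _ _) (size_mkseq (entry M) (8 * (nst M).+2)) hall => [|x ss IH] /=.
    by move=> <-.
  by case: (8 * _) IH => //= n IH [h] /andP[/eqP -> h2]; rewrite (_ : sumn _ = 3 * n) ?mulnS //;
     elim: ss n h h2 {IH} => [|y ss IH] [|n] //= [h] /andP[/eqP -> h2]; rewrite (IH n) // mulnS.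
have hb : nth 0 (flatten (mkseq (entry M) (8 * (nst M).+2))) (3 * j + d) = nth 0 (entry M j) d.
  by rewrite nth_blocks ?size_mkseq // nth_mkseq.
rewrite /table; move: hsz hb; set F := flatten _ => hsz hb.
rewrite addSn cat_cons -[nth 0 (_ :: _) _.+1]/(nth 0 (F ++ J) (3 * j + d)) nth_cat hsz.
case: ifP => [_|/negbT]; [exact: hb|lia].
Qed.

Section Simulation.
Variables (M : PTM) (J : seq nat).

Definition simulates (cf : config M) (z : ustate) := exists L R : seq sym,
  [/\ z = (cstate cf : nat, (map symn L, map symn R)),
      ctape cf = (fun i => nth Blank (rev L ++ R) i) & chead cf = size L].

Lemma entryE (q : 'I_(nst M).+2) s (b : bool) : entry M (8 * q + 2 * symn s + b) =
  let: (q', a, mv) := trans q s b in [:: q' : nat; symn a; mv : nat].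
Proof.
have h8 : (2 * symn s + b < 8)%N by case: s b => -[].
have -> : 8 * q + 2 * symn s + b = q * 8 + (2 * symn s + b) by lia.
rewrite /entry divnMDl // divn_small // addn0 inord_val modnMDl modn_small //.
have -> : nsym ((2 * symn s + b) %/ 2) = s by case: s b {h8} => -[].
have -> : odd (q * 8 + (2 * symn s + b)) = b by rewrite oddD oddM andbF addFb oddD mul2n odd_double; case: (b).
by [].
Qed.

Lemma ustep_simulates cf z b : simulates cf z -> simulates (step cf b) (ustep (table M ++ J) b z).
Proof.
case: cf => q tp hd [L [R []]]; rewrite [ctape _]/= [chead _]/= [cstate _]/= => -> -> ->.
have hn d := @nth_table M J q (head Blank R) b d (ltn_ord q).
have hT0 : nth 0 (table M ++ J) 0 = (nst M).+1 by [].
have h0 := hn 0 isT; have h1 := hn 1 isT; have h2 := hn 2 isT.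
rewrite addn1 in h1; rewrite addn2 in h2; rewrite addn0 in h0.
move: hT0 h0 h1 h2; rewrite entryE {hn}; move: (table M ++ J) => T hT0 h0 h1 h2.
rewrite /ustep hT0 /step /halt_state [_.1]/= [_.2]/= [cstate _]/= [ctape _]/= [chead _]/=.
have -> : (q == (nst M).+1 :> nat) = (q == ord_max) by [].
case: ifP => [_|hq]; first by exists L, R.
have -> : head 0 (map symn R) = symn (head Blank R) by case: (R).
have -> : nth Blank (rev L ++ R) (size L) = head Blank R.
  by rewrite nth_cat size_rev ltnn subnn nth0.
have -> : (if b then 1 else 0) = b :> nat by case: (b).
rewrite /= h0 h1 h2 {h0 h1 h2}.
case: (trans q _ b) => [[q' a] mv] /=.
rewrite upd_tape; case: mv => /=.
  exists (a :: L), (behead R); split => //=.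
    by congr (_, (_, _)); case: (R).
  by apply: functional_extensionality => i; rewrite rev_cons cat_rcons.
case: L => [|x L] /=.
  by exists [::], (a :: behead R); split => //=; congr (_, (_, _ :: _)); case: (R).
exists L, (x :: a :: behead R); split => //=.
  by congr (_, (_, _ :: _ :: _)); case: (R).
by apply: functional_extensionality => i; rewrite rev_cons cat_rcons.
Qed.

(** Table entries are fetched by position, so whatever follows the table is ignored; a machine may
    thus be the prefix of a random string. *)
Lemma universalE l c : universal (table M ++ J) l c = output M (ones l) c.
Proof.
rewrite /universal /output /run.
have h0 : simulates (init_config M (ones l)) (0, ([::], nseq l 2)).
  by exists [::], (ones l); split => //=; rewrite map_nseq.
(* Invariant: the zipper holds no more cells than the window inspected by [output], which grows by
   one cell per coin. *)
have hsz : size (rev (0, (@nil nat, nseq l 2)).2.1 ++ (0, (@nil nat, nseq l 2)).2.2) <= size (ones l).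
  by rewrite /= !size_nseq.
rewrite addnC; move: (size (ones l)) h0 hsz; move: (init_config _ _) (0, _) => cf z k.
elim: c cf z k => [|b c IH] cf z k h hk.
  rewrite /= addn0; have [L [R [ez -> _]]] := h; move: hk; rewrite ez /= => hk.
  rewrite -map_rev -map_cat ubitsE bits_prefix_iota //.
  by move: hk; rewrite !size_cat !size_rev !size_map.
rewrite [foldl _ _ _]/= [foldl (@step M) _ _]/= [size _]/= -addSnnS.
apply: IH; first exact: ustep_simulates.
apply: leq_trans (_ : (size (rev z.2.1 ++ z.2.2)).+1 <= _); last by rewrite ltnS.
rewrite /ustep; case: ifP => _ //=; case: z {h hk} => q [L R] /=.
by case: ifP => _; [case: L => [|x L]|]; case: R => [|y R] /=;
   rewrite ?rev_cons ?size_cat ?size_rcons ?size_rev /=; lia.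
Qed.
End Simulation.

Definition parse_step (b : bool) (p : nat * seq nat) : nat * seq nat :=
  if b then (p.1.+1, p.2) else (0, p.1 :: p.2).

Definition parse (e : seq bool) : seq nat := rev (foldl (fun s b => parse_step b s) (0, [::]) e).2.

Definition unparse (t : seq nat) : seq bool := flatten [seq rcons (nseq a true) false | a <- t].

(** Every number is written in unary with a closing 0, so decoding a code followed by arbitrary bits
    yields the table followed by junk. *)
Lemma parse_cat t e : parse (unparse t ++ e) = t ++ parse e.
Proof.
have H0 a n acc u : foldl (fun s b => parse_step b s) (n, acc) (rcons (nseq a true) false ++ u)
   = foldl (fun s b => parse_step b s) (0, n + a :: acc) u.
  by elim: a n => [|a IH] n /=; rewrite ?addn0 // IH addSnnS.
have H u acc : (foldl (fun s b => parse_step b s) (0, acc) u).2 = rev (parse u) ++ acc.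
  rewrite /parse revK; have : forall n acc0, (foldl (fun s b => parse_step b s) (n, acc0 ++ acc) u).2
    = (foldl (fun s b => parse_step b s) (n, acc0) u).2 ++ acc.
    by elim: u => //= b u IH n acc0; case: b; rewrite /= -?cat_cons IH.
  by move=> /(_ 0 [::]).
rewrite /parse; suff -> acc : (foldl (fun s b => parse_step b s) (0, acc) (unparse t ++ e)).2 = rev (t ++ parse e) ++ acc.
  by rewrite cats0 revK.
elim: t acc => [|a t IH] acc; first by rewrite H.
by rewrite /unparse /= -catA H0 add0n IH rev_cons cat_rcons.
Qed.

Section UniversalCp.
Context {X : Type} {eX : Enc X} {pl : bool}.

Lemma Cp_ubits (t : X -> seq nat) : Cp pl t -> Cp pl (fun x => ubits (t x)).
Proof.
move=> h; apply: Cp_rev; apply: Cp_snd.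
apply: (Cp_foldl_add (h := fun p : X * (nat * (bool * seq bool)) => ubits_step p.2.1 p.2.2) (b := fun=> 9)) => //.
- exact: Cp_const.
- rewrite /ubits_step; cp.
- exact: PB_const.
have e1 : sz false = 1 by [].
have e2 : sz true = 3 by [].
have e3 (s : bool) : sz s <= 3 by case: s.
move=> x a [s o] _ /=; have {}e3 := e3 s; rewrite /ubits_step /=; do ?case: ifP => _;
  rewrite ?sz_pair ?sz_cons ?e1 ?e2; lia.
Qed.

Lemma Cp_parse (e : X -> seq bool) : Cp pl e -> Cp pl (fun x => parse (e x)).
Proof.
move=> h; apply: Cp_rev; apply: Cp_snd.
apply: (Cp_foldl_add (h := fun p : X * (bool * (nat * seq nat)) => parse_step p.2.1 p.2.2) (b := fun=> 9)) => //.
- exact: Cp_const.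
- rewrite /parse_step; cp.
- exact: PB_const.
move=> x a [n o] _ /=; rewrite /parse_step /=; case: a; rewrite ?sz_pair ?sz_cons ?sz_nat; lia.
Qed.

Lemma Cp_ustep (T : X -> seq nat) b z : Cp pl T -> Cp pl b -> Cp pl z ->
  Cp pl (fun x => ustep (T x) (b x) (z x)).
Proof. move=> hT hb hz; rewrite /ustep; cp. Qed.

End UniversalCp.

Lemma sz_nth0 (T : seq nat) i : sz (nth 0 T i) <= sz T.
Proof.
have [h|h] := ltnP i (size T); first exact: sz_nth.
by rewrite nth_default //; apply: sz_gt0.
Qed.

Section UniversalCp2.
Context {X : Type} {eX : Enc X} {pl : bool}.

Lemma Cp_universal (T : X -> seq nat) l c : Cp pl T -> Cp pl l -> Cp pl c ->
  Cp pl (fun x => universal (T x) (l x) (c x)).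
Proof.
move=> hT hl hc; rewrite /universal.
set z := fun x => foldl (fun z b => ustep (T x) b z) (0, ([::], nseq (l x) 2)) (c x).
have hz : Cp pl z; last first.
  by apply: Cp_ubits; cp.
(* The growth of the state depends on the size of the table, and [Cp_foldl_add] wants it polynomial
   in the parameter even when [T] is merely computable. Hence the table is made part of the
   parameter. *)
have hTX : Cp pl (fun x => (T x, x)) by cp.
pose h (p : (seq nat * X) * (bool * ustate)) := ustep p.1.1 p.2.1 p.2.2.
pose G (q : seq nat * X) := foldl (fun s a => h (q, (a, s))) (0, ([::], nseq (l q.2) 2)) (c q.2).
have hl2 : Cp pl (fun q : seq nat * X => l q.2) by cp.
have hc2 : Cp pl (fun q : seq nat * X => c q.2) by cp.
apply: (@Cp_ext _ _ _ _ _ (fun x => G (T x, x))) => //.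
apply: (Cp_comp (f := fun x => (T x, x)) (g := G)) => //.
apply: (Cp_foldl_add (h := h) (b := fun q : seq nat * X => 2 * sz q + 4)); [exact: hc2|by cp| |by pb|].
  by rewrite /h; apply: Cp_ustep; cp.
move=> [t x] b [q [L R]] _ /=.
rewrite /h /ustep /=; case: ifP => _; first by lia.
set i := (3 * _).+1.
have h0 := sz_nth0 t i; have h1 := sz_nth0 t i.+1.
rewrite [sz (t, x)]sz_pair.
have hp : 0 < sz x by exact: sz_gt0.
have hq : 0 < sz q by exact: sz_gt0.
move: h0 h1; move: (nth 0 t i) (nth 0 t i.+1) (nth 0 t i.+2) => n0 n1 n2 h0 h1; clear i.
case: ifP => _; first case: L => [|y L]; case: R => [|y' R]; rewrite /= ?sz_pair ?sz_cons ?sz_nil /=; lia.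
Qed.
End UniversalCp2.

(** * Circuits as data *)

(* Gates as triples, which are data of the stack programs. *)
Notation ggate := (nat * (nat * nat))%type.

Definition to_gate (g : ggate) : gate :=
  if g.1 == 0 then GH g.2.1 else if g.1 == 1 then GT g.2.1 else GCX g.2.1 g.2.2.

Definition index_step (b : bool) (p : bool * nat) : bool * nat :=
  if p.1 then p else if b then (false, p.2.+1) else (true, p.2).

Definition unary_len (s : seq bool) : nat := (foldl (fun p b => index_step b p) (false, 0) s).2.

Lemma unary_len_false s : unary_len (false :: s) = 0.
Proof. by rewrite /unary_len /=; elim: s. Qed.

Lemma unary_len_true s : unary_len (true :: s) = (unary_len s).+1.
Proof.
have H1 u k : foldl (fun p b => index_step b p) (true, k) u = (true, k) by elim: u.
have H u k : (foldl (fun p b => index_step b p) (false, k.+1) u).2 =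
   (foldl (fun p b => index_step b p) (false, k) u).2.+1.
  by elim: u k => [|[] u IH] k //=; rewrite /index_step /= ?H1.
exact: H.
Qed.

Lemma read_unaryE s : read_unary s = (unary_len s, drop (unary_len s).+1 s).
Proof.
elim: s => [|b s IH] //=.
by case: b; rewrite ?unary_len_true ?unary_len_false ?drop0 ?IH.
Qed.

(** One round of [dec_gates] with a reversed accumulator. An undecodable rest is replaced by the
    empty string, on which later rounds are idle, so the fuel becomes a number of iterations. *)
Definition gate_step (p : seq ggate * seq bool) : seq ggate * seq bool :=
  if nilp p.2 || nilp (behead p.2) then (p.1, [::]) else
  let s := behead (behead p.2) in
  let i := unary_len s in
  let r := drop i.+1 s in
  if head false p.2 then
    if head false (behead p.2) then (p.1, [::])
    else ((2, (i, unary_len r)) :: p.1, drop (unary_len r).+1 r)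
  else if head false (behead p.2) then ((1, (i, 0)) :: p.1, r)
  else ((0, (i, 0)) :: p.1, r).

Definition decode_gates (s : seq bool) : seq ggate :=
  rev (iter (size s) gate_step ([::], s)).1.

Lemma decode_gatesE s : map to_gate (decode_gates s) = dec_gates (size s) s.
Proof.
have H0 n acc : iter n gate_step (acc, [::]) = (acc, [::]) by elim: n => //= n ->.
suff H n acc u : map to_gate (rev (iter n gate_step (acc, u)).1) = map to_gate (rev acc) ++ dec_gates n u.
  exact: H.
elim: n acc u => [|n IH] acc u; first by rewrite /= cats0.
rewrite iterSr.
case: u => [|[] [|[] u]] /=; rewrite /gate_step /= ?H0 ?cats0 // read_unaryE.
- by rewrite read_unaryE IH rev_cons map_rcons cat_rcons.
- by rewrite IH rev_cons map_rcons cat_rcons.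
- by rewrite IH rev_cons map_rcons cat_rcons.
Qed.

Notation circuit := ((nat * nat) * seq ggate)%type.

Definition decode (s : seq bool) : circuit :=
  let n := unary_len s in let r := drop n.+1 s in
  let m := unary_len r in (n, m, decode_gates (drop m.+1 r)).

Definition to_circ (d : circuit) := (d.1, map to_gate d.2).

Lemma decodeE s : to_circ (decode s) = decode_circ s.
Proof. by rewrite /decode /to_circ /decode_circ /= !read_unaryE decode_gatesE. Qed.

Definition unary (n : nat) : seq bool := rcons (nseq n true) false.

Definition encode_gate (g : ggate) : seq bool :=
  if g.1 == 0 then [:: false, false & unary g.2.1]
  else if g.1 == 1 then [:: false, true & unary g.2.1]
  else [:: true, false & unary g.2.1 ++ unary g.2.2].

Definition encode (d : circuit) : seq bool :=
  unary d.1.1 ++ unary d.1.2 ++ flatten (map encode_gate d.2).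

Lemma read_unary_cat n s : read_unary (unary n ++ s) = (n, s).
Proof. by elim: n => //= n ->. Qed.

Lemma decode_encode d : decode_circ (encode d) = to_circ d.
Proof.
case: d => [[n m] gs]; rewrite /decode_circ /encode /= !read_unary_cat /to_circ /=.
congr (_, _).
suff H f : size gs <= f -> dec_gates f (flatten (map encode_gate gs)) = map to_gate gs.
  apply: H; elim: gs => //= g gs IH; rewrite size_cat -add1n leq_add // /encode_gate.
  by do ?case: ifP.
elim: gs f => [|g gs IH] [|f] //= h.
rewrite {1}/encode_gate {1}/to_gate; case: ifP => _; last case: ifP => _;
  by rewrite /= -?catA read_unary_cat ?read_unary_cat IH.
Qed.

Definition out_step (b : bool) (p : nat * seq bool) : nat * seq bool :=
  if p.1 == 0 then (if b then 1 else 2, p.2)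
  else if p.1 == 1 then (0, b :: p.2) else p.

Definition out_bits (s : seq bool) : seq bool := rev (foldl (fun p b => out_step b p) (0, [::]) s).2.

Lemma out_bitsE s : out_bits s = decode_out s.
Proof.
have H2 u o : foldl (fun p b => out_step b p) (2, o) u = (2, o) by elim: u.
suff H n u o : size u <= n -> (foldl (fun p b => out_step b p) (0, o) u).2 = rev (decode_out u) ++ o.
  by rewrite /out_bits (H (size s)) // cats0 revK.
elim: n u o => [|n IH] [|[] [|b u]] o //= h; rewrite /out_step /= ?H2 //.
by rewrite IH ?rev_cons ?cat_rcons //; lia.
Qed.

Section CodecCp.
Context {X : Type} {eX : Enc X} {pl : bool}.

Lemma Cp_unary_len (s : X -> seq bool) : Cp pl s -> Cp pl (fun x => unary_len (s x)).
Proof.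
move=> h; apply: Cp_snd.
apply: (Cp_foldl_add (h := fun p : X * (bool * (bool * nat)) => index_step p.2.1 p.2.2) (b := fun=> 9)) => //.
- exact: Cp_const.
- rewrite /index_step; cp.
- exact: PB_const.
have e1 : sz false = 1 by [].
have e2 : sz true = 3 by [].
have e3 (b : bool) : sz b <= 3 by case: b.
move=> x a [s' o] _ /=; have {}e3 := e3 s'; rewrite /index_step /=; do ?case: ifP => _;
  rewrite ?sz_pair ?sz_nat ?e1 ?e2; lia.
Qed.

Lemma Cp_out_bits (s : X -> seq bool) : Cp pl s -> Cp pl (fun x => out_bits (s x)).
Proof.
move=> h; apply: Cp_rev; apply: Cp_snd.
apply: (Cp_foldl_add (h := fun p : X * (bool * (nat * seq bool)) => out_step p.2.1 p.2.2) (b := fun=> 9)) => //.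
- exact: Cp_const.
- rewrite /out_step; cp.
- exact: PB_const.
have e3 (b : bool) : sz b <= 3 by case: b.
move=> x a [s' o] _ /=; have {}e3 := e3 a; rewrite /out_step /=; do ?case: ifP => _;
  rewrite ?sz_pair ?sz_nat ?sz_cons; lia.
Qed.
End CodecCp.

Lemma unary_len_le s : unary_len s <= size s.
Proof.
suff H u p : (foldl (fun p b => index_step b p) p u).2 <= p.2 + size u by exact: (H s (false, 0)).
elim: u p => [|b u IH] p /=; first by rewrite addn0.
apply: leq_trans (IH _) _; rewrite /index_step; case: ifP => _; last case: ifP => _; rewrite /=; lia.
Qed.

Lemma gate_step_size p : size (gate_step p).2 <= size p.2 /\
  sz (gate_step p).1 <= sz p.1 + (4 * size p.2 + 10).
Proof.
case: p => gs s; rewrite /gate_step [(gs, s).2]/= [(gs, s).1]/=; case: ifP => _; first by rewrite /=; split => //; lia.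
have h1 := unary_len_le (behead (behead s)).
set i := unary_len _ in h1 *; set r := drop i.+1 _.
have h2 := unary_len_le r; have h3 : size r <= size s by rewrite /r size_drop !size_behead; lia.
have h4 : i <= size s by move: h1; rewrite !size_behead; lia.
clearbody r; clear h1; clearbody i.
case: ifP => _; case: ifP => _; rewrite /= ?sz_cons; do ?rewrite sz_pair; do ?rewrite sz_nat; rewrite ?size_drop; split; lia.
Qed.

Section CodecCp2.
Context {X : Type} {eX : Enc X} {pl : bool}.

Lemma Cp_gate_step (p : X -> seq ggate * seq bool) : Cp pl p -> Cp pl (fun x => gate_step (p x)).
Proof.
move=> h; have hu : Cp pl unary_len by exact: Cp_unary_len Cp_id.
rewrite /gate_step; cp.
Qed.
End CodecCp2.

Lemma Cp_decode_gates {pl} : Cp pl decode_gates.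
Proof.
apply: Cp_rev; apply: Cp_fst.
apply: (Cp_iter (h := fun p : seq bool * (seq ggate * seq bool) => gate_step p.2)).
- exact: Cp_size_seq Cp_id.
- by cp.
- by apply: Cp_gate_step; cp.
move=> _; exists (fun s => (1 + sz s * (4 * sz s + 10)) + (4 * sz s + 1) + 1); first by pb.
move=> s i hi.
have [h1 h2] : size (iter i gate_step ([::], s)).2 <= size s /\
    sz (iter i gate_step ([::], s)).1 <= 1 + i * (4 * size s + 10).
  elim: i {hi} => [|i [IH1 IH2]] //=; have [h1 h2] := gate_step_size (iter i gate_step ([::], s)).
  by split; [exact: leq_trans h1 IH1|rewrite mulSn; lia].
have hs : size s < sz s by exact: size_sz.
rewrite -[iter i _ _]/(iter i gate_step ([::], s)).
move: h1 h2; case: (iter i _ _) => a b /= h1 h2.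
rewrite sz_pair; have hb := sz_bits b.
have : i * (4 * size s + 10) <= sz s * (4 * sz s + 10) by apply: leq_mul; lia.
lia.
Qed.

Lemma Cp_decode {pl} : Cp pl decode.
Proof.
have hu : Cp pl unary_len by exact: Cp_unary_len Cp_id.
have hd : Cp pl decode_gates by exact: Cp_decode_gates.
rewrite /decode; cp.
Qed.

Lemma Cp_encode {pl} : Cp pl encode.
Proof.
have hu : Cp pl unary.
  apply: (@Cp_ext _ _ _ _ _ (fun n => nseq n true ++ [:: false])); last by cp.
  by move=> n; rewrite cats1.
have hg : Cp pl encode_gate by rewrite /encode_gate; cp.
rewrite /encode; cp.
Qed.

(** * Independent copies of a circuit *)

(** The gates that [apply_gate n] does not skip. A skipped gate of one copy could become active on
    the larger register, so such gates must be removed before renaming qubits. *)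
Definition valid (n : nat) (g : ggate) : bool :=
  if g.1 <= 1 then g.2.1 < n else (g.2.1 < n) && (g.2.2 < n) && (g.2.1 != g.2.2).

Definition map_gate (f : nat -> nat) (g : ggate) : ggate := (g.1, (f g.2.1, if g.1 <= 1 then 0 else f g.2.2)).

(* X = H Z H = H T^4 H *)
Definition xgates (j : nat) : seq ggate := (0, (j, 0)) :: rcons (nseq 4 (1, (j, 0))) (0, (j, 0)).

(* Position p < W occupies four qubits with output bits 1, mask, 1, y, read by decode_out
   as the pair (mask, y): y is qubit p of the circuit, and the mask marks the measured ones. *)
Definition sblock (W : nat) (d : circuit) : seq ggate :=
  [seq map_gate (fun j => 4 * j + 3) g | g <- [seq g <- d.2 | valid d.1.1 g]] ++
  flatten [seq xgates (4 * p) ++ ((if p < minn d.1.2 d.1.1 then xgates (4 * p + 1) else [::])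
    ++ xgates (4 * p + 2)) | p <- iota 0 W].

Definition circ_at (T : seq nat) (k l : nat) (r : seq bool) (i : nat) : circuit :=
  decode (universal T l (take (tb k l) (drop (i * tb k l) r))).

(** Bounds the length of the generator's output, hence the number of qubits, which is written there
    in unary. The bound does not depend on the coins, so all copies can share one width. *)
Definition width (k l : nat) := tb k l + l.

Definition copies_circ (T : seq nat) (k N l : nat) (r : seq bool) : circuit :=
  ((4 * width k l * N, 4 * width k l * N),
   flatten [seq map (map_gate (addn (4 * width k l * i))) (sblock (width k l) (circ_at T k l r i))
     | i <- iota 0 N]).

Definition sel_step (b : bool) (p : nat * seq bool) : nat * seq bool :=
  (p.1./2, if b then drop p.1./2 p.2 else take p.1./2 p.2).

(** For [n = w * 2 ^ q], the [q] coins of [c] choose one of the [2 ^ q] chunks of width [w] by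
    repeated halving. *)
Definition sel (c : seq bool) (n : nat) (s : seq bool) : seq bool :=
  (foldl (fun p b => sel_step b p) (n, take n s) c).2.

Definition mask_step (b : bool) (p : bool * (bool * seq bool)) : bool * (bool * seq bool) :=
  if p.1 then (false, (false, if p.2.1 then b :: p.2.2 else p.2.2)) else (true, (b, p.2.2)).

Definition unmask (s : seq bool) : seq bool :=
  rev (foldl (fun p b => mask_step b p) (false, (false, [::])) s).2.2.

Definition sample (s : seq bool) : seq bool := out_bits (unmask s).

Definition log_step (l : nat) (p : nat * nat) : nat * nat :=
  if 2 * p.2 <= l then (p.1.+1, 2 * p.2) else p.

Definition log_pow (l : nat) : nat * nat := iter l (log_step l) (0, 1).

(** [log_pow l] is a pair of an exponent and its power of two, within a factor 2 of [l.+1]. The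
    number of copies is thus a power of two with an integral number of index coins, at least
    [l.+1 ^ K] and still polynomial. *)
Definition ncoins (K l : nat) : nat := K * (log_pow l).1.+1.
Definition ncopies (K l : nat) : nat := (2 * (log_pow l).2) ^ K.

Lemma log_powE l : [/\ (log_pow l).2 = 2 ^ (log_pow l).1, (log_pow l).2 <= l.+1
  & l < 2 * (log_pow l).2].
Proof.
have H i : [/\ (iter i (log_step l) (0, 1)).2 = 2 ^ (iter i (log_step l) (0, 1)).1,
  (iter i (log_step l) (0, 1)).2 <= l.+1 &
  (l < 2 * (iter i (log_step l) (0, 1)).2) \/ (iter i (log_step l) (0, 1)).1 = i].
  elim: i => [|i]; first by split => //; right.
  rewrite iterS; case: (iter i _ _) => v w /= [h1 h2 h3]; rewrite /log_step /=.
  case: ifP => h; rewrite /= ?h1 ?expnS; split => //.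
  - by rewrite -h1; lia.
  - by right; case: h3 => [|->] //; lia.
  - by rewrite -h1.
  - by left; rewrite -h1; lia.
have [h1 h2 h3] := H l; split => //; case: h3 => // e; rewrite h1 e.
by apply: leq_trans (ltn_expl l (ltnSn 1)) _; rewrite leq_pmull.
Qed.

Lemma ncopiesE K l : ncopies K l = 2 ^ ncoins K l.
Proof. by have [h _ _] := log_powE l; rewrite /ncopies /ncoins h -expnS -expnM mulnC. Qed.

Lemma ncopies_ge K l : l.+1 ^ K <= ncopies K l.
Proof. by have [_ _ h] := log_powE l; exact: leq_expr. Qed.

Section SamplerCp.
Context {pl : bool}.

Lemma Cp_log_pow : Cp pl log_pow.
Proof.
rewrite /log_pow; apply: (Cp_iter (h := fun p : nat * (nat * nat) => log_step p.1 p.2)); try by cp.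
move=> _; exists (fun l : nat => sz l + (2 * sz l + 3) + 1); first by pb.
move=> l i hi; rewrite -[iter i _ _]/(iter i (log_step l) (0, 1)).
have : (iter i (log_step l) (0, 1)).1 <= i /\ (iter i (log_step l) (0, 1)).2 <= l.+1.
  elim: i {hi} => [|i IH] //; rewrite iterS; case: (iter i _ _) IH => v w /= [h1 h2].
  by rewrite /log_step /=; case: ifP => /= h; split; lia.
case: (iter i _ _) => v w /= [h1 h2]; rewrite sz_pair !sz_nat; lia.
Qed.

Lemma Cp_ncoins K : Cp pl (ncoins K).
Proof. have hl := Cp_log_pow; rewrite /ncoins; cp. Qed.

Lemma Cp_ncopies K : Cp pl (ncopies K).
Proof. have hl := Cp_log_pow; rewrite /ncopies; cp. Qed.

Lemma Cp_half : Cp pl half.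
Proof.
have e n : iter n (fun p => (~~ p.1, if p.1 then p.2.+1 else p.2)) (false, 0) = (odd n, n./2).
  elim: n => //= n ->; congr pair; rewrite /= uphalf_half; by case: odd.
pose h (p : nat * (bool * nat)) := (~~ p.2.1, if p.2.1 then p.2.2.+1 else p.2.2).
apply: (@Cp_ext _ _ _ _ _ (fun n => (iter n (fun s => h (n, s)) (false, 0)).2)).
  by move=> n; rewrite /h /= e.
apply: Cp_snd; apply: (Cp_iter_add (h := h) (b := fun=> 9)); try by rewrite /h; cp.
  exact: PB_const.
move=> x [a b]; rewrite /h /=.
have e3 (c : bool) : sz c <= 3 by case: c.
have := e3 (~~ a); case: a => /= h1; rewrite !sz_pair !sz_nat; lia.
Qed.

Lemma Cp_sel : Cp pl (fun p : seq bool * nat * seq bool => sel p.1.1 p.1.2 p.2).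
Proof.
have hh := Cp_half.
apply: Cp_snd; apply: (Cp_foldl_add (h := fun p : (seq bool * nat * seq bool) * (bool * (nat * seq bool)) => sel_step p.2.1 p.2.2) (b := fun=> 9)); try by cp.
- by rewrite /sel_step; cp.
- exact: PB_const.
move=> x a [n s] _; rewrite /sel_step /= !sz_pair !sz_nat.
have h1 : sz (drop n./2 s) <= sz s by exact: sz_drop.
have h2 : sz (take n./2 s) <= sz s by exact: sz_take.
case: ifP => _; lia.
Qed.

Lemma Cp_sample : Cp pl sample.
Proof.
apply: Cp_out_bits; apply: Cp_rev; apply: Cp_snd; apply: Cp_snd.
apply: (Cp_foldl_add (h := fun p : seq bool * (bool * (bool * (bool * seq bool))) => mask_step p.2.1 p.2.2) (b := fun=> 20)); try by cp.
  exact: PB_const.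
have e3 (c : bool) : 0 < sz c <= 3 by case: c.
move=> x a [u [v w]] _; rewrite /mask_step /=.
have := e3 a; have := e3 u; have := e3 v; have := e3 true; have := e3 false.
by do ?case: ifP => _; rewrite ?sz_pair ?sz_cons; lia.
Qed.

Lemma Cp_sblock : Cp pl (fun p : nat * circuit => sblock p.1 p.2).
Proof. rewrite /sblock /valid /map_gate /xgates /=; cp. Qed.

Lemma Cp_copies_circ T k (N : nat -> nat) : Cp pl N ->
  Cp pl (fun p : nat * seq bool => encode (copies_circ T k (N p.1) p.1 p.2)).
Proof.
move=> hN.
have hs : Cp pl (fun p : nat * circuit => sblock p.1 p.2) by exact: Cp_sblock.
have he : Cp pl encode by exact: Cp_encode.
have hd : Cp pl decode by exact: Cp_decode.
have hu : Cp pl (fun p : nat * seq bool => universal T p.1 p.2) by apply: Cp_universal; cp.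
rewrite /copies_circ /circ_at /map_gate /width; cp.
Qed.
End SamplerCp.

(** * Amplitudes *)

Local Open Scope ring_scope.

Fixpoint bsum (n : nat) (h : seq bool -> algC) : algC :=
  if n is n'.+1 then bsum n' (fun c => h (false :: c)) + bsum n' (fun c => h (true :: c))
  else h [::].

Lemma bsum_tuple n h : bsum n h = \sum_(c : n.-tuple bool) h c.
Proof.
elim: n h => [|n IH] h /=; last by rewrite !IH sum_tuple_cons.
by rewrite (big_pred1 [tuple]) // => c; apply/esym/eqP; exact: tuple0.
Qed.

Lemma avg_bsum n h : avg n h = bsum n h / 2%:R ^+ n.
Proof. by rewrite avgE bsum_tuple. Qed.

Lemma eq_bsum n h1 h2 : (forall c, size c = n -> h1 c = h2 c) -> bsum n h1 = bsum n h2.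
Proof. by move=> e; rewrite !bsum_tuple; apply: eq_bigr => c _; rewrite e ?size_tuple. Qed.

Lemma bsum_cat a b h : bsum (a + b) h = bsum a (fun s => bsum b (fun t => h (s ++ t))).
Proof. by elim: a h => [|a IH] h //=; rewrite !IH. Qed.

Lemma bsumZ n a h : bsum n (fun c => a * h c) = a * bsum n h.
Proof. by rewrite !bsum_tuple mulr_sumr. Qed.

Lemma bsumZr n a h : bsum n (fun c => h c * a) = bsum n h * a.
Proof. by rewrite !bsum_tuple mulr_suml. Qed.

Lemma bsumD n h1 h2 : bsum n (fun c => h1 c + h2 c) = bsum n h1 + bsum n h2.
Proof. by rewrite !bsum_tuple big_split. Qed.

Lemma bsum_ge0 n h : (forall c, 0 <= h c) -> 0 <= bsum n h.
Proof. by move=> hh; rewrite bsum_tuple; apply: sumr_ge0. Qed.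

Lemma bsum_eq n (s : seq bool) : size s = n -> bsum n (fun c => (c == s)%:R) = 1.
Proof.
move=> /eqP hs; rewrite bsum_tuple (bigD1 (Tuple hs)) //= eqxx big1 ?addr0 // => c hc.
by case: eqP => // e; case/eqP: hc; apply: val_inj.
Qed.

Lemma bsum_exchange a b (h : seq bool -> seq bool -> algC) :
  bsum a (fun s => bsum b (fun t => h s t)) = bsum b (fun t => bsum a (fun s => h s t)).
Proof.
rewrite !bsum_tuple (eq_bigr (fun c : a.-tuple bool => \sum_(t : b.-tuple bool) h c t)); last first.
  by move=> c _; rewrite bsum_tuple.
by rewrite exchange_big; apply: eq_bigr => c _; rewrite bsum_tuple.
Qed.

Lemma sqrt2K : sqrtC 2%:R * sqrtC 2%:R = 2%:R :> algC.
Proof. by rewrite -expr2 sqrtCK. Qed.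

Lemma sqrt2_neq0 : sqrtC 2%:R != 0 :> algC.
Proof. by rewrite sqrtC_eq0 pnatr_eq0. Qed.

Lemma conj_omega8 : omega8^* = (1 - 'i) / sqrtC 2%:R.
Proof.
rewrite /omega8 rmorphM rmorphD rmorph1 fmorphV /= conjCi; congr (_ / _).
by apply/CrealP; rewrite ger0_real // sqrtC_ge0 ler0n.
Qed.

Lemma norm_omega8 : `|omega8| = 1.
Proof.
have h : `|omega8| ^+ 2 = 1.
  rewrite normCK conj_omega8 /omega8.
  have -> : (1 + 'i) / sqrtC 2%:R * ((1 - 'i) / sqrtC 2%:R) =
     (1 - 'i ^+ 2) / (sqrtC 2%:R * sqrtC 2%:R) :> algC.
    by field; exact: sqrt2_neq0.
  rewrite sqrt2K sqrCi opprK -[1 + 1]/(2%:R) divff // pnatr_eq0 //.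
by apply/eqP; rewrite -(@pexpr_eq1 _ _ 2) // h.
Qed.

Lemma set_nth_mid (s t : seq bool) b c : set_nth false (s ++ b :: t) (size s) c = s ++ c :: t.
Proof. by elim: s => //= a s ->. Qed.

Lemma bsum_split n i h : (i < n)%N -> bsum n h =
  bsum i (fun s => bsum (n - i.+1) (fun t => h (s ++ false :: t) + h (s ++ true :: t))).
Proof.
move=> hi; rewrite {1}(_ : n = (i + (n - i.+1).+1)%N); last by lia.
by rewrite bsum_cat; apply: eq_bsum => s _ /=; rewrite bsumD.
Qed.

Lemma normsq_parallelogram (a b : algC) :
  `|(a + b) / sqrtC 2%:R| ^+ 2 + `|(a - b) / sqrtC 2%:R| ^+ 2 = `|a| ^+ 2 + `|b| ^+ 2.
Proof.
have hn : `|sqrtC 2%:R : algC| ^+ 2 = 2%:R.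
  by rewrite ger0_norm ?sqrtC_ge0 ?ler0n // sqrtCK.
have h2 : 2%:R != 0 :> algC by rewrite pnatr_eq0.
rewrite !normrM !normfV !exprMn !exprVn hn -mulrDl !normCK !rmorphD rmorphN.
rewrite /=; move: (a^*) (b^*) => a' b'; by field.
Qed.

Lemma unitary_gate n g f : bsum n (fun x => `|apply_gate n g f x| ^+ 2) = bsum n (fun x => `|f x| ^+ 2).
Proof.
case: g => [i|i|c t] /=.
- case: ifP => // hi; rewrite !(bsum_split _ hi).
  apply: eq_bsum => s hs; apply: eq_bsum => u _.
  rewrite -hs !set_nth_mid !nth_cat ltnn subnn /= mul1r mulN1r.
  exact: normsq_parallelogram.
- case: ifP => // hi; apply: eq_bsum => x _; rewrite normrM.
  by case: ifP => _; rewrite ?norm_omega8 ?normr1 mul1r.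
- case: ifP => // /and3P [hc ht hct]; rewrite !(bsum_split _ ht).
  apply: eq_bsum => s hs; apply: eq_bsum => u _.
  rewrite -hs !set_nth_mid !(@nth_cat _ _ _ _ (size s)) ltnn subnn /= ?hs.
  (* The control differs from the target, so its value is common to the two strings that the gate
     may exchange. *)
  have [e he] : exists e, forall b, nth false (s ++ b :: u) c = e.
    have [h|h] := ltnP c t; first by exists (nth false s c) => b; rewrite nth_cat hs h.
    exists (nth false u (c - t).-1) => b; rewrite nth_cat hs ltnNge h /=.
    by case E: (c - t)%N => [|d] //; lia.
  by rewrite !he; case: e {he} => //=; rewrite addrC.
Qed.

Lemma unitary n gs : bsum n (fun x => `|final_amp n gs x| ^+ 2) = 1.
Proof.
rewrite -(bsum_eq (size_nseq n false)) /final_amp.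
have -> : bsum n (fun c => (c == nseq n false)%:R) =
   bsum n (fun c => `|((c == nseq n false)%:R : algC)| ^+ 2).
  by apply: eq_bsum => c _; case: eqP => _; rewrite ?normr1 ?expr1n // normr0 expr0n.
elim/last_ind: gs => [|gs g IH] //.
by rewrite -IH -[RHS](unitary_gate n g); apply: eq_bsum => x _; rewrite foldl_rcons.
Qed.

Definition get (phi : nat -> nat) (n : nat) (x : seq bool) : seq bool :=
  mkseq (fun p => nth false x (phi p)) n.

Section Frame.
Variables (n n' : nat) (phi : nat -> nat) (v : seq bool -> algC).
Hypotheses (phi_lt : forall p, (p < n')%N -> (phi p < n)%N)
  (phi_inj : forall p q, (p < n')%N -> (q < n')%N -> phi p = phi q -> p = q)
  (v_inv : forall x p b, (p < n')%N -> v (set_nth false x (phi p) b) = v x).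

Lemma get_set x p b : (p < n')%N ->
  get phi n' (set_nth false x (phi p) b) = set_nth false (get phi n' x) p b.
Proof.
move=> hp; apply: (@eq_from_nth _ false); first by rewrite size_set_nth !size_mkseq (maxn_idPr hp).
rewrite size_mkseq => q hq; rewrite nth_mkseq // !nth_set_nth /= nth_mkseq //.
case: eqP => [/phi_inj -> //|h]; first by rewrite eqxx.
by case: eqP => // e; rewrite e in h.
Qed.

Lemma size_set x p b : size x = n -> (p < n')%N -> size (set_nth false x (phi p) b) = n.
Proof. by move=> hx hp; rewrite size_set_nth hx (maxn_idPr _) // phi_lt. Qed.

(** The state is a product of [u], on the qubits [phi p], and of [v], which does not depend on these
    qubits and so behaves as a scalar for a gate acting on them. *)
Lemma frame_gate g (F u : seq bool -> algC) : valid n' g ->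
  (forall x, size x = n -> F x = u (get phi n' x) * v x) ->
  forall x, size x = n ->
  apply_gate n (to_gate (map_gate phi g)) F x = apply_gate n' (to_gate g) u (get phi n' x) * v x.
Proof.
case: g => [t [i j]]; rewrite /valid /to_gate /= => hv HF x hx.
case: t hv => [|[|t]] /=.
- move=> hi; rewrite hi phi_lt //= !HF ?size_set // !v_inv // !get_set // nth_mkseq //.
  by ring.
- by move=> hi; rewrite hi phi_lt //= HF // nth_mkseq // mulrA.
- case/andP=> /andP [hi hj] hij; rewrite hi hj hij !phi_lt //=.
  have -> : phi i != phi j by apply: contra hij => /eqP /phi_inj ->.
  by rewrite HF ?size_set // v_inv // get_set // !nth_mkseq.
Qed.

Lemma frame_gates gs (F u : seq bool -> algC) : all (valid n') gs ->
  (forall x, size x = n -> F x = u (get phi n' x) * v x) ->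
  forall x, size x = n ->
  foldl (fun f g => apply_gate n g f) F (map to_gate (map (map_gate phi) gs)) x =
  foldl (fun f g => apply_gate n' g f) u (map to_gate gs) (get phi n' x) * v x.
Proof.
elim: gs F u => [|g gs IH] F u /=; first by move=> _ H; exact: H.
case/andP=> hg hgs H; apply: IH => //; exact: frame_gate.
Qed.
End Frame.

Section Blocks.
Variables (n N : nat) (wd : nat -> nat) (phi : nat -> nat -> nat) (gs : nat -> seq ggate).
Hypotheses (phi_lt : forall i p, (i < N)%N -> (p < wd i)%N -> (phi i p < n)%N)
  (phi_inj : forall i j p q, (i < N)%N -> (j < N)%N -> (p < wd i)%N -> (q < wd j)%N ->
     phi i p = phi j q -> i = j /\ p = q)
  (phi_onto : forall k, (k < n)%N -> exists i p, [/\ (i < N)%N, (p < wd i)%N & k = phi i p])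
  (gs_valid : forall i, (i < N)%N -> all (valid (wd i)) (gs i)).

(* Gates acting on disjoint sets of qubits: the final state is a tensor product. *)
Lemma blocks_amp x : size x = n ->
  final_amp n (map to_gate (flatten [seq map (map_gate (phi i)) (gs i) | i <- iota 0 N])) x
  = \prod_(0 <= i < N) final_amp (wd i) (map to_gate (gs i)) (get (phi i) (wd i) x).
Proof.
pose init i x : algC := (get (phi i) (wd i) x == nseq (wd i) false)%:R.
pose A i x := final_amp (wd i) (map to_gate (gs i)) (get (phi i) (wd i) x).
have get_other i j p b y : (i < N)%N -> (j < N)%N -> i != j -> (p < wd i)%N ->
    get (phi j) (wd j) (set_nth false y (phi i p) b) = get (phi j) (wd j) y.
  move=> hi hj hij hp; apply: (@eq_from_nth _ false); rewrite !size_mkseq // => q hq.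
  rewrite !nth_mkseq // nth_set_nth /=; case: eqP => // e.
  by have [e2 _] := phi_inj hj hi hq hp e; rewrite e2 eqxx in hij.
(* After the first [K] blocks of gates the remaining blocks are still in the all-zero state. *)
have H K : (K <= N)%N -> forall y, size y = n ->
   final_amp n (map to_gate (flatten [seq map (map_gate (phi i)) (gs i) | i <- iota 0 K])) y
   = (\prod_(0 <= i < K) A i y) * \prod_(K <= i < N) init i y.
  elim: K => [|K IH] hK y hy.
    rewrite big_nil mul1r /final_amp /= /init.
    have [e|ne] := eqVneq y (nseq n false).
      rewrite big_nat_cond big1 // => i /andP[/andP[_ hi] _]; apply/eqP; rewrite pnatr_eq1 eqb1 e.
      apply/eqP/(@eq_from_nth _ false); rewrite ?size_mkseq ?size_nseq // => p hp.
      by rewrite nth_mkseq // !nth_nseq; do !case: ifP.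
    (* A nonzero bit of [y] lies in some block by [phi_onto], and the initial factor of that block
       vanishes. *)
    have [k hk hyk] : exists2 k, (k < n)%N & nth false y k.
      have : ~~ all negb y.
        apply: contra ne => /all_nthP h; apply/eqP/(@eq_from_nth _ false); first by rewrite hy size_nseq.
        by move=> k hk; rewrite nth_nseq -hy hk; apply/negbTE/h.
      by rewrite -has_predC => /(has_nthP false) [k hk]; rewrite /= negbK hy in hk *; exists k.
    have [i [p [hi hp ek]]] := phi_onto hk.
    apply/esym/eqP; rewrite big_mkord prodf_seq_eq0; apply/hasP; exists (Ordinal hi).
      by rewrite mem_index_enum.
    rewrite /= pnatr_eq0 eqb0; apply/eqP => /(congr1 (fun s => nth false s p)).
    by rewrite nth_mkseq // nth_nseq hp -ek hyk.
  rewrite -addn1 iotaD map_cat flatten_cat map_cat /final_amp foldl_cat -/(final_amp _ _) /= cats0 add0n.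
  pose v z := (\prod_(0 <= i < K) A i z) * \prod_(K.+1 <= i < N) init i z.
  rewrite addn1 big_nat_recr //= -/(A K y) -mulrA [A K y * _]mulrC mulrA -/(v y) mulrC.
  rewrite -/(final_amp n _).
  have e := @frame_gates n (wd K) (phi K) v _ _ _ (gs K) _ (fun z => (z == nseq (wd K) false)%:R).
  rewrite e //.
  - by move=> p; exact: phi_lt.
  - by move=> p q hp hq /phi_inj [].
  - move=> z p b hp; rewrite /v; congr (_ * _); rewrite !big_nat; apply: eq_bigr => i /andP[h1 h2];
      rewrite /A /init get_other // ?neq_ltn ?h1 ?h2 ?orbT //; lia.
  - exact: gs_valid.
  - move=> z hz; rewrite IH ?(ltnW hK) // [\prod_(K <= i < N) _]big_ltn // /v -/(init K z).
    by rewrite mulrCA.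
by move=> hx; rewrite H // [X in _ * X]big_geq // mulr1.
Qed.
End Blocks.

Lemma invalid_gate n g f : ~~ valid n g -> apply_gate n (to_gate g) f = f.
Proof.
case: g => [[|[|t]] [i j]]; rewrite /valid /to_gate /=; do ?by move/negbTE => ->.
by rewrite -andbA => /negbTE ->.
Qed.

Lemma final_amp_valid n gs : final_amp n (map to_gate [seq g <- gs | valid n g]) =
  final_amp n (map to_gate gs).
Proof.
rewrite /final_amp; move: (fun x => (x == nseq n false)%:R); elim: gs => //= g gs IH f.
by case: ifP => [|/negbT] h /=; rewrite IH // invalid_gate.
Qed.

Lemma omega8_4 : omega8 ^+ 4 = -1.
Proof.
have h2 : omega8 ^+ 2 = 'i.
  rewrite /omega8 expr_div_n expr2 sqrtCK.
  have -> : (1 + 'i) * (1 + 'i) = 2%:R * 'i + (1 + 'i ^+ 2) :> algC by ring.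
  by rewrite sqrCi subrr addr0 mulrAC divff ?mul1r // pnatr_eq0.
by rewrite -[RHS]sqrCi -h2 -exprM.
Qed.

Lemma xgates_amp b : final_amp 1 (map to_gate (xgates 0)) [:: b] = b%:R.
Proof.
rewrite /final_amp /=; have h4 := omega8_4; rewrite !exprS expr0 mulr1 in h4.
have hs := sqrt2K; have h0 := sqrt2_neq0.
have aux (a : algC) : a / sqrtC 2%:R / sqrtC 2%:R = a / 2%:R.
  by rewrite -mulrA -invfM sqrt2K.
have -> (a b' c : algC) : (1 * (1 * (1 * (1 * (a / sqrtC 2%:R)))) + b' * (omega8 * (omega8 * (omega8 *
   (omega8 * (c / sqrtC 2%:R)))))) / sqrtC 2%:R = (a - b' * c) / 2%:R.
  rewrite -[RHS]aux; congr (_ / _).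
  have -> : b' * (omega8 * (omega8 * (omega8 * (omega8 * (c / sqrtC 2%:R))))) =
    (omega8 * (omega8 * (omega8 * omega8))) * (b' * c) / sqrtC 2%:R by ring.
  by rewrite h4; ring.
have h2 : 2%:R != 0 :> algC by rewrite pnatr_eq0.
by case: b => /=; rewrite ?eqxx /=; field.
Qed.

(** * The block of one copy *)

Section Superblock.
Variables (W n m : nat) (gs : seq ggate).
Hypothesis hn : (n <= W)%N.

(** Block 0 is the circuit itself. Block [k.+1] is the single qubit [k], with width 0 when that
    qubit already belongs to the circuit, so that the blocks partition the register. *)
Let wd i := if i == 0%N then n else
  if (i.-1 %% 4 == 3)%N && (i.-1 %/ 4 < n)%N then 0%N else 1%N.
Let phi i p := if i == 0%N then (4 * p + 3)%N else i.-1.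
Let sgs i := if i == 0%N then [seq g <- gs | valid n g] else
  match (i.-1 %% 4)%N with
  | 0 | 2 => xgates 0
  | 1 => if (i.-1 %/ 4 < minn m n)%N then xgates 0 else [::]
  | _ => [::]
  end.

Lemma flatten_iota4 T (f : nat -> seq T) : flatten [seq f i | i <- iota 0 (4 * W)] =
  flatten [seq f (4 * p)%N ++ (f (4 * p + 1)%N ++ (f (4 * p + 2)%N ++ f (4 * p + 3)%N)) | p <- iota 0 W].
Proof.
elim: (W) => // w IH; rewrite mulnSr iotaD map_cat flatten_cat IH.
rewrite -(addn1 w) (iotaD 0 w 1) map_cat flatten_cat /= !add0n cats0; congr (_ ++ _).
by rewrite cats0 addn1 addn2 addn3. 
Qed.

Lemma modn4 p r : (r < 4)%N -> ((4 * p + r) %% 4 = r)%N /\ ((4 * p + r) %/ 4 = p)%N.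
Proof. by move=> h; rewrite mulnC modnMDl modn_small // divnMDl // divn_small // addn0. Qed.

Lemma sblock_blocks : sblock W (n, m, gs) =
  flatten [seq map (map_gate (phi i)) (sgs i) | i <- iota 0 (1 + 4 * W)].
Proof.
rewrite /sblock iotaD map_cat flatten_cat /= cats0; congr (_ ++ _).
rewrite (iotaDl 1 0) -map_comp flatten_iota4; congr flatten; apply: eq_map => p /=.
have h0 := @modn4 p 0 isT; rewrite addn0 in h0.
rewrite /sgs /phi /= (modn4 p (isT : 1 < 4)%N).1 (modn4 p (isT : 2 < 4)%N).1 (modn4 p (isT : 3 < 4)%N).1.
rewrite h0.1 (modn4 p (isT : 1 < 4)%N).2 /= !add0n.
by case: ifP.
Qed.

Definition embed (l : seq (bool * bool)) : seq bool :=
  flatten [seq [:: true; q.1; true; q.2] | q <- l].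

Definition block_pairs (y : seq bool) := mkseq (fun p => ((p < minn m n)%N, nth false y p)) W.

Lemma size_embed l : size (embed l) = (4 * size l)%N.
Proof. by elim: l => //= q l IH; rewrite IH mulnS. Qed.

Lemma nth_embed y k : (k < 4 * W)%N -> nth false (embed (block_pairs y)) k =
  nth false [:: true; (k %/ 4 < minn m n)%N; true; nth false y (k %/ 4)] (k %% 4).
Proof.
move=> hk; rewrite {1}(divn_eq k 4) mulnC /embed /block_pairs /mkseq -map_comp nth_blocks.
- rewrite (nth_map 0%N) ?size_iota ?nth_iota //; lia.
- by apply/allP => s /mapP [p _ ->].
- by rewrite ltn_mod.
- by rewrite size_map size_iota; lia.
Qed.

(** All qubits outside the circuit end in a fixed basis state, so an amplitude is nonzero only on
    strings that are determined by their circuit bits. *)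
Lemma sblock_amp x : size x = (4 * W)%N ->
  final_amp (4 * W) (map to_gate (sblock W (n, m, gs))) x =
  (x == embed (block_pairs (get (fun p => 4 * p + 3)%N n x)))%:R
  * final_amp n (map to_gate gs) (get (fun p => 4 * p + 3)%N n x).
Proof.
move=> hx; rewrite sblock_blocks; set y := get _ n x.
rewrite (@blocks_amp (4 * W) (1 + 4 * W) wd phi sgs); first last.
- exact: hx.
- move=> [|i] hi; rewrite /sgs /=; first by apply/allP => g; rewrite mem_filter => /andP[].
  rewrite /wd /=.
  have : (i %% 4 < 4)%N by rewrite ltn_mod.
  by case: (i %% 4)%N => [|[|[|[|r]]]] //= _; case: ifP.
- move=> k hk; have [h|h] := boolP ((k %% 4 == 3)%N && (k %/ 4 < n)%N).
    by exists 0%N, (k %/ 4)%N; rewrite /wd /phi /=; split=> //; lia.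
  by exists k.+1, 0%N; rewrite /wd /phi /= (negbTE h); split=> //; lia.
- move=> [|i] [|j] p q; rewrite /wd /phi /=.
  + by move=> _ _ _ _ h; split=> //; lia.
  + by move=> _ hj hp; case: ifP => // /negbT h1 hq e; exfalso; move: h1; rewrite -e; lia.
  + by move=> hi _; case: ifP => // /negbT h1 hp hq e; exfalso; move: h1; rewrite e; lia.
  + by move=> hi hj; do 2 (case: ifP => // _); move=> hp hq ->; split => //; lia.
- move=> [|i] p hi; rewrite /wd /phi /=; first by lia.
  by move=> _; lia.
rewrite big_ltn // [X in X * _](_ : _ = final_amp n (map to_gate gs) y); last first.
  by rewrite /sgs /= final_amp_valid.
rewrite mulrC; congr (_ * _).
rewrite big_add1 /=.
have hk k : (0 <= k < 4 * W)%N -> final_amp (wd k.+1) (map to_gate (sgs k.+1)) (get (phi k.+1) (wd k.+1) x)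
   = (nth false x k == nth false (embed (block_pairs y)) k)%:R.
  move=> /= hk; rewrite nth_embed // /sgs /wd /=.
  have : (k %% 4 < 4)%N by rewrite ltn_mod.
  have hy p : (p < n)%N -> nth false y p = nth false x (4 * p + 3) by move=> hp; rewrite nth_mkseq.
  case E: (k %% 4)%N => [|[|[|[|r]]]] //= _.
  - by rewrite xgates_amp /phi /=; case: nth.
  - case: ifP => _; first by rewrite xgates_amp /phi /=; case: nth.
    by rewrite /final_amp /get /phi /=; case: nth.
  - by rewrite xgates_amp /phi /=; case: nth.
  - case: ifP => h.
      by rewrite /final_amp /get /= hy // (_ : 4 * _ + 3 = k)%N ?eqxx //; lia.
    (* Beyond the last qubit of the circuit, the default value [false] of [nth] is the value of the
       untouched data qubit. *)
    rewrite /final_amp /get /phi /= [nth false y _]nth_default ?size_mkseq; last by lia.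
    by case: nth.
rewrite (eq_big_nat _ _ hk).
have hsz : size (embed (block_pairs y)) = (4 * W)%N by rewrite size_embed size_mkseq.
case: eqP => [<-|ne]; first by rewrite big1 // => k _; rewrite eqxx.
have : ~~ all (fun k => nth false x k == nth false (embed (block_pairs y)) k) (iota 0 (4 * W)).
  apply/negP => /allP h; case: ne; apply: (@eq_from_nth _ false); rewrite ?hsz // hx => k hk'.
  by apply/eqP/h; rewrite mem_iota.
rewrite -has_predC => /hasP [k]; rewrite mem_iota add0n => /andP [_ hk'] /= hne.
apply/eqP; rewrite big_mkord prodf_seq_eq0; apply/hasP; exists (Ordinal hk').
  by rewrite mem_index_enum.
by rewrite /= pnatr_eq0 eqb0.
Qed.

Lemma get_embed y : size y = n -> get (fun p => 4 * p + 3)%N n (embed (block_pairs y)) = y.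
Proof.
move=> hy; apply: (@eq_from_nth _ false); rewrite size_mkseq // => p hp.
rewrite nth_mkseq // nth_embed; last by lia.
by rewrite (modn4 p (isT : 3 < 4)%N).1 (modn4 p (isT : 3 < 4)%N).2.
Qed.

Lemma sblock_bsum (G : seq bool -> algC) :
  bsum (4 * W) (fun x => `|final_amp (4 * W) (map to_gate (sblock W (n, m, gs))) x| ^+ 2 * G x) =
  bsum n (fun y => `|final_amp n (map to_gate gs) y| ^+ 2 * G (embed (block_pairs y))).
Proof.
pose K y := `|final_amp n (map to_gate gs) y| ^+ 2 * G (embed (block_pairs y)).
pose gx := get (fun p => 4 * p + 3)%N n.
(* Change of variables: insert the sum over [y] of the indicator that [x] is the embedding of [y];
   at most one term survives, since [get_embed] recovers [y]. *)
rewrite (@eq_bsum _ _ (fun x => bsum n (fun y => (x == embed (block_pairs y))%:R * K y))).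
  rewrite bsum_exchange; apply: eq_bsum => y hy.
  by rewrite bsumZr bsum_eq ?mul1r // size_embed size_mkseq.
move=> x hx; rewrite sblock_amp // -/(gx x).
rewrite (@eq_bsum _ _ (fun y => (y == gx x)%:R * ((x == embed (block_pairs (gx x)))%:R * K (gx x)))); last first.
  move=> y hy; have [e|ne] := eqVneq y (gx x); first by rewrite -e mul1r.
  rewrite mul0r; case: eqP => [e|_]; last by rewrite mul0r.
  by case/eqP: ne; rewrite e /gx get_embed.
rewrite bsumZr bsum_eq ?size_mkseq // mul1r /K.
by case: eqP => [e|_]; [rewrite !mul1r -e|rewrite !mul0r normr0 expr0n mul0r].
Qed.
End Superblock.

Definition pair_bits (l : seq (bool * bool)) : seq bool := flatten [seq [:: q.1; q.2] | q <- l].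

Lemma decode_embed l : decode_out (embed l) = pair_bits l.
Proof. by elim: l => //= q l ->. Qed.

Lemma unmask_pairs l : unmask (pair_bits l) = [seq q.2 | q <- l & q.1].
Proof.
rewrite /unmask; suff H v w : (foldl (fun p b => mask_step b p) (false, (v, w)) (pair_bits l)).2.2
    = rev [seq q.2 | q <- l & q.1] ++ w by rewrite H cats0 revK.
elim: l v w => //= -[a b] l IH v w; rewrite /mask_step /= IH.
by case: a; rewrite //= rev_cons cat_rcons.
Qed.

(** The mask selects the measured bits, and only then is the end marker of this copy interpreted. *)
Lemma sample_block W n m y : (n <= W)%N -> size y = n ->
  sample (pair_bits (block_pairs W n m y)) = decode_out (take m y).
Proof.
move=> hn hy; rewrite /sample out_bitsE unmask_pairs; congr decode_out.
have hk : (minn m n <= W)%N by apply: leq_trans hn; exact: geq_minr.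
rewrite /block_pairs /mkseq -(subnKC hk) iotaD map_cat filter_cat map_cat add0n.
rewrite [X in _ ++ X](_ : _ = [::]) ?cats0; last first.
  apply/size0nil/eqP; rewrite size_map size_filter.
  rewrite -leqn0 leqNgt -has_count; apply/negP => /hasP [q /mapP [p]].
  by rewrite mem_iota => /andP [h _] ->; rewrite /= ltnNge h.
rewrite (_ : [seq q <- _ | q.1] = map (fun p => ((p < minn m n)%N, nth false y p)) (iota 0 (minn m n))); last first.
  apply/all_filterP/allP => q /mapP [p]; rewrite mem_iota add0n => /andP [_ h] ->; exact: h.
rewrite -map_comp (_ : _ \o _ = nth false y) // map_nth_iota0; last by rewrite hy geq_minr.
by rewrite /minn; case: ltnP => // h; rewrite !take_oversize ?hy.
Qed.

Definition chunk w i (s : seq bool) := take w (drop (w * i) s).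

Lemma chunk_embed W i L : chunk (4 * W) i (embed L) = embed (take W (drop (W * i) L)).
Proof.
have ht k l : take (4 * k) (embed l) = embed (take k l).
  elim: l k => [|q l IH] [|k] //.
  by rewrite mulnS /embed /= -!/(embed _) IH.
have hd k l : drop (4 * k) (embed l) = embed (drop k l).
  elim: l k => [|q l IH] [|k] //.
  by rewrite mulnS /embed /= -!/(embed _) IH.
by rewrite /chunk -mulnA hd ht.
Qed.

Lemma chunk_pairs W i L : chunk (2 * W) i (pair_bits L) = pair_bits (take W (drop (W * i) L)).
Proof.
have ht k l : take (2 * k) (pair_bits l) = pair_bits (take k l).
  elim: l k => [|q l IH] [|k] //.
  by rewrite mulnS /pair_bits /= -!/(pair_bits _) IH.
have hd k l : drop (2 * k) (pair_bits l) = pair_bits (drop k l).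
  elim: l k => [|q l IH] [|k] //.
  by rewrite mulnS /pair_bits /= -!/(pair_bits _) IH.
by rewrite /chunk -mulnA hd ht.
Qed.

Lemma chunks_embed W N x : size x = (4 * W * N)%N ->
  (forall i, (i < N)%N -> exists l, chunk (4 * W) i x = embed l) -> exists L, x = embed L.
Proof.
elim: N x => [|N IH] x; first by rewrite muln0 => /size0nil -> _; exists [::].
move=> hx H; have hs : size (take (4 * W * N) x) = (4 * W * N)%N.
  by rewrite size_take hx; case: ifP => //; rewrite mulnS; lia.
have [i hi|L eL] := IH _ hs.
  have [l hl] := H i (ltnW hi); exists l; rewrite -hl /chunk.
  rewrite !take_drop take_takel //; have : (4 * W * i.+1 <= 4 * W * N)%N by rewrite leq_mul2l hi orbT.
  rewrite mulnS; lia.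
have [l hl] := H N (ltnSn N); exists (L ++ l).
rewrite /embed map_cat flatten_cat -/(embed L) -/(embed l) -eL -hl /chunk [X in _ ++ X]take_oversize ?cat_take_drop //.
by rewrite size_drop hx mulnS; lia.
Qed.

Lemma bsum_chunks w N (h : nat -> seq bool -> algC) :
  bsum (w * N) (fun x => \prod_(0 <= i < N) h i (chunk w i x)) = \prod_(0 <= i < N) bsum w (h i).
Proof.
elim: N h => [|N IH] h; first by rewrite muln0 /= !big_nil.
rewrite mulnS bsum_cat big_nat_recl // -IH -bsumZr; apply: eq_bsum => s hs.
rewrite -bsumZ; apply: eq_bsum => t _; rewrite big_nat_recl //; congr (_ * _).
  by rewrite /chunk muln0 drop0 take_size_cat.
by apply: eq_bigr => i _; rewrite /chunk mulnS drop_cat hs ltnNge leq_addr /= addKn.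
Qed.

Definition circ_expect (d : nat * nat * seq gate) (g : seq bool -> algC) : algC :=
  let: (n, m, gs) := d in
  bsum n (fun x => `|final_amp n gs x| ^+ 2 * g (decode_out (take m x))).

Lemma sblock_valid W n m gs : (n <= W)%N -> all (valid (4 * W)) (sblock W (n, m, gs)).
Proof.
move=> hn; rewrite /sblock /= all_cat; apply/andP; split.
  apply/allP => g /mapP [h]; rewrite mem_filter => /andP [hv _] ->.
  move: hv; rewrite /valid /map_gate /=; case: ifP => _; first by lia.
  by move=> /andP [/andP [h1 h2] h3]; apply/andP; split; [apply/andP; split; lia|lia].
have hxg j : (j < 4 * W)%N -> all (valid (4 * W)) (xgates j) by move=> hj; rewrite /= /valid /= hj.
apply/allP => g /flattenP [s /mapP [p]]; rewrite mem_iota add0n => /andP [_ hp] -> hg.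
have : all (valid (4 * W)) (xgates (4 * p) ++ ((if (p < minn m n)%N then xgates (4 * p + 1) else [::])
    ++ xgates (4 * p + 2))).
  by rewrite !all_cat !hxg //=; try lia; case: ifP => _; rewrite ?hxg //; lia.
by move/allP => /(_ _ hg).
Qed.

Section Copies.
Variables (W N : nat) (D : nat -> circuit).
Hypothesis hD : forall i, (i < N)%N -> ((D i).1.1 <= W)%N.

Let gates := flatten [seq map (map_gate (addn (4 * W * i))) (sblock W (D i)) | i <- iota 0 N].

Lemma copies_amp x : size x = (4 * W * N)%N -> final_amp (4 * W * N) (map to_gate gates) x =
  \prod_(0 <= i < N) final_amp (4 * W) (map to_gate (sblock W (D i))) (chunk (4 * W) i x).
Proof.
move=> hx; rewrite /gates (@blocks_amp _ _ (fun=> (4 * W)%N) (fun i => addn (4 * W * i)) (fun i => sblock W (D i))) //.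
- rewrite !big_nat; apply: eq_bigr => i /andP [_ hi]; congr (final_amp _ _ _).
  have h : (4 * W * i.+1 <= 4 * W * N)%N by rewrite leq_mul2l hi orbT.
  rewrite mulnS in h.
  apply: (@eq_from_nth _ false); rewrite size_mkseq.
    by rewrite /chunk size_takel // size_drop hx; lia.
  by move=> p hp; rewrite nth_mkseq // /chunk nth_take // nth_drop.
- move=> i p hi hp; have h : (4 * W * i.+1 <= 4 * W * N)%N by rewrite leq_mul2l hi orbT.
  by rewrite mulnS in h; lia.
- move=> i j p q hi hj hp hq e.
  have hw : (0 < 4 * W)%N by lia.
  have ei : i = j.
    have := congr1 (divn^~ (4 * W)%N) e.
    by rewrite ![(4 * W * _)%N]mulnC !divnMDl // !divn_small // !addn0.
  by split => //; move: e; rewrite ei => /addnI.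
- move=> k hk; have hw : (0 < 4 * W)%N by case: (4 * W)%N hk => //; rewrite mul0n.
  exists (k %/ (4 * W))%N, (k %% (4 * W))%N; split.
  + by rewrite ltn_divLR // mulnC.
  + by rewrite ltn_mod.
  + by rewrite {1}(divn_eq k (4 * W)) mulnC.
- by move=> i hi; case: (D i) (hD hi) => [[n m] gs] /= h; exact: sblock_valid.
Qed.

(** The amplitude is a product over the chunks. Where it does not vanish, every chunk is an
    embedding and contains no end marker, so decoding the whole string amounts to decoding the
    chunks separately. *)
Lemma copies_expect (g : nat -> seq bool -> algC) :
  circ_expect ((4 * W * N)%N, (4 * W * N)%N, map to_gate gates)
    (fun tau => \prod_(0 <= i < N) g i (sample (chunk (2 * W) i tau)))
  = \prod_(0 <= i < N) circ_expect (to_circ (D i)) (g i).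
Proof.
rewrite /circ_expect.
pose A i z := final_amp (4 * W) (map to_gate (sblock W (D i))) z.
have hA i z : (i < N)%N -> size z = (4 * W)%N -> A i z != 0 -> exists l, z = embed l.
  move=> hi hz; rewrite /A; case: (D i) (hD hi) => [[n m] gs] /= hn.
  rewrite sblock_amp //; case: (z =P _) => [e _|_]; first by exists (block_pairs W n m (get (fun p => 4 * p + 3)%N n z)); rewrite {1}e.
  by rewrite mul0r eqxx.
rewrite (@eq_bsum _ _ (fun x => \prod_(0 <= i < N)
   (fun z => `|A i z| ^+ 2 * g i (sample (decode_out z))) (chunk (4 * W) i x))).
  rewrite (bsum_chunks (4 * W) N (fun i z => `|A i z| ^+ 2 * g i (sample (decode_out z)))) !big_nat; apply: eq_bigr => i /andP [_ hi].
  rewrite /A; case: (D i) (hD hi) => [[n m] gs] /= hn.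
  rewrite (@sblock_bsum W n m gs hn (fun z => g i (sample (decode_out z)))).
  by apply: eq_bsum => y hy; rewrite decode_embed sample_block.
move=> x hx; rewrite copies_amp // -/A take_oversize ?hx //.
rewrite big_split /= normr_prod -prodrXl.
have [h0|hn0] := eqVneq (\prod_(0 <= i < N) `|A i (chunk (4 * W) i x)| ^+ 2) 0; first by rewrite h0 !mul0r.
congr (_ * _).
have [L eL] : exists L, x = embed L.
  apply: (@chunks_embed W N) => // i hi; apply: (@hA i) => //.
    have h : (4 * W * i.+1 <= 4 * W * N)%N by rewrite leq_mul2l hi orbT.
    rewrite mulnS in h; rewrite /chunk size_takel // size_drop hx; lia.
  apply: contra hn0 => /eqP h; rewrite big_mkord prodf_seq_eq0; apply/hasP; exists (Ordinal hi).
    by rewrite mem_index_enum.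
  by rewrite /= h normr0 expr0n.
rewrite !big_nat; apply: eq_bigr => i /andP [_ hi].
by rewrite eL chunk_embed !decode_embed chunk_pairs.
Qed.
End Copies.

(** * Expectations *)

Lemma avg_le T h1 h2 : (forall c, size c = T -> h1 c <= h2 c) -> avg T h1 <= avg T h2.
Proof.
move=> h; rewrite !avgE ler_wpM2r ?invr_ge0 ?exprn_ge0 ?ler0n //.
by apply: ler_sum => c _; apply: h; rewrite size_tuple.
Qed.

Lemma avgD T h1 h2 : avg T (fun c => h1 c + h2 c) = avg T h1 + avg T h2.
Proof. by rewrite !avgE big_split mulrDl. Qed.

Lemma avgZ T a h : avg T (fun c => a * h c) = a * avg T h.
Proof. by rewrite !avgE -mulr_sumr mulrA. Qed.

Lemma avg_cat a b h : avg (a + b) h = avg a (fun s => avg b (fun t => h (s ++ t))).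
Proof. by elim: a h => [|a IH] h //=; rewrite !IH. Qed.

Lemma avg_chunks w N (h : nat -> seq bool -> algC) :
  avg (w * N) (fun x => \prod_(0 <= i < N) h i (chunk w i x)) = \prod_(0 <= i < N) avg w (h i).
Proof.
rewrite avg_bsum bsum_chunks exprM.
rewrite [RHS](eq_bigr (fun i => bsum w (h i) * (2%:R ^- w))); last by move=> i _; rewrite avg_bsum.
by rewrite big_split /= prodr_const_nat subn0 exprVn.
Qed.

Lemma avg_ge0 T h : (forall c, 0 <= h c) -> 0 <= avg T h.
Proof. by move=> hh; rewrite avg_bsum divr_ge0 ?bsum_ge0 // exprn_ge0 ?ler0n. Qed.

Lemma circ_expectD d g1 g2 : circ_expect d (fun t => g1 t + g2 t) = circ_expect d g1 + circ_expect d g2.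
Proof. by case: d => [[n m] gs] /=; rewrite -bsumD; apply: eq_bsum => x _; rewrite mulrDr. Qed.

Lemma circ_expectZ d a g : circ_expect d (fun t => a * g t) = a * circ_expect d g.
Proof. by case: d => [[n m] gs] /=; rewrite -bsumZ; apply: eq_bsum => x _; rewrite mulrCA. Qed.

Lemma circ_expect1 d : circ_expect d (fun=> 1) = 1.
Proof. by case: d => [[n m] gs] /=; rewrite -[RHS](unitary n gs); apply: eq_bsum => x _; rewrite mulr1. Qed.

Lemma circ_expect_le d g1 g2 : (forall t, g1 t <= g2 t) -> circ_expect d g1 <= circ_expect d g2.
Proof.
case: d => [[n m] gs] h /=; rewrite !bsum_tuple; apply: ler_sum => x _.
by rewrite ler_wpM2l // exprn_ge0.
Qed.

Lemma eq_circ_expect d g1 g2 : g1 =1 g2 -> circ_expect d g1 = circ_expect d g2.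
Proof. by case: d => [[n m] gs] h /=; apply: eq_bsum => x _; rewrite h. Qed.

Lemma circprobE d s : circprob d s = circ_expect d (fun t => (t == s)%:R).
Proof.
case: d => [[n m] gs] /=; rewrite bsum_tuple big_mkcond /=; apply: eq_bigr => x _.
by case: eqP => _; rewrite ?mulr1 ?mulr0.
Qed.

(** Expectation over the sampler's output, taken over coins and basis states; unlike [expect] it
    needs no bound on the length of the output. *)
Definition qexp (M : PTM) (k l : nat) (g : seq bool -> algC) : algC :=
  avg (tb k l) (fun c => circ_expect (decode_circ (output M (ones l) c)) g).

Section Qexp.
Variables (M : PTM) (k l : nat).
Local Notation E := (qexp M k l).

Lemma qexpD g1 g2 : E (fun t => g1 t + g2 t) = E g1 + E g2.
Proof. by rewrite /qexp -avgD; apply: eq_avg => c _; rewrite circ_expectD. Qed.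

Lemma qexpZ a g : E (fun t => a * g t) = a * E g.
Proof. by rewrite /qexp -avgZ; apply: eq_avg => c _; rewrite circ_expectZ. Qed.

Lemma qexp1 : E (fun=> 1) = 1.
Proof. by rewrite /qexp -[RHS](avg_const (tb k l)); apply: eq_avg => c _; rewrite circ_expect1. Qed.

Lemma qexp_le g1 g2 : (forall t, g1 t <= g2 t) -> E g1 <= E g2.
Proof. by move=> h; apply: avg_le => c _; exact: circ_expect_le. Qed.

Lemma eq_qexp g1 g2 : g1 =1 g2 -> E g1 = E g2.
Proof. by move=> h; apply: eq_avg => c _; exact: eq_circ_expect. Qed.

Lemma qexp_cst a : E (fun=> a) = a.
Proof. by rewrite (eq_qexp (g2 := fun=> a * 1)) ?qexpZ ?qexp1 ?mulr1 // => t; rewrite mulr1. Qed.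

Lemma qexp_sum I (r : seq I) g : E (fun t => \sum_(i <- r) g i t) = \sum_(i <- r) E (g i).
Proof.
elim: r => [|i r IH].
  by rewrite big_nil -[RHS]qexp_cst; apply: eq_qexp => t; rewrite big_nil.
rewrite big_cons -IH -qexpD; apply: eq_qexp => t; by rewrite big_cons.
Qed.
End Qexp.

Definition lsum (L : nat) (f : seq bool -> algC) : algC :=
  \sum_(j < L.+1) \sum_(t : j.-tuple bool) f t.

Lemma lsumE L f : lsum L f = \sum_(j < L.+1) bsum j f.
Proof. by apply: eq_bigr => j _; rewrite bsum_tuple. Qed.

Lemma lsumD L f g : lsum L (fun s => f s + g s) = lsum L f + lsum L g.
Proof. by rewrite !lsumE -big_split; apply: eq_bigr => j _; rewrite bsumD. Qed.

Lemma lsumZ L a f : lsum L (fun s => a * f s) = a * lsum L f.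
Proof. by rewrite !lsumE mulr_sumr; apply: eq_bigr => j _; rewrite bsumZ. Qed.

Lemma eq_lsum L f g : f =1 g -> lsum L f = lsum L g.
Proof. by move=> e; rewrite !lsumE; apply: eq_bigr => j _; apply: eq_bsum. Qed.

Lemma ler_lsum L f g : (forall s, f s <= g s) -> lsum L f <= lsum L g.
Proof. by move=> h; apply: ler_sum => j _; apply: ler_sum. Qed.

Lemma lsum_bsum L T (h : seq bool -> seq bool -> algC) :
  lsum L (fun s => bsum T (fun c => h c s)) = bsum T (fun c => lsum L (h c)).
Proof.
rewrite lsumE bsum_tuple (eq_bigr (fun c : T.-tuple bool => \sum_(j < L.+1) bsum j (h c))); last first.
  by move=> c _; rewrite lsumE.
rewrite exchange_big; apply: eq_bigr => j _.
by rewrite bsum_exchange bsum_tuple.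
Qed.

Lemma lsum_avg L T (h : seq bool -> seq bool -> algC) :
  lsum L (fun s => avg T (fun c => h c s)) = avg T (fun c => lsum L (h c)).
Proof.
rewrite avg_bsum -lsum_bsum mulrC -lsumZ; apply: eq_lsum => s.
by rewrite avg_bsum mulrC.
Qed.

Lemma lsum_pick L u g : (size u <= L)%N -> lsum L (fun s => (u == s)%:R * g s) = g u.
Proof.
move=> hu; rewrite lsumE (bigD1 (Ordinal (hu : (size u < L.+1)%N))) //=.
rewrite (@eq_bsum _ _ (fun s => (s == u)%:R * g u)); last first.
  by move=> s _; rewrite eq_sym; case: eqP => [->|_] //; rewrite !mul0r.
rewrite bsumZr bsum_eq // mul1r big1 ?addr0 // => j hj.
rewrite bsum_tuple big1 // => c _; case: eqP => [e|_]; last by rewrite mul0r.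
by case/eqP: hj; apply: val_inj; rewrite /= e size_tuple.
Qed.

Lemma size_output M w c : (size (output M w c) <= size c + size w)%N.
Proof.
have h t : (size (bits_prefix t) <= size t)%N by elim: t => //= -[].
by apply: leq_trans (h _) _; rewrite size_map size_iota.
Qed.

Lemma size_decode_out s : (size (decode_out s) <= size s)%N.
Proof.
have H n : forall u, (size u <= n)%N -> (size (decode_out u) <= size u)%N.
  elim: n => [|n IH] [|[] [|b u]] //= h; have := IH u; lia.
exact: H (leqnn _).
Qed.

Lemma decode_circ_width s : ((decode_circ s).1.1 <= size s)%N.
Proof. by rewrite -decodeE /=; exact: unary_len_le. Qed.

Lemma lsum_circprob L d g : (d.1.1 <= L)%N -> lsum L (fun s => circprob d s * g s) = circ_expect d g.
Proof.
move=> hL; rewrite (@eq_lsum _ _ (fun s => circ_expect d (fun t => (t == s)%:R * g s))); last first.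
  by move=> s; rewrite circprobE mulrC -circ_expectZ; apply: eq_circ_expect => t; rewrite mulrC.
case: d hL => [[n m] gs] /= hL; rewrite lsum_bsum; apply: eq_bsum => x hx.
rewrite lsumZ lsum_pick //; apply: leq_trans (size_decode_out _) _.
by apply: leq_trans hL; rewrite -hx size_take; case: ifP => //; lia.
Qed.

Lemma expect_qpt L M k l g : (tb k l + l <= L)%N -> expect L (qpt_dist M k l) g = qexp M k l g.
Proof.
move=> hL; rewrite -[LHS]/(lsum L (fun s => qpt_dist M k l s * g s)).
rewrite (@eq_lsum _ _ (fun s => avg (tb k l) (fun c => circprob (decode_circ (output M (ones l) c)) s * g s))); last first.
  by move=> s; rewrite qpt_dist_avg mulrC -avgZ; apply: eq_avg => c _; rewrite mulrC.
rewrite lsum_avg; apply: eq_avg => c hc; apply: lsum_circprob.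
apply: leq_trans (decode_circ_width _) _; apply: leq_trans (size_output _ _ _) _.
by rewrite hc size_nseq.
Qed.

Lemma expect_ppt L M k l g : (tb k l + l <= L)%N ->
  expect L (ppt_dist M k l) g = avg (tb k l) (fun c => g (output M (ones l) c)).
Proof.
move=> hL; rewrite -[LHS]/(lsum L (fun s => ppt_dist M k l s * g s)).
rewrite (@eq_lsum _ _ (fun s => avg (tb k l) (fun c => (output M (ones l) c == s)%:R * g s))); last first.
  by move=> s; rewrite /ppt_dist outprob_avg mulrC -avgZ; apply: eq_avg => c _; rewrite mulrC.
rewrite lsum_avg; apply: eq_avg => c hc; rewrite lsum_pick //.
by apply: leq_trans (size_output _ _ _) _; rewrite hc size_nseq.
Qed.

Lemma qpt_dist_ge0 M k l s : 0 <= qpt_dist M k l s.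
Proof.
rewrite qpt_dist_avg; apply: avg_ge0 => c; rewrite circprobE.
case: (decode_circ _) => [[n m] gs] /=; apply: bsum_ge0 => x.
by rewrite mulr_ge0 ?exprn_ge0 ?ler0n.
Qed.

Lemma ppt_dist_ge0 M k l s : 0 <= ppt_dist M k l s.
Proof. by rewrite /ppt_dist outprob_avg; apply: avg_ge0 => c; rewrite ler0n. Qed.

(** * Choosing a sample, and the statistics of independent samples *)

Lemma sel_cons b c n s : sel (b :: c) (n + n) s = sel c n (if b then drop n s else take n s).
Proof.
rewrite /sel /= /sel_step /= addnn doubleK -addnn; case: b; first by rewrite take_drop.
by rewrite take_takel ?leq_addr // take_takel.
Qed.

Lemma sel_bsum w q s (h : seq bool -> algC) :
  bsum q (fun c => h (sel c (w * 2 ^ q) s)) = \sum_(0 <= j < 2 ^ q) h (chunk w j s).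
Proof.
elim: q s => [|q IH] s.
  by rewrite expn0 big_nat1 /= /sel /= /chunk muln0 drop0 muln1.
have e : (w * 2 ^ q.+1 = w * 2 ^ q + w * 2 ^ q)%N by rewrite expnS mulnCA mul2n addnn.
have e1 b : bsum q (fun c => h (sel (b :: c) (w * 2 ^ q.+1) s)) =
   bsum q (fun c => h (sel c (w * 2 ^ q) (if b then drop (w * 2 ^ q) s else take (w * 2 ^ q) s))).
  by apply: eq_bsum => c _; rewrite e sel_cons.
rewrite [LHS]/= !e1 !IH expnS mul2n -addnn [RHS](@big_cat_nat _ _ _ (2 ^ q)) ?leq_addr //=; congr (_ + _).
  rewrite !big_nat; apply: eq_bigr => j /andP [_ hj]; rewrite /chunk; congr h.
  have hw : (w * j.+1 <= w * 2 ^ q)%N by rewrite leq_mul2l hj orbT.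
  by rewrite !take_drop take_takel //; rewrite mulnS in hw.
have := big_addn 0 (2 ^ q + 2 ^ q) (2 ^ q) xpredT (fun j => h (chunk w j s)).
rewrite add0n addnK => ->; apply: eq_bigr => j _; congr h.
by rewrite /chunk drop_drop mulnDr.
Qed.

Section Copy.
Variables (A P : PTM) (kA kP N l : nat).
Local Notation W := (width kA l).
Hypothesis hP : forall g : seq bool -> algC,
  avg (tb kP l) (fun c => g (output P (ones l) c)) =
  avg (tb kA l * N) (fun r => g (encode (copies_circ (table A) kA N l r))).

(** Independence of the samples: each copy has its own chunk of generator coins and its own
    qubits. *)
Lemma qexp_prod (g : nat -> seq bool -> algC) :
  qexp P kP l (fun tau => \prod_(0 <= i < N) g i (sample (chunk (2 * W) i tau)))
  = \prod_(0 <= i < N) qexp A kA l (g i).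
Proof.
rewrite /qexp (hP (fun o => circ_expect (decode_circ o) _)).
rewrite -(avg_chunks _ _ (fun i c => circ_expect (decode_circ (output A (ones l) c)) (g i))).
apply: eq_avg => r hr; rewrite decode_encode.
have hc i : circ_at (table A) kA l r i = decode (output A (ones l) (chunk (tb kA l) i r)).
  by rewrite /circ_at -[table A]cats0 universalE /chunk mulnC.
transitivity (\prod_(0 <= i < N) circ_expect (to_circ (circ_at (table A) kA l r i)) (g i)).
  apply: copies_expect => i hi; rewrite hc /=; apply: leq_trans (unary_len_le _) _.
  apply: leq_trans (size_output _ _ _) _; rewrite size_nseq leq_add2r /chunk size_take.
  by case: ifP => // /negbT; rewrite -leqNgt.
by apply: eq_bigr => i _; rewrite hc decodeE.
Qed.

Definition average (f : seq bool -> algC) (tau : seq bool) : algC :=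
  (\sum_(0 <= i < N) f (sample (chunk (2 * W) i tau))) / N%:R.

(** Covariances of distinct samples vanish by independence, so only the [N] diagonal terms remain,
    each at most 1, against the factor [N ^ 2] in the denominator. *)
Lemma qexp_variance (f : seq bool -> algC) : (0 < N)%N ->
  (forall s, f s \in Num.real) -> (forall s, (f s - qexp A kA l f) ^+ 2 <= 1) ->
  qexp P kP l (fun tau => (average f tau - qexp A kA l f) ^+ 2) <= N%:R^-1.
Proof.
move=> hN hr h1; set a := qexp A kA l f.
pose Y i tau := f (sample (chunk (2 * W) i tau)) - a.
have hN0 : N%:R != 0 :> algC by rewrite pnatr_eq0 -lt0n.
have eZ tau : (average f tau - a) ^+ 2 =
    N%:R ^- 2 * \sum_(0 <= i < N) \sum_(0 <= j < N) Y i tau * Y j tau.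
  have -> : average f tau - a = (\sum_(0 <= i < N) Y i tau) / N%:R.
    rewrite /Y sumrB /average mulrBl; congr (_ - _).
    by rewrite sumr_const_nat subn0 -[a *+ N]mulr_natr mulfK.
  rewrite expr_div_n mulrC; congr (_ * _); rewrite expr2 mulr_suml.
  by apply: eq_bigr => i _; rewrite mulr_sumr.
rewrite (@eq_qexp _ _ _ _ (fun tau => N%:R ^- 2 * \sum_(0 <= i < N) \sum_(0 <= j < N) Y i tau * Y j tau)) //.
rewrite qexpZ qexp_sum.
have E0 : qexp A kA l (fun s => f s - a) = 0.
  by rewrite qexpD qexp_cst subrr.
(* Functions of one or two samples are written as products over all copies with factors 1 elsewhere,
   the form to which [qexp_prod] applies. *)
have hprod (F : nat -> seq bool -> algC) i : (i < N)%N -> (forall j, j != i -> F j = fun=> 1) ->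
    qexp P kP l (fun tau => \prod_(0 <= k < N) F k (sample (chunk (2 * W) k tau))) = qexp A kA l (F i).
  move=> hi hF; rewrite qexp_prod big_mkord (bigD1 (Ordinal hi)) //= big1 ?mulr1 // => j hj.
  rewrite hF ?qexp1 //.
have hii i : (i < N)%N -> \sum_(0 <= j < N) qexp P kP l (fun tau => Y i tau * Y j tau) <= 1.
  move=> hi; rewrite big_mkord (bigD1 (Ordinal hi)) //= big1 ?addr0.
    have -> : qexp P kP l (fun tau => Y i tau * Y i tau) = qexp A kA l (fun s => (f s - a) ^+ 2).
      transitivity (qexp P kP l (fun tau => \prod_(0 <= k < N)
         (fun k s => if k == i then (f s - a) ^+ 2 else 1) k (sample (chunk (2 * W) k tau)))).
        apply: eq_qexp => tau; rewrite big_mkord (bigD1 (Ordinal hi)) //= eqxx big1 ?mulr1 //.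
        by move=> j hj; rewrite (negbTE (_ : (j : nat) != i)).
      rewrite (hprod (fun k s => if k == i then (f s - a) ^+ 2 else 1) i) //.
        by rewrite eqxx.
      by move=> j hj; rewrite (negbTE hj).
    by rewrite -[X in _ <= X](qexp1 A kA l); apply: qexp_le => s; exact: h1.
  move=> j hj; have hji : (j : nat) != i by [].
  rewrite (@eq_qexp _ _ _ _ (fun tau => \prod_(0 <= k < N)
     (fun k s => if (k == i) || (k == j :> nat) then f s - a else 1) k (sample (chunk (2 * W) k tau)))); last first.
    move=> tau; rewrite big_mkord (bigD1 (Ordinal hi)) //= eqxx (bigD1 j) //= eqxx orbT big1 ?mulr1 //.
    move=> k /andP [hk1 hk2].
    by rewrite (negbTE (_ : (k : nat) != i)) // (negbTE (_ : (k : nat) != j)).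
  rewrite (qexp_prod (fun k s => if (k == i) || (k == j :> nat) then f s - a else 1)).
  rewrite big_mkord (bigD1 (Ordinal hi)) //= eqxx /= E0 mul0r //.
have hi2 : \sum_(0 <= i < N) qexp P kP l (fun tau => \sum_(0 <= j < N) Y i tau * Y j tau) <= N%:R.
  have -> : N%:R = \sum_(0 <= i < N) 1 :> algC by rewrite sumr_const_nat subn0.
  rewrite !big_mkord; apply: ler_sum => i _.
  by rewrite qexp_sum; exact: hii.
have hp : 0 < N%:R :> algC by rewrite ltr0n.
rewrite -exprVn expr2 -mulrA ler_piMr ?invr_ge0 ?ler0n //.
by rewrite mulrC ler_pdivrMr // mul1r.
Qed.
End Copy.

(** * Soundness *)

Lemma vacc_ge0 V tV l t : 0 <= vacc V tV l t.
Proof. by rewrite /vacc /accprob divr_ge0 ?exprn_ge0 ?ler0n. Qed.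

Lemma vacc_le1 V tV l t : vacc V tV l t <= 1.
Proof.
rewrite /vacc /accprob ler_pdivrMr ?exprn_gt0 ?ltr0n // mul1r -natrX ler_nat.
by apply: leq_trans (max_card _) _; rewrite card_tuple card_bool.
Qed.

Lemma sdE L P Q : sd L P Q = 2%:R^-1 * lsum L (fun s => `|P s - Q s|).
Proof. by []. Qed.

Lemma expectE L P f : expect L P f = lsum L (fun s => P s * f s).
Proof. by []. Qed.

(** The test is bounded termwise by the absolute difference, and the sum of these is twice [sd]. *)
Lemma expect_gap_sd L P Q v : (forall s, 0 <= P s) -> (forall s, 0 <= Q s) ->
  (forall s, 0 <= v s <= 1) -> expect L P v - expect L Q v <= 2%:R * sd L P Q.
Proof.
move=> hP hQ hv; rewrite sdE mulrA mulfV ?pnatr_eq0 // mul1r.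
rewrite !expectE -[X in _ + X]mulN1r -lsumZ -lsumD; apply: ler_lsum => s.
have /andP [v0 v1] := hv s.
have r : P s - Q s \is Num.real by rewrite rpredB ?ger0_real.
apply: le_trans (_ : v s * `|P s - Q s| <= _); last by rewrite ler_piMl.
rewrite mulN1r -mulrBl mulrC ler_wpM2l //; exact: real_ler_norm.
Qed.

Lemma pvalZ (n : nat) p l : pval (n%:R *: p) l = n%:R * pval p l.
Proof. by rewrite /pval hornerZ rmorphM /= ratr_nat. Qed.

Lemma IVPoQ_QAS : IVPoQ_exist -> QAS_exist.
Proof.
move=> [P [kP [hP [V [tV [hV [c [s [[p [l1 hp]] [[l2 hc] hs]]]]]]]]]].
(* The gap is at most twice the distance; the factor 3 in place of 2 makes the inequality strict. *)
exists P, kP; split=> //; exists (3%:R *: p) => B kB hB.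
have [l3 h3] := hs B kB hB; exists (maxn l1 (maxn l2 l3)) => l.
rewrite !geq_max => /and3P [g1 g2 g3].
have [p0 p1] := hp l g1; rewrite pvalZ; split; first by rewrite mulr_gt0 ?ltr0n.
set d := sd _ _ _.
have h2 : (pval p l)^-1 <= 2%:R * d.
  apply: le_trans (expect_gap_sd _ (qpt_dist_ge0 _ _ _) (ppt_dist_ge0 _ _ _) (_ : forall s, 0 <= vacc V tV l s <= 1)).
    apply: le_trans p1 _; apply: lerB.
      apply: le_trans (hc l g2) _; rewrite !expect_qpt //; lia.
    apply: le_trans (h3 l g3); rewrite !expect_ppt //; lia.
  by move=> t; rewrite vacc_ge0 vacc_le1.
have hp0 : 0 < (pval p l)^-1 by rewrite invr_gt0.
rewrite invfM -(ltr_pM2l (_ : 0 < 3%:R :> algC)) ?ltr0n // mulrA mulfV ?pnatr_eq0 // mul1r.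
have d0 : 0 < d by have := lt_le_trans hp0 h2; rewrite pmulr_rgt0 ?ltr0n.
apply: le_lt_trans h2 _; rewrite ltr_pM2r ?ltr_nat //.
Qed.

(** The inequality x <= 1 + x^2 at x = D z. It bounds a first moment by a second moment pointwise,
    which replaces an appeal to Cauchy-Schwarz. *)
Lemma ler_trick (z D : algC) : 0 < D -> z \is Num.real -> z <= D^-1 + D * z ^+ 2.
Proof.
move=> hD hz; have hDn : D != 0 by rewrite gt_eqF.
rewrite -(ler_pM2l hD) mulrDr mulfV // mulrA -expr2 -exprMn.
have hr : D * z \is Num.real by rewrite rpredM // gtr0_real.
have h : 0 <= (D * z - 2%:R^-1) ^+ 2.
  by rewrite real_exprn_even_ge0 // rpredB // realV realn.
rewrite -[X in is_true X]subr_ge0.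
have -> : 1 + (D * z) ^+ 2 - D * z = (D * z - 2%:R^-1) ^+ 2 + (1 - 2%:R^-1 ^+ 2) by field.
by rewrite addr_ge0 // subr_ge0 exprn_ile1 ?invr_ge0 ?ler0n // invf_le1 ?ltr0n // ler1n.
Qed.

Section Soundness.
Variables (A P B B' : PTM) (kA kP kB kB' q l C D : nat) (acc : seq bool -> bool).
Local Notation N := (2 ^ q)%N.
Local Notation W := (width kA l).
Hypothesis hP : forall g : seq bool -> algC,
  avg (tb kP l) (fun c => g (output P (ones l) c)) =
  avg (tb kA l * N) (fun r => g (encode (copies_circ (table A) kA N l r))).
Hypothesis hB' : forall g : seq bool -> algC,
  avg (tb kB' l) (fun c => g (output B' (ones l) c)) =
  avg (tb kB l + q) (fun r => g (sample (sel (drop (tb kB l) r) (2 * W * N)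
                                   (output B (ones l) (take (tb kB l) r))))).
Hypothesis D_gt0 : (0 < D)%N.
Hypothesis N_ge : (C * D ^ 3 <= N)%N.
Hypothesis acc_dom : forall t, acc t -> ppt_dist B kB l t <= C%:R * D%:R * qpt_dist P kP l t.
Local Notation EB h := (avg (tb kB l) (fun c => h (output B (ones l) c))).

(** Change of measure: it carries the variance bound of the honest prover over to the accepted
    outputs of [B]. *)
Lemma acc_expect (h : seq bool -> algC) : (forall t, 0 <= h t) ->
  EB (fun t => (acc t)%:R * h t) <= C%:R * D%:R * qexp P kP l h.
Proof.
move=> h0; pose L := (tb kP l + tb kB l + l)%N.
rewrite -(@expect_ppt L _ _ _ (fun t => (acc t)%:R * h t)); last by rewrite /L; lia.
rewrite -(@expect_qpt L); last by rewrite /L; lia.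
rewrite !expectE -lsumZ; apply: ler_lsum => t; case e : (acc t).
  by rewrite mul1r mulrA ler_wpM2r // acc_dom.
rewrite mul0r mulr0; have d0 : 0 <= C%:R * D%:R :> algC by rewrite -natrM ler0n.
by apply: mulr_ge0 => //; apply: mulr_ge0 => //; apply: qpt_dist_ge0.
Qed.

Lemma expect_averaged (f : seq bool -> algC) :
  avg (tb kB' l) (fun c => f (output B' (ones l) c)) = EB (average kA N l f).
Proof.
rewrite hB' avg_cat; apply: eq_avg => c hc.
rewrite /average -(sel_bsum (2 * W) q _ (fun s => f (sample s))) avg_bsum natrX; congr (_ / _).
by apply: eq_bsum => e he; rewrite -hc take_size_cat // drop_size_cat.
Qed.

(** The distance is the mean, under [B], of the deviation [Z] of an empirical frequency from its
    value under [A]. Accepted outputs contribute at most 1/D by [ler_trick] and 1/D by the variance;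
    rejected ones have probability at most 2/D, and there [Z] is at most 1. *)
Lemma sampler_close : 1 - 2%:R / D%:R <= EB (fun t => (acc t)%:R) ->
  sd (tb kA l + tb kB' l + l) (qpt_dist A kA l) (ppt_dist B' kB' l) <= 4%:R / D%:R.
Proof.
move=> hacc; set L := (_ + _ + l)%N.
(* The optimal test, for which the gap of expectations equals the statistical distance. *)
pose f s : algC := (qpt_dist A kA l s < ppt_dist B' kB' l s)%R%:R.
have hD : 0 < D%:R :> algC by rewrite ltr0n.
have hDn : D%:R != 0 :> algC by rewrite gt_eqF.
have f01 s : 0 <= f s <= 1 by rewrite ler0n lern1 leq_b1.
pose a := qexp A kA l f.
have a01 : 0 <= a <= 1.
  rewrite -(qexp_cst A kA l 0) -(qexp1 A kA l).
  by apply/andP; split; apply: qexp_le => s; case/andP: (f01 s).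
pose Z t := average kA N l f t - a.
have N0 : (0 < N)%N by rewrite expn_gt0.
have Nn : N%:R != 0 :> algC by rewrite pnatr_eq0 -lt0n.
have av01 t : 0 <= average kA N l f t <= 1.
  rewrite /average; apply/andP; split.
    by rewrite divr_ge0 ?ler0n // sumr_ge0 // => i _; case/andP: (f01 (sample (chunk (2 * W) i t))).
  rewrite ler_pdivrMr ?ltr0n // mul1r.
  apply: le_trans (_ : \sum_(0 <= i < N) 1 <= _); last by rewrite sumr_const_nat subn0.
  by apply: ler_sum => i _; case/andP: (f01 (sample (chunk (2 * W) i t))).
have diff1 x y : 0 <= x <= 1 -> 0 <= y <= 1 -> x - y \is Num.real /\ x - y <= 1 :> algC.
  move=> /andP [x0 x1] /andP [y0 y1]; split; first by rewrite rpredB ?ger0_real.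
  by rewrite lerBlDr (le_trans x1) // lerDl.
have Zr t : Z t \is Num.real by case: (diff1 _ _ (av01 t) a01).
have Z1 t : Z t <= 1 by case: (diff1 _ _ (av01 t) a01).
have sdZ : sd L (qpt_dist A kA l) (ppt_dist B' kB' l) = EB Z.
  have -> : EB Z = expect L (ppt_dist B' kB' l) f - expect L (qpt_dist A kA l) f.
    rewrite expect_ppt ?expect_qpt /L; try lia.
    by rewrite expect_averaged /Z avgD avg_const.
  have e1 : expect L (ppt_dist B' kB' l) (fun=> 1) - expect L (qpt_dist A kA l) (fun=> 1) = 0.
    by rewrite expect_ppt ?expect_qpt /L; try lia; rewrite avg_const qexp1 subrr.
  rewrite sdE; have h2 : 2%:R != 0 :> algC by rewrite pnatr_eq0.
  (* Absolute value through the sign indicator [f]. The second summand adds up to 0 because both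
     distributions have mass 1. *)
  have pw s : `|qpt_dist A kA l s - ppt_dist B' kB' l s| =
      2%:R * (ppt_dist B' kB' l s * f s + -1 * (qpt_dist A kA l s * f s))
      + -1 * (ppt_dist B' kB' l s * 1 + -1 * (qpt_dist A kA l s * 1)).
    rewrite /f; have r0 := ger0_real (qpt_dist_ge0 A kA l s).
    have r1 := ger0_real (ppt_dist_ge0 B' kB' l s).
    case: (real_ltP r0 r1) => hlt /=; ring.
  apply: (mulfI h2); rewrite mulrA mulfV // mul1r (@eq_lsum L _ _ pw).
  rewrite !(lsumD, lsumZ) -!expectE !mulN1r e1 subr0 //.
rewrite sdZ.
have step1 : EB Z <= EB (fun t => D%:R^-1 + (D%:R * ((acc t)%:R * Z t ^+ 2) + (1 - (acc t)%:R))).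
  apply: avg_le => c _; set t := output _ _ _; case: (acc t).
    by rewrite subrr addr0 mul1r ler_trick.
  rewrite mul0r mulr0 add0r subr0; apply: le_trans (Z1 t) _.
  by rewrite lerDr invr_ge0 ler0n.
apply: le_trans step1 _; rewrite !avgD !avg_const avgZ.
(* The bound D * (C * D / N) <= 1/D is the assumption [N_ge], whence the exponent 3. *)
have h1 : D%:R * EB (fun t => (acc t)%:R * Z t ^+ 2) <= D%:R^-1.
  have Z2 t : 0 <= Z t ^+ 2 by rewrite real_exprn_even_ge0.
  have v : qexp P kP l (fun t => Z t ^+ 2) <= N%:R^-1.
    apply: (qexp_variance hP) => // [s|s]; first by rewrite realn.
    have [r1 l1] := diff1 _ _ (f01 s) a01; have [r2 l2] := diff1 _ _ a01 (f01 s).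
    rewrite -real_normK // exprn_ile1 // real_ler_norml // l1 andbT.
    by rewrite lerNl opprB.
  apply: le_trans (_ : D%:R * (C%:R * D%:R * N%:R^-1) <= _).
    rewrite ler_wpM2l ?ler0n //; apply: le_trans (acc_expect Z2) _.
    by rewrite ler_wpM2l // mulr_ge0 ?ler0n.
  rewrite !mulrA ler_pdivrMr ?ltr0n // [X in _ <= X]mulrC ler_pdivlMr // -!natrM ler_nat.
  by apply: leq_trans N_ge; rewrite !expnS; lia.
have h3 : avg (tb kB l) (fun c => - (acc (output B (ones l) c))%:R) <= 2%:R / D%:R - 1.
  have -> : avg (tb kB l) (fun c => - (acc (output B (ones l) c))%:R) = - EB (fun t => (acc t)%:R).
    by rewrite -mulN1r -avgZ; apply: eq_avg => c _; rewrite mulN1r.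
  by rewrite lerNl opprB.
apply: le_trans (_ : D%:R^-1 + (D%:R^-1 + (1 + (2%:R / D%:R - 1))) <= _).
  by rewrite !lerD.
have -> : 4%:R / D%:R = D%:R^-1 + (D%:R^-1 + (1 + (2%:R / D%:R - 1))) :> algC by field.
by [].
Qed.
End Soundness.

(** * Sums over paths *)

Definition allbits (n : nat) : seq (seq bool) :=
  iter n (fun L => [seq false :: s | s <- L] ++ [seq true :: s | s <- L]) [:: [::]].

Lemma sum_allbits n (f : seq bool -> algC) : \sum_(s <- allbits n) f s = bsum n f.
Proof.
elim: n f => [|n IH] f; first by rewrite big_seq1.
by rewrite /allbits iterS big_cat !big_map -/(allbits n) !IH.
Qed.

(** [set_nth] expressed through operations already known to be computable. *)
Definition setb (x : seq bool) (i : nat) (b : bool) : seq bool :=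
  take i x ++ (nseq (i - size x) false ++ b :: drop i.+1 x).

Lemma setbE x i b : setb x i b = set_nth false x i b.
Proof.
elim: x i => [|a x IH] [|i]; rewrite /setb /=.
- by [].
- by rewrite ?subn0; elim: i => //= i [->].
- by rewrite drop0.
- by rewrite subSS -IH.
Qed.

(* A path ending in the basis state p.1 with phase omega8 ^ p.2, traced backwards through
   a gate; the factors 1 / sqrt 2 of the Hadamard gates are counted by hcount. *)
Definition branch (n : nat) (g : ggate) (p : seq bool * nat) : seq (seq bool * nat) :=
  if valid n g then
    if g.1 == 0%N then [:: (setb p.1 g.2.1 false, p.2);
      (setb p.1 g.2.1 true, if nth false p.1 g.2.1 then (p.2 + 4)%N else p.2)]
    else if g.1 == 1%N then [:: (p.1, if nth false p.1 g.2.1 then p.2.+1 else p.2)]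
    else [:: (setb p.1 g.2.2 (~~ (nth false p.1 g.2.2 == nth false p.1 g.2.1)), p.2)]
  else [:: p].

Definition hcount (n : nat) (gs : seq ggate) : nat := size [seq g <- gs | valid n g && (g.1 == 0%N)].

Definition paths (n : nat) (gs : seq ggate) (x : seq bool) : seq (seq bool * nat) :=
  foldl (fun L g => flatten [seq branch n g p | p <- L]) [:: (x, 0%N)] (rev gs).

Lemma sum_branch n g p (f : seq bool -> algC) :
  \sum_(q <- branch n g p) omega8 ^+ q.2 * f q.1 =
  sqrtC 2%:R ^+ (valid n g && (g.1 == 0%N)) * (omega8 ^+ p.2 * apply_gate n (to_gate g) f p.1).
Proof.
case: p => x e; rewrite /branch; case: ifP => hv; last first.
  by rewrite big_seq1 invalid_gate ?hv // expr0 mul1r.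
move: hv; rewrite /valid /to_gate; case: g => [[|[|k]] [c t]] /= hv.
- rewrite big_cons big_seq1 /= hv !setbE expr1 mulrCA [sqrtC _ * _]mulrC divfK ?sqrt2_neq0 // mulrDr.
  by case: nth; rewrite ?mul1r // exprD omega8_4; congr (_ + _); ring.
- rewrite big_seq1 /= hv expr0 mul1r; case: nth; rewrite ?mul1r // exprSr; ring.
- rewrite big_seq1 /= andbA hv setbE expr0 mul1r; congr (_ * f (set_nth _ _ _ _)).
  by case: nth; case: nth.
Qed.

Lemma sum_flatten I J (F : I -> algC) (G : J -> seq I) (s : seq J) :
  \sum_(i <- flatten [seq G j | j <- s]) F i = \sum_(j <- s) \sum_(i <- G j) F i.
Proof. by elim: s => [|j s IH]; rewrite ?big_nil // big_cons /= big_cat IH. Qed.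

Lemma sum_paths n gs x (f : seq bool -> algC) :
  \sum_(q <- paths n gs x) omega8 ^+ q.2 * f q.1 =
  sqrtC 2%:R ^+ hcount n gs * foldl (fun f g => apply_gate n g f) f (map to_gate gs) x.
Proof.
elim: gs f => [|g gs IH] f; first by rewrite /paths big_seq1 /hcount /= !mul1r.
rewrite /paths rev_cons foldl_rcons -/(paths n gs x).
rewrite (sum_flatten (fun q : seq bool * nat => omega8 ^+ q.2 * f q.1)).
rewrite (eq_bigr (fun p => sqrtC 2%:R ^+ (valid n g && (g.1 == 0%N)) *
   (omega8 ^+ p.2 * apply_gate n (to_gate g) f p.1))); last by move=> p _; exact: sum_branch.
rewrite -mulr_sumr IH mulrA -exprD; congr (_ ^+ _ * _) => //.
by rewrite /hcount /=; case: (_ && _).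
Qed.

(** Only paths that arrive at the all-zero initial state contribute to an amplitude; recording
    exponents of [omega8] keeps the data integral. *)
Definition phases (n : nat) (gs : seq ggate) (x : seq bool) : seq nat :=
  [seq q.2 | q <- [seq q <- paths n gs x | q.1 == nseq n false]].

Lemma sum_phases n gs x : \sum_(e <- phases n gs x) omega8 ^+ e =
  sqrtC 2%:R ^+ hcount n gs * final_amp n (map to_gate gs) x.
Proof.
rewrite /final_amp -sum_paths big_map big_filter big_mkcond; apply: eq_bigr => q _.
by case: eqP => _; rewrite ?mulr1 ?mulr0.
Qed.

Lemma omega8_8 : omega8 ^+ 8 = 1.
Proof. by rewrite -[8%N]/(4 * 2)%N exprM omega8_4 sqrrN expr1n. Qed.

Lemma conj_omega8_pow : omega8^* = omega8 ^+ 7.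
Proof.
have h : omega8 * omega8^* = 1 by rewrite -normCK norm_omega8 expr1n.
by rewrite -[LHS]mul1r -omega8_8 exprSr -mulrA h mulr1.
Qed.

(** The conjugate of [omega8] is its seventh power, so a squared modulus is again a sum over a list
    of exponents. *)
Definition norm_phases (s : seq nat) : seq nat := flatten [seq [seq (e + 7 * f)%N | f <- s] | e <- s].

Lemma sum_norm_phases s : \sum_(e <- norm_phases s) omega8 ^+ e = `|\sum_(e <- s) omega8 ^+ e| ^+ 2.
Proof.
rewrite normCK sum_flatten mulr_suml; apply: eq_bigr => e _.
rewrite big_map rmorph_sum /= mulr_sumr; apply: eq_bigr => f _.
by rewrite exprD exprM rmorphXn /= conj_omega8_pow.
Qed.

Definition circ_phases (d : circuit) (tau : seq bool) : seq nat :=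
  flatten [seq norm_phases (phases d.1.1 d.2 x) |
    x <- [seq x <- allbits d.1.1 | out_bits (take d.1.2 x) == tau]].

Lemma sum_circ_phases d tau : \sum_(e <- circ_phases d tau) omega8 ^+ e =
  2%:R ^+ hcount d.1.1 d.2 * circprob (to_circ d) tau.
Proof.
case: d => [[n m] gs]; rewrite sum_flatten big_filter big_mkcond sum_allbits circprobE /= -bsumZ.
apply: eq_bsum => x _; rewrite out_bitsE; case: eqP => _; last by rewrite !mulr0.
rewrite sum_norm_phases sum_phases normrM exprMn mulr1; congr (_ * _).
by rewrite normrX -exprM mulnC exprM ger0_norm ?sqrtC_ge0 ?ler0n // sqrtCK.
Qed.

Definition mod8 (e : nat) : nat := iter e (fun k => if k == 7%N then 0%N else k.+1) 0%N.

Lemma mod8E e : mod8 e = (e %% 8)%N.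
Proof.
elim: e => //= e ->; rewrite -[e.+1]addn1 -modnDml; have := ltn_pmod e (isT : 0 < 8)%N.
by move: (e %% 8)%N => r; do 8?[case: r => [|r]].
Qed.

Definition count8 (j : nat) (s : seq nat) : nat := size [seq e <- s | mod8 e == j].

(** Twice the real part of a power: the exponents 0 and 4 give 2 and -2, the odd ones plus or minus
    sqrt 2, while 2 and 6 give 0. *)
Lemma omega8_pow_real e : omega8 ^+ e + (omega8 ^+ e)^* =
  2%:R * ((mod8 e == 0)%N%:R - (mod8 e == 4)%N%:R)
  + sqrtC 2%:R * ((mod8 e == 1)%N%:R + (mod8 e == 7)%N%:R - ((mod8 e == 3)%N%:R + (mod8 e == 5)%N%:R)).
Proof.
rewrite mod8E {1 2}(divn_eq e 8) exprD mulnC exprM omega8_8 expr1n mul1r.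
rewrite rmorphXn /= conj_omega8_pow.
have h1 : omega8 + omega8 ^+ 7 = sqrtC 2%:R.
  rewrite -conj_omega8_pow conj_omega8 /omega8 -mulrDl addrACA subrr addr0.
  by apply: (mulIf sqrt2_neq0); rewrite divfK ?sqrt2_neq0 // sqrt2K.
have h2 : omega8 ^+ 2 + (omega8 ^+ 7) ^+ 2 = 0.
  by rewrite -exprM -[(7 * 2)%N]/(8 + (2 + 4))%N exprD omega8_8 exprD omega8_4; ring.
have h4 := omega8_4.
have : (e %% 8 < 8)%N by rewrite ltn_pmod.
move: (e %% 8)%N => r; do 8?[case: r => [|r]] => //= _; rewrite ?expr0 ?expr1.
- ring.
- by rewrite h1; ring.
- by rewrite h2; ring.
- have e3 : omega8 ^+ 3 = omega8 ^+ 4 * omega8 ^+ 7.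
    by rewrite -exprD -[(4 + 7)%N]/(3 + 8)%N exprD omega8_8 mulr1.
  transitivity (omega8 ^+ 4 * (omega8 ^+ 7 + omega8 * (omega8 ^+ 8) ^+ 2)); first by rewrite e3; ring.
  by rewrite omega8_8 h4 expr1n mulr1 addrC h1; ring.
- transitivity (omega8 ^+ 4 * (1 + (omega8 ^+ 8) ^+ 3)); first by ring.
  by rewrite omega8_8 h4; ring.
- transitivity (omega8 ^+ 4 * (omega8 + (omega8 ^+ 8) ^+ 3 * omega8 ^+ 7)); first by ring.
  by rewrite omega8_8 h4 expr1n mul1r h1; ring.
- transitivity (omega8 ^+ 4 * (omega8 ^+ 2 + (omega8 ^+ 8) ^+ 3 * (omega8 ^+ 7) ^+ 2)); first by ring.
  by rewrite omega8_8 h4 expr1n mul1r h2; ring.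
- transitivity (omega8 ^+ 7 + (omega8 ^+ 8) ^+ 6 * omega8); first by ring.
  by rewrite omega8_8 expr1n mul1r addrC h1; ring.
Qed.

Lemma count8E j s : (count8 j s)%:R = \sum_(e <- s) (mod8 e == j)%:R :> algC.
Proof.
by rewrite /count8 size_filter -sum1_count natr_sum big_mkcond; apply: eq_bigr => e _; case: eqP.
Qed.

(** A sum known to be real equals its real part, so six counters determine it as an element of
    Z[sqrt 2] divided by 2. *)
Lemma sum_omega8_real s (X : algC) : X \is Num.real -> \sum_(e <- s) omega8 ^+ e = X ->
  2%:R * X = 2%:R * ((count8 0 s)%:R - (count8 4 s)%:R)
  + sqrtC 2%:R * ((count8 1 s)%:R + (count8 7 s)%:R - ((count8 3 s)%:R + (count8 5 s)%:R)).
Proof.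
move=> hX e; have -> : 2%:R * X = X + X^* by rewrite (CrealP hX); ring.
rewrite -e rmorph_sum -big_split !count8E /=.
rewrite (eq_bigr _ (fun e _ => omega8_pow_real e)) big_split -!mulr_sumr !sumrB !big_split /=.
by [].
Qed.

(* Decides a + b sqrt 2 <= a' + b' sqrt 2; when a <= a' in the first branch the truncated
   difference is 0 and the test succeeds. *)
Definition le_sqrt2 (a b a' b' : nat) : bool :=
  (if b <= b' then (a - a') ^ 2 <= 2 * (b' - b) ^ 2
   else (a <= a') && (2 * (b - b') ^ 2 <= (a' - a) ^ 2))%N.

Lemma le_sqrt2E a b a' b' : le_sqrt2 a b a' b' =
  (a%:R + sqrtC 2%:R * b%:R <= a'%:R + sqrtC 2%:R * b'%:R :> algC).
Proof.
have s0 : 0 <= sqrtC 2%:R :> algC by rewrite sqrtC_ge0 ler0n.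
have sq m n : (n%:R <= sqrtC 2%:R * m%:R :> algC) = (n ^ 2 <= 2 * m ^ 2)%N.
  rewrite -(@ler_pXn2r _ 2) ?nnegrE ?mulr_ge0 ?ler0n // exprMn sqrtCK.
  by rewrite -!natrX -natrM ler_nat.
have sq' m n : (sqrtC 2%:R * m%:R <= n%:R :> algC) = (2 * m ^ 2 <= n ^ 2)%N.
  rewrite -(@ler_pXn2r _ 2) ?nnegrE ?mulr_ge0 ?ler0n // exprMn sqrtCK.
  by rewrite -!natrX -natrM ler_nat.
have sub m n : (m <= n)%N -> n%:R = m%:R + (n - m)%:R :> algC.
  by move=> h; rewrite -natrD subnKC.
rewrite /le_sqrt2; case: ifP => hb.
  rewrite (sub _ _ hb) mulrDr [_ + sqrtC 2%:R * _]addrC [a'%:R + _]addrC -addrA lerD2l [_ + a'%:R]addrC.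
  have [ha|ha] := leqP a a'; last by rewrite (sub _ _ (ltnW ha)) lerD2l sq.
  rewrite (eqP ha) exp0n //; apply/esym/(le_trans (_ : _ <= a'%:R)); first by rewrite ler_nat.
  by rewrite lerDl mulr_ge0 ?ler0n.
have hb' : (b' <= b)%N by lia.
rewrite (sub _ _ hb') mulrDr [a%:R + _]addrC [a'%:R + _]addrC -addrA lerD2l [_ + a%:R]addrC.
have [ha|ha] := leqP a a'; first by rewrite (sub _ _ ha) lerD2l sq'.
apply/esym/negbTE/negP => h.
have : a%:R <= a'%:R :> algC by apply: le_trans h; rewrite lerDl mulr_ge0 ?ler0n.
by rewrite ler_nat leqNgt ha.
Qed.

Section PathsCp.
Local Notation CF := (Cp false).

Lemma Cp_allbits : CF allbits.
Proof.
apply: (Cp_iter (h := fun p : nat * seq (seq bool) =>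
  [seq false :: s | s <- p.2] ++ [seq true :: s | s <- p.2])) => //; cp.
Qed.

Lemma Cp_mod8 : CF mod8.
Proof.
apply: (Cp_iter (h := fun p : nat * nat => if p.2 == 7%N then 0%N else p.2.+1)) => //; cp.
Qed.

Lemma Cp_count8 j : CF (count8 j).
Proof. have h := Cp_mod8; rewrite /count8; cp. Qed.

Lemma Cp_le_sqrt2 X {eX : Enc X} (a b a' b' : X -> nat) : CF a -> CF b -> CF a' -> CF b' ->
  CF (fun x => le_sqrt2 (a x) (b x) (a' x) (b' x)).
Proof. move=> h1 h2 h3 h4; rewrite /le_sqrt2; cp. Qed.

Lemma Cp_paths : CF (fun p : nat * seq ggate * seq bool => paths p.1.1 p.1.2 p.2).
Proof.
apply: (Cp_foldl (h := fun p : (nat * seq ggate * seq bool) * (ggate * seq (seq bool * nat)) =>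
  flatten [seq branch p.1.1.1 p.2.1 q | q <- p.2.2])) => //; try by cp.
rewrite /branch /valid /setb; cp.
Qed.

Lemma Cp_circ_phases : CF (fun p : circuit * seq bool => circ_phases p.1 p.2).
Proof.
have h1 := Cp_paths; have h2 := Cp_allbits.
have h3 : CF out_bits by exact: Cp_out_bits Cp_id.
have h4 : CF norm_phases by rewrite /norm_phases; cp.
rewrite /circ_phases /phases; cp.
Qed.
End PathsCp.

(** * The verifier *)

(** The window of [output] grows with the number of coins, so the claim is transported to
    [universal], which reads the whole zipper and stays put in the halting state. *)
Lemma output_halted M T l c d : halts_within M T (ones l) -> size c = T ->
  output M (ones l) (c ++ d) = output M (ones l) c.
Proof.
move=> hT hc; rewrite -!(universalE M [::]) cats0 /universal foldl_cat.
have h (cf : config M) z s : simulates cf z ->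
    simulates (foldl (@step M) cf s) (foldl (fun z b => ustep (table M ++ [::]) b z) z s).
  by elim: s cf z => //= b s IH cf z h; apply: IH; exact: ustep_simulates.
have h0 : simulates (init_config M (ones l)) (0%N, ([::], nseq l 2)).
  by exists [::], (ones l); split => //=; rewrite map_nseq.
have [L [R [e _ _]]] := h _ _ c h0.
rewrite cats0 in e; move: e; set z := foldl _ _ c => e.
have hz b : ustep (table M) b z = z.
  rewrite /ustep e /=; have /(_ (Tuple (introT eqP hc))) := hT; rewrite /run /= => ->.
  by rewrite /halt_state eqxx.
by elim: d => //= b d; rewrite hz.
Qed.

Lemma avg_output_le M T T' l (g : seq bool -> algC) : halts_within M T (ones l) -> (T <= T')%N ->
  avg T' (fun c => g (output M (ones l) c)) = avg T (fun c => g (output M (ones l) c)).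
Proof.
move=> h /subnKC <-; rewrite avg_cat; apply: eq_avg => c hc.
rewrite -[RHS](avg_const (T' - T)); apply: eq_avg => d _; by rewrite (output_halted _ h).
Qed.

(** The first [l] uniform bits are the program: a code of length e is a prefix with probability
    2^-e. The remaining [tb l l] coins suffice for any fixed PPT machine once [l] exceeds its
    exponent. *)
Definition mixture (l : nat) (tau : seq bool) : algC :=
  avg (l + tb l l) (fun w => (universal (parse (take l w)) l (drop l w) == tau)%:R).

Lemma mixture_ge0 l tau : 0 <= mixture l tau.
Proof. by apply: avg_ge0 => w; rewrite ler0n. Qed.

Lemma lsum_le1 L u : lsum L (fun s => (u == s)%:R) <= 1.
Proof.
have [h|h] := leqP (size u) L.
  by rewrite -[X in _ <= X](lsum_pick (fun=> 1) h) (@eq_lsum _ _ (fun s => (u == s)%:R * 1)) // => s; rewrite mulr1.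
rewrite lsumE big1 ?ler01 // => j _; rewrite bsum_tuple big1 // => c _.
by case: eqP => // e; move: h; rewrite e size_tuple ltnNge -ltnS ltn_ord.
Qed.

Lemma lsum_mixture L l : lsum L (mixture l) <= 1.
Proof.
rewrite lsum_avg -[X in _ <= X](avg_const (l + tb l l)); apply: avg_le => w _; exact: lsum_le1.
Qed.

Lemma tb_diag k l : (k <= l)%N -> (tb k l <= tb l l)%N.
Proof.
case: l => [|l] h; first by move: h; rewrite leqn0 => /eqP ->.
by rewrite /tb leq_add // leq_mul // leq_pexp2l.
Qed.

Lemma avg_pick n e h : size e = n -> (forall c, 0 <= h c) -> h e <= (2 ^ n)%:R * avg n h.
Proof.
move=> /eqP he hh; have h2 : (2 ^ n)%:R != 0 :> algC by rewrite pnatr_eq0 expn_eq0.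
rewrite avg_bsum -natrX mulrC divfK // bsum_tuple (bigD1 (Tuple he)) //= lerDl.
exact: sumr_ge0.
Qed.

(* Each machine B is a component of the mixture, of weight 2 to the minus its code length. *)
Lemma ppt_mixture B kB l tau : is_PPT B kB -> (kB <= l)%N -> (size (unparse (table B)) <= l)%N ->
  ppt_dist B kB l tau <= (2 ^ size (unparse (table B)))%:R * mixture l tau.
Proof.
move=> hB hk; set e := unparse _ => hs.
have eqn : (l + tb l l = size e + ((l - size e) + tb l l))%N by rewrite addnA subnKC.
rewrite /mixture eqn avg_cat.
apply: le_trans (avg_pick (erefl (size e)) _); last by move=> c; apply: avg_ge0 => d; rewrite ler0n.
rewrite avg_cat -[X in X <= _](avg_const (l - size e)); apply: avg_le => t ht.
(* The machine has halted after [tb kB l] coins, so granting it [tb l l] coins does not change its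
   distribution. *)
rewrite /ppt_dist outprob_avg -(avg_output_le (fun o => (o == tau)%:R) (hB l) (tb_diag hk)).
apply: avg_le => c _; have het : size (e ++ t) = l by rewrite size_cat ht subnKC.
by rewrite catA (take_size_cat _ het) (drop_size_cat _ het) parse_cat universalE.
Qed.

Lemma sum_nseq k s (F : nat -> algC) : \sum_(e <- flatten (nseq k s)) F e = k%:R * \sum_(e <- s) F e.
Proof.
elim: k => [|k IH]; first by rewrite big_nil mul0r.
by rewrite /= big_cat IH -natr1 mulrDl mul1r addrC.
Qed.

Section Verdict.
Variables (P : PTM) (kP : nat) (D : nat -> nat).

Definition circuits (l : nat) : seq circuit :=
  [seq decode (universal (table P) l c) | c <- allbits (tb kP l)].

(** A common exponent for the denominators of all circuits; the sum is a computable upper bound of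
    each [hcount]. *)
Definition hsum (l : nat) : nat := sumn [seq hcount d.1.1 d.2 | d <- circuits l].

(** Repeating a list of phases multiplies its sum by an integer, which brings all circuits to the
    denominator [2 ^ hsum l]. *)
Definition all_phases (l : nat) (tau : seq bool) : seq nat :=
  flatten [seq flatten (nseq (2 ^ (hsum l - hcount d.1.1 d.2)) (circ_phases d tau)) | d <- circuits l].

Definition mixture_count (l : nat) (tau : seq bool) : nat :=
  size [seq w <- allbits (l + tb l l) | universal (parse (take l w)) l (drop l w) == tau].

(* The inequality mixture l tau <= D l * qpt_dist P kP l tau with denominators cleared. *)
Definition verdict (p : nat * seq bool) : bool :=
  let l := p.1 in let s := all_phases l p.2 in let E := (D l * 2 ^ (l + tb l l))%N in
  le_sqrt2 (mixture_count l p.2 * 2 ^ (hsum l + tb kP l) * 2 + E * (2 * count8 4 s))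
    (E * (count8 3 s + count8 5 s)) (E * (2 * count8 0 s)) (E * (count8 1 s + count8 7 s)).

Lemma mixture_countE l tau : mixture l tau = (mixture_count l tau)%:R / (2 ^ (l + tb l l))%:R.
Proof.
rewrite /mixture avg_bsum natrX -sum_allbits /mixture_count size_filter -sum1_count natr_sum.
by rewrite [in RHS]big_mkcond; congr (_ / _); apply: eq_bigr => w _; case: eqP.
Qed.

Lemma sum_all_phases l tau : \sum_(e <- all_phases l tau) omega8 ^+ e =
  (2 ^ (hsum l + tb kP l))%:R * qpt_dist P kP l tau.
Proof.
rewrite sum_flatten qpt_dist_avg avg_bsum -sum_allbits.
have h2 n : 2%:R ^+ n != 0 :> algC by rewrite expf_neq0 // pnatr_eq0.
rewrite natrX exprD -mulrA [_ * (_ / _)]mulrC divfK // mulr_sumr.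
have hle d : d \in circuits l -> (hcount d.1.1 d.2 <= hsum l)%N.
  rewrite /hsum; elim: (circuits l) => //= d' s IH; rewrite inE => /orP [/eqP ->|/IH]; lia.
rewrite (eq_big_seq (fun d => 2%:R ^+ hsum l * circprob (to_circ d) tau)); last first.
  move=> d /hle hd; rewrite sum_nseq sum_circ_phases mulrA natrX -exprD subnK //.
rewrite big_map; apply: eq_bigr => c _.
by rewrite decodeE -[table P]cats0 universalE.
Qed.

Lemma verdictE l tau : verdict (l, tau) = (mixture l tau <= (D l)%:R * qpt_dist P kP l tau).
Proof.
rewrite /verdict le_sqrt2E /=; set s := all_phases l tau.
have r := ger0_real (qpt_dist_ge0 P kP l tau).
have rx : (2 ^ (hsum l + tb kP l))%:R * qpt_dist P kP l tau \is Num.real by rewrite rpredM ?realn.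
have := sum_omega8_real rx (sum_all_phases l tau); rewrite -/s mixture_countE.
set q := qpt_dist _ _ _ _; set S := (2 ^ (hsum l + _))%N; set U := (2 ^ (l + _))%N => e.
have U0 : 0 < U%:R :> algC by rewrite ltr0n expn_gt0.
have S0 : 0 < S%:R :> algC by rewrite ltr0n expn_gt0.
have S2 : 0 < 2%:R * S%:R :> algC by rewrite mulr_gt0 // ltr0n.
rewrite ler_pdivrMr // -[in RHS](ler_pM2l S2) -[LHS]subr_ge0 -[RHS]subr_ge0.
congr (0 <= _); rewrite !(natrD, natrM).
have -> : 2%:R * S%:R * ((D l)%:R * q * U%:R) = (D l)%:R * U%:R * (2%:R * (S%:R * q)) :> algC by ring.
by rewrite e; ring.
Qed.

Lemma verdict_complete l : (0 < D l)%N -> 1 - (D l)%:R^-1 <= qexp P kP l (fun t => (verdict (l, t))%:R).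
Proof.
move=> hD; have D0 : 0 < (D l)%:R :> algC by rewrite ltr0n.
rewrite -(expect_qpt _ _ (leqnn (tb kP l + l))) -[X in X - _](qexp1 P kP l).
rewrite -(expect_qpt _ _ (leqnn (tb kP l + l))) !expectE lerBlDr.
(* Pointwise: an accepted string pays for its own probability, a rejected one has probability below
   the mixture divided by [D l]. *)
apply: le_trans (_ : lsum (tb kP l + l) (fun s => qpt_dist P kP l s * (verdict (l, s))%:R
    + (D l)%:R^-1 * mixture l s) <= _).
  apply: ler_lsum => s; case e : (verdict (l, s)).
    by rewrite lerDl mulr_ge0 ?mixture_ge0 // invr_ge0 ler0n.
  rewrite mulr0 mulr1 add0r mulrC ler_pdivlMr //; move/negbT: e; rewrite verdictE.
  have r1 := ger0_real (mixture_ge0 l s).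
  have r2 : (D l)%:R * qpt_dist P kP l s \is Num.real by rewrite rpredM ?realn // ger0_real // qpt_dist_ge0.
  by rewrite -real_ltNge // mulrC => /ltW.
rewrite lsumD lsumZ lerD2l ler_piMr ?lsum_mixture // invr_ge0 ler0n //.
Qed.

Lemma Cp_verdict : Cp false D -> Cp false verdict.
Proof.
move=> hD; have h1 := @Cp_circ_phases; have h2 := Cp_allbits.
have h3 j : Cp false (count8 j) by exact: Cp_count8.
have h4 : Cp false decode by exact: Cp_decode.
have h5 : Cp false (fun p : nat * seq bool => universal (table P) p.1 p.2) by apply: Cp_universal; cp.
have h6 : Cp false (fun p : seq nat * nat * seq bool => universal p.1.1 p.1.2 p.2) by apply: Cp_universal; cp.
have h7 : Cp false parse by apply: Cp_parse; exact: Cp_id.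
have h8 : Cp false circuits by rewrite /circuits; cp.
have h9 : Cp false hsum by rewrite /hsum /hcount /valid; cp.
have h10 : Cp false (fun p : nat * seq bool => all_phases p.1 p.2).
  rewrite /all_phases /hcount /valid; cp; apply: Cp_expn; cp.
have h11 : Cp false (fun p : nat * seq bool => mixture_count p.1 p.2).
  by rewrite /mixture_count /tb; cp; apply: Cp_expn; cp.
have h30 := h3 0%N; have h31 := h3 1%N; have h33 := h3 3%N; have h34 := h3 4%N.
have h35 := h3 5%N; have h37 := h3 7%N.
have h12 : Cp false (fun x : nat * seq bool => tb x.1 x.1) by rewrite /tb; cp; apply: Cp_expn; cp.
apply: Cp_le_sqrt2; cp; apply: Cp_expn; cp.
Qed.
End Verdict.

(** * Choice of parameters *)

Lemma tb_gt0 k l : (0 < k)%N -> (0 < tb k l)%N.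
Proof. by move=> h; rewrite /tb addn_gt0 h orbT. Qed.

(** Replaces a rational polynomial by a positive natural number that the machines can compute. *)
Lemma pval_bound (p : {poly rat}) : exists2 K, (0 < K)%N & forall l, pval p l <= (tb K l)%:R.
Proof.
elim/poly_ind: p => [|p c [K hK IH]].
  by exists 1%N => // l; rewrite /pval horner0 rmorph0 ler0n.
pose n := Num.bound `|c|.
have hc : ratr c <= n%:R :> algC.
  rewrite -(ratr_nat _ n) ler_rat; apply: le_trans (ler_norm c) _.
  exact/ltW/archi_boundP/normr_ge0.
exists (2 * K + n + 1)%N => [|l]; first by rewrite addn1.
rewrite /pval hornerMXaddC rmorphD rmorphM /= ratr_nat.
apply: le_trans (_ : (tb K l)%:R * l%:R + n%:R <= _).
  by rewrite lerD // ler_wpM2r ?ler0n // IH.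
rewrite -natrM -natrD ler_nat /tb; case: l => [|l]; first by rewrite muln0; lia.
set m := (2 * K + n + 1)%N.
have h1 : (l.+1 ^ K * l.+1 <= l.+1 ^ m)%N by rewrite -expnSr leq_pexp2l // /m; lia.
have h2 : (l.+1 <= l.+1 ^ m)%N by rewrite -{1}[l.+1]expn1 leq_pexp2l // /m; lia.
have h3 : (K * (l.+1 ^ K * l.+1) <= K * l.+1 ^ m)%N by rewrite leq_mul2l h1 orbT.
have h4 : (K * l.+1 <= K * l.+1 ^ m)%N by rewrite leq_mul2l h2 orbT.
rewrite mulnDl -mulnA; apply: (@leq_trans (2 * K * l.+1 ^ m + n)%N); first by lia.
rewrite leq_add //; last by rewrite /m; lia.
by rewrite leq_mul2r /m; apply/orP; right; lia.
Qed.

Lemma pval_tb K l : pval (K%:R *: 'X^K + K%:R%:P) l = (tb K l)%:R.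
Proof.
rewrite /pval hornerD hornerZ hornerXn hornerC rmorphD rmorphM rmorphXn /= !ratr_nat.
by rewrite /tb natrD natrM natrX.
Qed.

(** Of the exponent 3K + 2, the part 3K covers the cube of [tb K l]. One further factor [l.+1]
    absorbs the coefficient (2K)^3 and the other absorbs [C], which is unknown when the number of
    copies is fixed. *)
Lemma ncopies_large C K l : (C <= l)%N -> ((2 * K) ^ 3 <= l)%N ->
  (C * tb K l ^ 3 <= ncopies (3 * K + 2) l)%N.
Proof.
move=> h1 h2; apply: leq_trans (ncopies_ge _ _).
have h3 : (tb K l <= 2 * K * l.+1 ^ K)%N.
  have e1 : (l ^ K <= l.+1 ^ K)%N by exact: leq_expr.
  have e2 : (K * l ^ K <= K * l.+1 ^ K)%N by rewrite leq_mul2l e1 orbT.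
  have e3 : (K <= K * l.+1 ^ K)%N by rewrite leq_pmulr // expn_gt0.
  by rewrite /tb; lia.
apply: (@leq_trans (l.+1 * (l.+1 * (l.+1 ^ K) ^ 3))%N); last first.
  by rewrite -expnM -!expnS mulnC addn2.
apply: leq_mul; first by lia.
apply: (@leq_trans ((2 * K * l.+1 ^ K) ^ 3)%N); first by exact: leq_expr.
by rewrite expnMn leq_mul2r; apply/orP; right; lia.
Qed.

Lemma QAS_IVPoQ : QAS_exist -> IVPoQ_exist.
Proof.
move=> [A [kA [hA [p hq]]]].
(* The extracted sampler will be within 4/D of [A], so [D] has to dominate 4 times the hardness
   polynomial [p]. *)
have [K K0 hK] := pval_bound (4%:R *: p).
pose K' := (3 * K + 2)%N; pose N := ncopies K'.
have cN (pl : bool) : Cp pl N by exact: Cp_ncopies.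
have [P [kP [hP hPE]]] : exists M k, is_PPT M k /\ forall l g,
    avg (tb k l) (fun c => g (output M (ones l) c)) =
    avg (tb kA l * N l) (fun r => g (encode (copies_circ (table A) kA (N l) l r))).
  apply: (ppt_realized (m := fun l => (tb kA l * N l)%N)
    (F := fun p => encode (copies_circ (table A) kA (N p.1) p.1 p.2))); first by apply: Cp_mul; [cp|exact: cN].
  exact: Cp_copies_circ.
pose D := tb K.
have D0 l : (0 < D l)%N by exact: tb_gt0.
have D_neq0 l : (D l)%:R != 0 :> algC by rewrite pnatr_eq0 -lt0n.
have [V [tV [hV hVE]]] : exists V tV, is_verifier V tV /\
    forall l tau, vacc V tV l tau = (verdict P kP D (l, tau))%:R.
  by apply: verifier_realized; apply: Cp_verdict; rewrite /D; cp.
exists P, kP; split=> //; exists V, tV; split=> //.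
(* Completeness error 1/D against soundness error 2/D leaves the gap 1/D. *)
exists (fun l => 1 - (D l)%:R^-1), (fun l => 1 - 2%:R / (D l)%:R); split; last split.
- exists (K%:R *: 'X^K + K%:R%:P), 0%N => l _; rewrite pval_tb ltr0n; split; first exact: D0.
  have -> : 1 - (D l)%:R^-1 - (1 - 2%:R / (D l)%:R) = (D l)%:R^-1 :> algC by field.
  by [].
- exists 0%N => l _; rewrite expect_qpt //; apply: le_trans (verdict_complete _ _ (D0 l)) _.
  by apply: qexp_le => t; rewrite hVE.
move=> B kB hB; pose C := (2 ^ size (unparse (table B)))%N.
(* The extracted sampler runs [B] on its first coins and uses the last [ncoins K' l] to pick one of
   the samples contained in the output. *)
have [B' [kB' [hB' hBE]]] : exists M k, is_PPT M k /\ forall l g,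
    avg (tb k l) (fun c => g (output M (ones l) c)) =
    avg (tb kB l + ncoins K' l) (fun r => g ((fun p : nat * seq bool =>
      sample (sel (drop (tb kB p.1) p.2) (2 * width kA p.1 * N p.1)
        (universal (table B) p.1 (take (tb kB p.1) p.2)))) (l, r))).
  apply: (ppt_realized (m := fun l => (tb kB l + ncoins K' l)%N)
    (F := fun p : nat * seq bool => sample (sel (drop (tb kB p.1) p.2) (2 * width kA p.1 * N p.1)
        (universal (table B) p.1 (take (tb kB p.1) p.2))))).
    have h := @Cp_ncoins true K'; cp.
  have h1 := @Cp_sample true; have h2 := @Cp_sel true.
  have h3 : Cp true (fun p : nat * seq bool => universal (table B) p.1 p.2) by apply: Cp_universal; cp.
  have h4 := cN true.
  rewrite /width; cp.
have [l1 h1] := hq B' kB' hB'.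
(* Beyond this threshold [A] is hard for [B'], the mixture grants [B] enough coins, and the number
   of copies is large enough. That [l] is at least [C] also bounds the code length of [B] by [l]. *)
exists (maxn l1 (maxn kB (maxn C ((2 * K) ^ 3)))) => l; rewrite !geq_max => /and4P [g1 g2 g3 g4].
rewrite expect_ppt //.
have r1 : avg (tb kB l) (fun c => vacc V tV l (output B (ones l) c)) \is Num.real.
  by apply: ger0_real; apply: avg_ge0 => c; exact: vacc_ge0.
have r2 : (1 - 2%:R / (D l)%:R : algC) \is Num.real by rewrite rpredB ?rpred1 // ger0_real // divr_ge0 ?ler0n.
rewrite real_leNgt //; apply/negP => hlt.
have [p0 hsd] := h1 l g1.
have g5 : (size (unparse (table B)) <= l)%N by apply: leq_trans g3; exact/ltnW/ltn_expl.
have close : sd (tb kA l + tb kB' l + l) (qpt_dist A kA l) (ppt_dist B' kB' l) <= 4%:R / (D l)%:R.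
  apply: (@sampler_close A P B B' kA kP kB kB' (ncoins K' l) l C (D l) (fun t => verdict P kP D (l, t))).
  - by move=> g; rewrite hPE /N ncopiesE.
  - move=> g; rewrite hBE /=; apply: eq_avg => r _.
    by rewrite /N ncopiesE -[table B]cats0 universalE.
  - exact: D0.
  - by rewrite -ncopiesE; exact: ncopies_large.
  - move=> t; rewrite verdictE => ht; apply: le_trans (ppt_mixture t hB g2 g5) _.
    by rewrite -mulrA ler_wpM2l ?ler0n.
  - apply/ltW; apply: lt_le_trans hlt _; apply: avg_le => c _; by rewrite hVE.
(* Now 1/p < 4/D, that is D < 4p, against the choice of [D]. *)
have /lt_le_trans/(_ close) := hsd.
rewrite -(ltr_pM2l p0) mulfV ?gt_eqF // mulrA ltr_pdivlMr ?ltr0n // mul1r.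
by have := hK l; rewrite pvalZ mulrC => /le_lt_trans h /h; rewrite ltxx.
Qed.

Theorem theorem1p3 : QAS_exist <-> IVPoQ_exist.
Proof. by split; [exact: QAS_IVPoQ | exact: IVPoQ_QAS]. Qed.
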